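(* For each $\nu>-1$ the radius of starlikeness $r^\star(v_\nu)$ satisfies $r^\star(v_\nu)<\sqrt[4]{4(\nu+1)^2(\nu+2)}$. Moreover, if $\nu>-1$, then $$2\sqrt[4]{\frac{(\nu+1)^2(\nu+2)}{5}}<r^\star(v_\nu)<2\sqrt[4]{\frac{5(\nu+1)(\nu+1)_4}{16\nu^2+157\nu+291}},$$ $$2\sqrt[8]{\frac{(\nu+1)_4(\nu+1)^3(\nu+2)}{16\nu^2+157\nu+291}}<r^\star(v_\nu)<\sqrt[4]{\frac{8(\nu+1)(\nu+1)_3(\nu+5)_2(16\nu^2+157\nu+291)}{\nu_9}}$$ and $$\sqrt[12]{\frac{2^{11}(\nu+1)_3(\nu+1)_6(\nu+1)^4(\nu+2)}{\nu_9}}<r^\star(v_\nu)<2\sqrt[4]{\frac{2(\nu+1)^2(\nu+2)(\nu+4)(\nu+7)_2\,\nu_9}{\nu_{10}}},$$ where $$\nu_9=32\nu^5+792\nu^4+7753\nu^3+35977\nu^2+78453\nu+64469$$ and $$\nu_{10}=256\nu^8+11520\nu^7+224672\nu^6+2469757\nu^5+16606040\nu^4+69429816\nu^3+175324950\nu^2+243560267\nu+142215442.$$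
   Context: For $\nu>-1$, with $J_\nu,I_\nu$ the Bessel and modified Bessel functions of the first kind, $$\mathbf{\Pi}_\nu(z)=J_\nu(z)I_\nu(z)=\sum_{n\ge0}\frac{(-1)^n(z/2)^{2\nu+4n}}{n!\,\Gamma(\nu+n+1)\Gamma(\nu+2n+1)},$$ $$v_\nu(z)=2^{2\nu}z^{-2\nu+1}\Gamma^2(\nu+1)\mathbf{\Pi}_\nu(z)=\sum_{n\ge0}\frac{(-1)^n z^{4n+1}}{2^{4n}n!\,(\nu+1)_n(\nu+1)_{2n}}.$$ The radius of starlikeness is $r^\star(f)=\sup\{r>0:\operatorname{Re}(zf'(z)/f(z))>0\text{ for all }|z|<r\}$. Pochhammer symbol: $(a)_0=1$, $(a)_n=a(a+1)\cdots(a+n-1)$. *)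

(* Defs.v *)
(* Classical reals of the Stdlib, with Coquelicot for complex numbers, limits,
   series and integrals. *)
From Stdlib Require Import Reals Factorial.
From Coquelicot Require Import Coquelicot.
Open Scope R_scope.

(* Euler's integral; used only for 0 < x, where it converges. *)
Definition Gamma (x : R) : R :=
  RInt_gen (fun t : R => Rpower t (x - 1) * exp (- t))
    (at_right 0) (Rbar_locally p_infty).

Fixpoint pochhammer (a : R) (n : nat) : R :=
  match n with
  | O => 1
  | S m => pochhammer a m * (a + INR m)
  end.

(* The n-th root of x, for x > 0 only: Rpower is not meaningful otherwise. *)
Definition root (n : nat) (x : R) : R := Rpower x (/ INR n).

(* Principal argument, in (-PI, PI], of z <> 0. *)
Definition Carg (z : C) : R :=
  if Rle_dec 0 (Im z) then acos (Re z / Cmod z) else - acos (Re z / Cmod z).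

(* Principal branch of z^a for z <> 0. *)
Definition CRpower (z : C) (a : R) : C :=
  (Rpower (Cmod z) a * cos (a * Carg z), Rpower (Cmod z) a * sin (a * Carg z)).

Definition CSeries (a : nat -> C) : C :=
  (Series (fun n => Re (a n)), Series (fun n => Im (a n))).

(* The Bessel functions below are meant for z <> 0 and -1 < nu; then all the
   arguments of Gamma are positive. *)
Definition BesselJ (nu : R) (z : C) : C :=
  CSeries (fun n =>
    (RtoC ((-1) ^ n / (INR (fact n) * Gamma (nu + INR n + 1)))
     * CRpower (z / RtoC 2) (2 * INR n + nu))%C).

Definition BesselI (nu : R) (z : C) : C :=
  CSeries (fun n =>
    (RtoC (1 / (INR (fact n) * Gamma (nu + INR n + 1)))
     * CRpower (z / RtoC 2) (2 * INR n + nu))%C).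

Definition Bessel_Pi (nu : R) (z : C) : C := (BesselJ nu z * BesselI nu z)%C.

(* The jumps of the principal powers across the negative real axis cancel in the
   product, and the singularity at 0 is removable with value 0: this is the
   entire function
     sum_n (-1)^n z^(4n+1) / (2^(4n) n! (nu+1)_n (nu+1)_(2n)). *)
Definition v (nu : R) (z : C) : C :=
  if Ceq_dec z (RtoC 0) then RtoC 0
  else
    (RtoC (Rpower 2 (2 * nu)) * CRpower z (- 2 * nu + 1)
     * RtoC (Gamma (nu + 1) ^ 2) * Bessel_Pi nu z)%C.

(* For f analytic with f(0) = 0 and f'(0) = 1, the quotient z f'(z) / f(z) extends
   to z = 0 with the value 1, so the condition is only imposed at z <> 0.  The
   supremum is taken in the extended reals. *)
Definition radius_starlikeness (f : C -> C) : Rbar :=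
  Lub_Rbar (fun r : R =>
    0 < r /\
    forall z : C, z <> RtoC 0 -> Cmod z < r ->
      f z <> RtoC 0 /\ 0 < Re (z * C_derive f z / f z)%C).

Definition nu9 (nu : R) : R :=
  32 * nu ^ 5 + 792 * nu ^ 4 + 7753 * nu ^ 3 + 35977 * nu ^ 2 + 78453 * nu
  + 64469.

Definition nu10 (nu : R) : R :=
  256 * nu ^ 8 + 11520 * nu ^ 7 + 224672 * nu ^ 6 + 2469757 * nu ^ 5
  + 16606040 * nu ^ 4 + 69429816 * nu ^ 3 + 175324950 * nu ^ 2
  + 243560267 * nu + 142215442.

(* Main.v *)
Require Import Defs.
From Stdlib Require Import Arith Reals Factorial Lra Lia Psatz.
From Stdlib Require Import FunctionalExtensionality Classical_Prop.
From Coquelicot Require Import Coquelicot.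
Open Scope R_scope.

(** Write [a = nu + 1] and [F_a(x) = sum_n (-x)^n / (n! (a)_n)], so that [J_nu(z)] and
[I_nu(z)] are, up to the factor [(z/2)^nu / Gamma(a)], the values [F_a((z/2)^2)] and
[F_a(-(z/2)^2)]. The product [F_a(x) F_a(-x)] is even in [x], so
[v_nu(z) = z Phi(z^4)] for an entire [Phi] with [Phi(0) = 1] (lemma [v_quartic];
the gamma factors cancel by [Gamma (x + 1) = x Gamma x]).

If [1 / x_n] runs over the inverse zeros of [F_a], let [s_k = sum_n x_n^(-k)] be the
Rayleigh sums and [m_k = s_(2k) / 16^k] the corresponding power sums of the inverse
zeros of [Phi]. Logarithmic differentiation gives
[z v'(z) / v(z) = 1 - 4 M(z^4)] with [M(w) = sum_k m_k w^k], for [|w| < 1 / m_1].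
As all [m_k] are positive, the real part of the right-hand side on [|z| = r] is least
at [z = r]. Hence the fourth power of the radius is the root of the single real
equation [M(w) = 1/4] (lemmas [radius_gt] and [radius_lt]), and every bound of the
theorem says on which side of 1/4 the value of [M] at an explicit point lies.
The points are [1 / (4 m_1)], and [sigma_k^(-1/k)] and [sigma_k / sigma_(k+1)] for
[k = 1, 2, 3], with [sigma_k] the power sums of the inverse zeros of
[Phi + 4 w Phi'], i.e. of [v'] in the variable [w = z^4].

The zeros themselves are never constructed. The sums [s_k] are the coefficients of
the logarithmic derivative of [F_a] as a formal power series, and what one would read
off from real zeros is obtained from two identities between formal series:
the Riccati equation of [F_a], which is Rayleigh's convolution formula
[(a + n - 1) s_n = sum_i s_i s_(n-i)], and the continued fraction
[R_a = 1 + x R_a R_(a+1) / (a (a + 1))] of [R_a = F_(a+1) / F_a].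
- The continued fraction makes every [R_a] the generating function of a renewal
  sequence whose weights are the coefficients of [R_(a+1)]. Renewal sequences of
  log-convex weights are log-convex ([renewal_log_convex]), so by induction on the
  order, [s_n^2 <= s_(n-1) s_(n+1)].
- Every zero counts once, so [s_k^(1/k)] decreases with [k]. In terms of sequences:
  [s_n >= rho^n] where [rho] is the supremum of the ratios [s_(n+1) / s_n]. If this
  failed, the convolution formula would force [s_n] to decay faster than
  [(gamma rho)^n] for some [gamma < 1], which log-convexity excludes
  ([rayleigh_ge_sup], [rayleigh_power_mean]).

With these two facts the tail of [M] is bounded below by a geometric series whose
ratio is [m_(n+1) / m_n] ([zero_sum_lower]) and above by a geometric series in
[m_n^(1/n) w] ([zero_sum_upper]). The first gives the upper bounds for the radius, by
the positivity of explicit polynomials in [a]; the second gives the lower bounds, by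
inequalities that hold with a defect divisible by [1 - 5 g], where [g = 1/5] is the
case of a single zero. *)

(** * Formal power series *)

Notation series := (nat -> R).
Definition tail (p : series) : series := fun n => p (S n).
(** The recursion splits off the constant term of [p]. It makes the ring axioms
    immediate by induction; the usual convolution sum is [smul_sum]. *)
Fixpoint smul (p q : series) (n : nat) : R :=
  match n with
  | O => p O * q O
  | S m => p O * q (S m) + smul (tail p) q m
  end.
Definition szero : series := fun _ => 0.
Definition sone : series := fun n => match n with O => 1 | S _ => 0 end.
Definition sX : series := fun n => match n with S O => 1 | _ => 0 end.
Definition sadd (p q : series) : series := fun n => p n + q n.
Definition sopp (p : series) : series := fun n => - p n.
Definition ssub (p q : series) : series := fun n => p n - q n.
Definition sconst (c : R) : series := fun n => match n with O => c | S _ => 0 end.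
(** The derivation [x d/dx]. *)
Definition theta (p : series) : series := fun n => INR n * p n.
(** Long division: the remainder after the constant term is divided by [x] and by
    [q] again. It is the quotient only when [q] has constant term 1. *)
Fixpoint sdiv (p q : series) (n : nat) : R :=
  match n with
  | O => p O
  | S m => sdiv (fun k => p (S k) - p O * q (S k)) q m
  end.

Lemma smul_sum : forall p q n,
  smul p q n = sum_f_R0 (fun k => p k * q (n - k)%nat) n.
Proof.
intros p q n; revert p; induction n as [|n IH]; intros p; [reflexivity|].
rewrite decomp_sum by lia; cbn [smul pred]; rewrite IH, Nat.sub_0_r.
reflexivity.
Qed.

Lemma smul_add_l : forall p p' q n,
  smul (sadd p p') q n = smul p q n + smul p' q n.
Proof.
intros p p' q n; revert p p'; induction n as [|n IH]; intros p p'; cbn.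
- unfold sadd; ring.
- change (tail (sadd p p')) with (sadd (tail p) (tail p')); rewrite IH.
  unfold sadd; ring.
Qed.

Lemma smul_scal_l : forall c p q n,
  smul (fun k => c * p k) q n = c * smul p q n.
Proof.
intros c p q n; revert p; induction n as [|n IH]; intros p; cbn.
- ring.
- change (tail (fun k => c * p k)) with (fun k => c * tail p k); rewrite IH; ring.
Qed.

Lemma smul_zero_l : forall q n, smul szero q n = 0.
Proof.
intros q; induction n as [|n IH]; cbn; [unfold szero; ring|].
change (tail szero) with szero; rewrite IH; unfold szero; ring.
Qed.

Lemma smul_S_r : forall p q n,
  smul p q (S n) = p (S n) * q O + smul p (tail q) n.
Proof.
intros p q n; revert p; induction n as [|n IH]; intros p.
- cbn; unfold tail; ring.
- transitivity (p O * q (S (S n)) + smul (tail p) q (S n)); [reflexivity|].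
  rewrite IH; cbn [smul]; unfold tail; ring.
Qed.

Lemma smul_comm_pt : forall p q n, smul p q n = smul q p n.
Proof.
intros p q n; revert p q; induction n as [|n IH]; intros p q.
- cbn; ring.
- rewrite smul_S_r; cbn [smul]; rewrite IH; ring.
Qed.

Lemma smul_assoc_pt : forall p q r n,
  smul (smul p q) r n = smul p (smul q r) n.
Proof.
intros p q r n; revert p; induction n as [|n IH]; intros p.
- cbn; ring.
- cbn [smul].
  assert (E : tail (smul p q) = sadd (fun k => p O * tail q k) (smul (tail p) q))
    by reflexivity.
  rewrite E, smul_add_l, smul_scal_l, IH; cbn; ring.
Qed.

(** Registered as a ring, so that identities between power series are left to
    [ring]; extensionality makes Leibniz equality the right one. *)
Lemma series_ring : ring_theory szero sone sadd smul ssub sopp (@eq series).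
Proof.
constructor; intros; apply functional_extensionality; intros n;
  try (unfold sadd, ssub, sopp, szero; ring).
- destruct n as [|n]; cbn; [ring|].
  change (tail sone) with szero; rewrite smul_zero_l; ring.
- apply smul_comm_pt.
- symmetry; apply smul_assoc_pt.
- apply smul_add_l.
Qed.
Add Ring series_ring_inst : series_ring.

Lemma sX_smul_S : forall p n, smul sX p (S n) = p n.
Proof.
intros p n; cbn [smul].
assert (E : tail sX = sone) by (apply functional_extensionality; intros [|k]; reflexivity).
rewrite E.
replace (smul sone p) with p by ring.
cbn; ring.
Qed.

Lemma sconst_smul : forall c p n, smul (sconst c) p n = c * p n.
Proof.
intros c p n; destruct n as [|n]; [reflexivity|].
cbn; change (tail (sconst c)) with szero; rewrite smul_zero_l; ring.
Qed.

Lemma theta_smul : forall p q,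
  theta (smul p q) = sadd (smul (theta p) q) (smul p (theta q)).
Proof.
intros p q; apply functional_extensionality; intros n.
unfold theta, sadd; rewrite !smul_sum, scal_sum, <- sum_plus.
apply sum_eq; intros i Hi; rewrite minus_INR by lia; ring.
Qed.

Lemma smul_sdiv : forall p q, q O = 1 -> smul q (sdiv p q) = p.
Proof.
intros p q Hq; transitivity (smul (sdiv p q) q); [ring|].
apply functional_extensionality; intros n; revert p.
induction n as [|n IH]; intros p.
- cbn; rewrite Hq; ring.
- cbn [smul]; change (tail (sdiv p q))
    with (sdiv (fun k => p (S k) - p O * q (S k)) q).
  rewrite IH; cbn; ring.
Qed.

Lemma smul_cancel : forall q x y, q O = 1 -> smul q x = smul q y -> x = y.
Proof.
intros q x y Hq E.
transitivity (smul (smul q (sdiv sone q)) x); [rewrite smul_sdiv by assumption; ring|].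
transitivity (smul (sdiv sone q) (smul q x)); [ring|].
rewrite E.
transitivity (smul (smul q (sdiv sone q)) y); [ring|].
rewrite smul_sdiv by assumption; ring.
Qed.

(** * The series of Bessel type and their logarithmic derivatives *)

(** The hypergeometric series [0F1(; a; -x)], i.e. [F_a] above. *)
Definition bessel_series (a : R) : series :=
  fun n => (-1) ^ n / (INR (fact n) * pochhammer a n).
(** The series [R_a = F_(a+1) / F_a]. *)
Definition bessel_ratio (a : R) : series := sdiv (bessel_series (a + 1)) (bessel_series a).
(** The coefficients of [-x F_a' / F_a]: coefficient [k >= 1] is the sum of the
    [k]-th powers of the inverse zeros of [F_a]. Since [F_a' = - F_(a+1) / a], the
    series equals [x R_a / a]. *)
Definition rayleigh (a : R) : series := smul (sconst (/ a)) (smul sX (bessel_ratio a)).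

Lemma pochhammer_pos : forall a n, 0 < a -> 0 < pochhammer a n.
Proof.
intros a n Ha; induction n as [|n IH]; cbn [pochhammer]; [lra|].
apply Rmult_lt_0_compat; [assumption|]; pose proof (pos_INR n); lra.
Qed.

Lemma pochhammer_succ : forall a n,
  pochhammer a (S n) = a * pochhammer (a + 1) n.
Proof.
intros a n; induction n as [|n IH]; [cbn; ring|].
change (pochhammer a (S (S n))) with (pochhammer a (S n) * (a + INR (S n))).
rewrite IH, S_INR; cbn [pochhammer]; ring.
Qed.

Lemma bessel_series_0 : forall a, bessel_series a O = 1.
Proof. intros a; unfold bessel_series; cbn; field. Qed.

Lemma bessel_series_S : forall a n, 0 < a ->
  INR (S n) * (a + INR n) * bessel_series a (S n) = - bessel_series a n.
Proof.
intros a n Ha; unfold bessel_series.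
rewrite fact_simpl, mult_INR; cbn [pochhammer pow].
pose proof (pochhammer_pos a n Ha); pose proof (INR_fact_neq_0 n).
pose proof (pos_INR n); rewrite S_INR.
field; repeat split; lra.
Qed.

Lemma bessel_series_theta : forall a n, 0 < a ->
  INR (S n) * bessel_series a (S n) = - / a * bessel_series (a + 1) n.
Proof.
intros a n Ha; unfold bessel_series.
rewrite pochhammer_succ, fact_simpl, mult_INR; cbn [pow].
pose proof (pochhammer_pos (a + 1) n ltac:(lra)); pose proof (INR_fact_neq_0 n).
pose proof (pos_INR n); rewrite S_INR.
field; repeat split; lra.
Qed.

(** The three-term relation of Bessel functions of consecutive orders. *)
Lemma bessel_series_contiguous : forall a, 0 < a ->
  bessel_series (a + 1) =
  sadd (bessel_series a) (smul (sconst (/ (a * (a + 1)))) (smul sX (bessel_series (a + 1 + 1)))).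
Proof.
intros a Ha; apply functional_extensionality; intros n; unfold sadd.
rewrite sconst_smul; destruct n as [|n].
- rewrite !bessel_series_0; cbn; ring.
- rewrite sX_smul_S; unfold bessel_series.
  rewrite (pochhammer_succ a), fact_simpl, mult_INR; cbn [pow].
  assert (E : pochhammer (a + 1) (S n) = (a + 1) * pochhammer (a + 1 + 1) n)
    by apply pochhammer_succ.
  assert (E' : pochhammer (a + 1) (S n) = pochhammer (a + 1) n * (a + 1 + INR n))
    by reflexivity.
  pose proof (pochhammer_pos (a + 1 + 1) n ltac:(lra)); pose proof (INR_fact_neq_0 n).
  pose proof (pos_INR n).
  rewrite E.
  replace (pochhammer (a + 1) n)
    with ((a + 1) * pochhammer (a + 1 + 1) n / (a + 1 + INR n))
    by (rewrite <- E, E'; field; lra).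
  rewrite S_INR; field; repeat split; lra.
Qed.

Lemma bessel_series_bessel_ratio : forall a,
  smul (bessel_series a) (bessel_ratio a) = bessel_series (a + 1).
Proof. intros a; apply smul_sdiv, bessel_series_0. Qed.

Lemma theta_bessel_series : forall a, 0 < a ->
  theta (bessel_series a) = sopp (smul (bessel_series a) (rayleigh a)).
Proof.
intros a Ha; unfold rayleigh.
transitivity (sopp (smul (sconst (/ a)) (smul sX (smul (bessel_series a) (bessel_ratio a)))));
  [|ring].
rewrite bessel_series_bessel_ratio; apply functional_extensionality; intros n.
unfold theta, sopp; rewrite sconst_smul; destruct n as [|n].
- cbn; ring.
- rewrite sX_smul_S, bessel_series_theta by assumption; ring.
Qed.

(** The contiguous relation divided by [F_a]: one step of the continued
    fraction of [R_a]. *)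
Lemma bessel_ratio_fraction : forall a, 0 < a ->
  bessel_ratio a = sadd sone
    (smul (sconst (/ (a * (a + 1)))) (smul sX (smul (bessel_ratio (a + 1)) (bessel_ratio a)))).
Proof.
intros a Ha; apply (smul_cancel (bessel_series a)); [apply bessel_series_0|].
transitivity (sadd (bessel_series a) (smul (sconst (/ (a * (a + 1))))
   (smul sX (smul (bessel_ratio (a + 1)) (smul (bessel_series a) (bessel_ratio a)))))); [|ring].
rewrite bessel_series_bessel_ratio.
transitivity (sadd (bessel_series a) (smul (sconst (/ (a * (a + 1))))
   (smul sX (smul (bessel_series (a + 1)) (bessel_ratio (a + 1)))))); [|ring].
rewrite bessel_series_bessel_ratio; apply bessel_series_contiguous; assumption.
Qed.

(** Bessel's equation, written with [x d/dx]. *)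
Lemma bessel_series_ode : forall a, 0 < a ->
  sadd (theta (theta (bessel_series a)))
    (sadd (smul (sconst (a - 1)) (theta (bessel_series a))) (smul sX (bessel_series a))) = szero.
Proof.
intros a Ha; apply functional_extensionality; intros n; unfold sadd, theta.
rewrite sconst_smul; destruct n as [|n].
- cbn; unfold szero; ring.
- rewrite sX_smul_S; pose proof (bessel_series_S a n Ha) as E; rewrite S_INR in *.
  unfold szero; nra.
Qed.

(** Substituting [theta F = - F L], [L] the Rayleigh series, in the second-order
    equation and cancelling [F]. *)
Lemma rayleigh_riccati : forall a, 0 < a ->
  sadd (theta (rayleigh a)) (smul (sconst (a - 1)) (rayleigh a))
  = sadd sX (smul (rayleigh a) (rayleigh a)).
Proof.
intros a Ha; apply (smul_cancel (bessel_series a)); [apply bessel_series_0|].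
pose proof (bessel_series_ode a Ha) as E.
rewrite theta_bessel_series in E by assumption.
assert (E2 : theta (sopp (smul (bessel_series a) (rayleigh a)))
  = sopp (theta (smul (bessel_series a) (rayleigh a)))).
{ apply functional_extensionality; intros n; unfold theta, sopp; ring. }
rewrite E2, theta_smul, theta_bessel_series in E by assumption.
set (f := bessel_series a) in *; set (l := rayleigh a) in *; set (c := sconst (a - 1)) in *.
set (t := theta l) in *.
match type of E with ?A = _ =>
  transitivity (ssub (smul f (sadd sX (smul l l))) A); [ring|] end.
rewrite E; ring.
Qed.

(** * Log-convexity of the Rayleigh sums *)

(** Under log-convexity the ratios increase; stated without division. *)
Lemma ratio_le : forall (u : series) n k,
  (forall i, (i <= n)%nat -> 0 < u i) ->
  (forall i, (S i < n)%nat -> u (S i) * u (S i) <= u i * u (S (S i))) ->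
  (k < n)%nat -> u (S k) * u (n - 1)%nat <= u n * u k.
Proof.
intros u n k; induction n as [|n IH]; intros Hp Hc Hk; [lia|].
destruct (Nat.eq_dec k n) as [->|Hne].
- replace (S n - 1)%nat with n by lia; lra.
- assert (IH' : u (S k) * u (n - 1)%nat <= u n * u k)
    by (apply IH; [intros; apply Hp; lia|intros; apply Hc; lia|lia]).
  destruct n as [|n]; [lia|].
  replace (S n - 1)%nat with n in IH' by lia.
  replace (S (S n) - 1)%nat with (S n) by lia.
  pose proof (Hc n ltac:(lia)); pose proof (Hp n ltac:(lia)).
  pose proof (Hp (S n) ltac:(lia)); pose proof (Hp k ltac:(lia)).
  pose proof (Hp (S (S n)) ltac:(lia)).
  pose proof (Hp (S k) ltac:(lia)).
  apply Rmult_le_reg_l with (u n); [assumption|].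
  apply Rle_trans with (u (S n) * (u (S n) * u k)); [nra|].
  nra.
Qed.

(** The theorem of de Bruijn and Erdos on renewal sequences. By induction the
    ratios of [u] increase up to [lambda = u_(n+2) / u_(n+1)], so the numbers
    [e_k = lambda u_(n+1-k) - u_(n+2-k)] are nonnegative. Taking differences in the
    renewal equation gives [f_(n+1) = sum_k f_k e_(k+1)] and
    [u_(n+3) - lambda u_(n+2) = f_(n+2) - sum_k f_(k+1) e_(k+1)]; as the ratios of
    [f] increase as well, the last sum is at most
    [(f_(n+2) / f_(n+1)) sum_k f_k e_(k+1) = f_(n+2)]. Here [k] runs from 0 to [n],
    and the case [u_2 u_0 >= u_1^2] is separate. *)
Lemma renewal_log_convex : forall (f u : series) n,
  (forall i, 0 < f i) -> (forall i, 0 < u i) -> u O = 1 ->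
  (forall i, u (S i) = smul f u i) ->
  (forall i, (i < n)%nat -> f (S i) * f (S i) <= f i * f (S (S i))) ->
  u (S n) * u (S n) <= u n * u (S (S n)).
Proof.
intros f u n Hf Hu H0 Hr; induction n as [n IH] using lt_wf_ind; intros Hc.
assert (Hlc : forall i, (i < n)%nat -> u (S i) * u (S i) <= u i * u (S (S i)))
  by (intros i Hi; apply IH; [assumption|intros; apply Hc; lia]).
destruct n as [|n].
{ rewrite (Hr 1%nat); cbn [smul]; rewrite (Hr O); cbn [smul].
  unfold tail; rewrite H0; pose proof (Hf O); pose proof (Hf 1%nat); nra. }
(* The numbers [e_k] of the comment above, multiplied by [u (S n)]. *)
set (e := fun k => u (S n - k)%nat * u (S (S n)) - u (S (S n) - k)%nat * u (S n)).
assert (He : forall k, (k <= S n)%nat -> 0 <= e k).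
{ intros k Hk; unfold e.
  pose proof (ratio_le u (S (S n)) (S n - k)) as H.
  replace (S (S n) - 1)%nat with (S n) in H by lia.
  replace (S (S n) - k)%nat with (S (S n - k)) by lia.
  apply Rge_le, Rge_minus, Rle_ge.
  rewrite (Rmult_comm (u (S n - k)%nat)).
  apply H; [auto|intros; apply Hlc; lia|lia]. }
assert (E1 : f (S n) * u (S n) = sum_f_R0 (fun k => f k * e (S k)) n).
{ assert (A : u (S (S n)) = f (S n) + sum_f_R0 (fun k => f k * u (S n - k)%nat) n).
  { rewrite Hr, smul_sum; cbn [sum_f_R0]; rewrite Nat.sub_diag, H0; ring. }
  assert (B : u (S n) = sum_f_R0 (fun k => f k * u (n - k)%nat) n)
    by (rewrite Hr, smul_sum; reflexivity).
  replace (sum_f_R0 (fun k => f k * e (S k)) n)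
    with (sum_f_R0 (fun k => f k * u (n - k)%nat) n * u (S (S n))
          - sum_f_R0 (fun k => f k * u (S n - k)%nat) n * u (S n)).
  { rewrite <- B; rewrite A at 1; ring. }
  rewrite !(Rmult_comm (sum_f_R0 _ n)), !scal_sum, <- minus_sum.
  apply sum_eq; intros k Hk; unfold e; cbn [Nat.sub]; ring. }
assert (E2 : u (S n) * u (S (S (S n))) - u (S (S n)) * u (S (S n))
  = f (S (S n)) * u (S n) - sum_f_R0 (fun k => f (S k) * e (S k)) n).
{ assert (A : u (S (S (S n))) = f (S (S n))
     + sum_f_R0 (fun k => f k * u (S (S n) - k)%nat) (S n)).
  { rewrite Hr, smul_sum; cbn [sum_f_R0]; rewrite Nat.sub_diag, H0; ring. }
  assert (B : u (S (S n)) = sum_f_R0 (fun k => f k * u (S n - k)%nat) (S n))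
    by (rewrite Hr, smul_sum; reflexivity).
  assert (C : sum_f_R0 (fun k => f (S k) * e (S k)) n
    = sum_f_R0 (fun k => f k * u (S n - k)%nat) (S n) * u (S (S n))
          - sum_f_R0 (fun k => f k * u (S (S n) - k)%nat) (S n) * u (S n)).
  { rewrite !(Rmult_comm (sum_f_R0 _ (S n))), !scal_sum, <- minus_sum.
    rewrite (decomp_sum _ (S n)) by lia; cbn [pred].
    rewrite <- (Rplus_0_l (sum_f_R0 _ n)); f_equal.
    - unfold e; cbn [Nat.sub]; ring.
    - apply sum_eq; intros k Hk; unfold e; ring. }
  rewrite C, A, <- B; ring. }
assert (E3 : sum_f_R0 (fun k => f (S k) * e (S k)) n * f (S n)
   <= sum_f_R0 (fun k => f k * e (S k)) n * f (S (S n))).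
{ rewrite !(Rmult_comm (sum_f_R0 _ n)), !scal_sum; apply sum_Rle; intros k Hk.
  pose proof (ratio_le f (S (S n)) k ltac:(auto)) as H.
  replace (S (S n) - 1)%nat with (S n) in H by lia.
  specialize (H ltac:(intros; apply Hc; lia) ltac:(lia)).
  pose proof (He (S k) ltac:(lia)).
  replace (f (S k) * e (S k) * f (S n)) with (f (S k) * f (S n) * e (S k)) by ring.
  replace (f k * e (S k) * f (S (S n))) with (f (S (S n)) * f k * e (S k)) by ring.
  apply Rmult_le_compat_r; assumption. }
rewrite <- E1 in E3.
assert (sum_f_R0 (fun k => f (S k) * e (S k)) n <= f (S (S n)) * u (S n)).
{ apply Rmult_le_reg_r with (f (S n)); [auto|]; lra. }
lra.
Qed.

Lemma bessel_ratio_0 : forall a, bessel_ratio a O = 1.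
Proof. intros a; unfold bessel_ratio; cbn; apply bessel_series_0. Qed.

(** The continued fraction as a renewal equation, whose weights are the
    coefficients for the parameter [a + 1]. *)
Lemma bessel_ratio_S : forall a n, 0 < a ->
  bessel_ratio a (S n)
  = smul (fun k => / (a * (a + 1)) * bessel_ratio (a + 1) k) (bessel_ratio a) n.
Proof.
intros a n Ha; pose proof (equal_f (bessel_ratio_fraction a Ha) (S n)) as E.
unfold sadd in E; rewrite sconst_smul, sX_smul_S in E.
rewrite E, smul_scal_l; cbn; ring.
Qed.

Lemma bessel_ratio_pos : forall n a, 0 < a -> 0 < bessel_ratio a n.
Proof.
induction n as [n IH] using lt_wf_ind; intros a Ha; destruct n as [|n].
- rewrite bessel_ratio_0; lra.
- rewrite bessel_ratio_S, smul_sum by assumption.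
  assert (Hg : 0 < / (a * (a + 1))) by (apply Rinv_0_lt_compat; nra).
  assert (H : forall m, (m <= n)%nat -> 0 < sum_f_R0
    (fun k => / (a * (a + 1)) * bessel_ratio (a + 1) k * bessel_ratio a (n - k)%nat) m).
  { assert (Hk : forall k, (k <= n)%nat ->
      0 < / (a * (a + 1)) * bessel_ratio (a + 1) k * bessel_ratio a (n - k)%nat).
    { intros k Hk; apply Rmult_lt_0_compat; [apply Rmult_lt_0_compat|];
        [assumption|apply IH|apply IH]; lia || lra. }
    intros m; induction m as [|m IHm]; intros Hm; cbn [sum_f_R0].
    - apply Hk; lia.
    - apply Rplus_lt_0_compat; [apply IHm; lia|apply Hk; lia]. }
  apply H; lia.
Qed.

(** Index [n] for [a] needs only indices below [n] for [a + 1], so the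
    induction on [n] is over all parameters at once. *)
Lemma bessel_ratio_log_convex : forall n a, 0 < a ->
  bessel_ratio a (S n) * bessel_ratio a (S n) <= bessel_ratio a n * bessel_ratio a (S (S n)).
Proof.
induction n as [n IH] using lt_wf_ind; intros a Ha.
assert (Hg : 0 < / (a * (a + 1))) by (apply Rinv_0_lt_compat; nra).
apply (renewal_log_convex (fun k => / (a * (a + 1)) * bessel_ratio (a + 1) k)).
- intros i; apply Rmult_lt_0_compat; [assumption|apply bessel_ratio_pos; lra].
- intros i; apply bessel_ratio_pos; assumption.
- apply bessel_ratio_0.
- intros i; apply bessel_ratio_S; assumption.
- intros i Hi; pose proof (IH i Hi (a + 1) ltac:(lra)).
  assert (0 < / (a * (a + 1)) * / (a * (a + 1))) by nra.
  nra.
Qed.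

Lemma rayleigh_0 : forall a, rayleigh a O = 0.
Proof. intros a; unfold rayleigh; rewrite sconst_smul; cbn; ring. Qed.

Lemma rayleigh_S : forall a n, rayleigh a (S n) = / a * bessel_ratio a n.
Proof. intros a n; unfold rayleigh; rewrite sconst_smul, sX_smul_S; reflexivity. Qed.

Lemma rayleigh_pos : forall a n, 0 < a -> 0 < rayleigh a (S n).
Proof.
intros a n Ha; rewrite rayleigh_S; apply Rmult_lt_0_compat;
  [apply Rinv_0_lt_compat; assumption|apply bessel_ratio_pos; assumption].
Qed.

Lemma rayleigh_nonneg : forall a n, 0 < a -> 0 <= rayleigh a n.
Proof.
intros a [|n] Ha; [rewrite rayleigh_0; lra|left; apply rayleigh_pos; assumption].
Qed.

Lemma rayleigh_log_convex : forall a n, 0 < a ->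
  rayleigh a (S (S n)) * rayleigh a (S (S n)) <= rayleigh a (S n) * rayleigh a (S (S (S n))).
Proof.
intros a n Ha; rewrite !rayleigh_S; pose proof (bessel_ratio_log_convex n a Ha).
assert (0 < / a) by (apply Rinv_0_lt_compat; assumption).
assert (0 < / a * / a) by nra; nra.
Qed.

(** Coefficients of the Riccati equation. The end terms of the convolution
    vanish, so this computes [s_n] from earlier sums. *)
Lemma rayleigh_convolution : forall a n, 0 < a ->
  (a + INR (S n)) * rayleigh a (S (S n)) = smul (rayleigh a) (rayleigh a) (S (S n)).
Proof.
intros a n Ha.
pose proof (equal_f (rayleigh_riccati a Ha) (S (S n))) as E.
unfold sadd, theta in E; rewrite sconst_smul in E.
change (sX (S (S n))) with 0 in E; rewrite !S_INR in *; lra.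
Qed.

(** * Comparison of power means *)

Lemma rayleigh_geometric : forall a n m, 0 < a ->
  rayleigh a (S n) * rayleigh a (S (S n)) ^ m
  <= rayleigh a (S n + m)%nat * rayleigh a (S n) ^ m.
Proof.
intros a n m Ha; induction m as [|m IH].
- rewrite Nat.add_0_r; cbn; lra.
- pose proof (ratio_le (fun k => rayleigh a (S k)) (S (n + m)) n) as H.
  cbn beta in H.
  specialize (H ltac:(intros; apply rayleigh_pos; assumption)
    ltac:(intros; apply rayleigh_log_convex; assumption) ltac:(lia)).
  replace (S (S (n + m) - 1))%nat with (S n + m)%nat in H by lia.
  replace (S n + S m)%nat with (S (S (n + m)))%nat by lia.
  pose proof (rayleigh_pos a n Ha); pose proof (rayleigh_pos a (S n) Ha).
  assert (0 < rayleigh a (S n) ^ m) by (apply pow_lt; assumption).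
  cbn [pow].
  apply Rle_trans with (rayleigh a (S (S n)) * (rayleigh a (S n + m)%nat * rayleigh a (S n) ^ m)).
  + rewrite (Rmult_comm (rayleigh a (S (S n))) (rayleigh a (S (S n)) ^ m)), <- Rmult_assoc.
    rewrite Rmult_comm; apply Rmult_le_compat_l; lra.
  + replace (rayleigh a (S (S n)) * (rayleigh a (S n + m)%nat * rayleigh a (S n) ^ m))
      with (rayleigh a (S (S n)) * rayleigh a (S n + m)%nat * rayleigh a (S n) ^ m) by ring.
    replace (rayleigh a (S (S (n + m))) * (rayleigh a (S n) * rayleigh a (S n) ^ m))
      with (rayleigh a (S (S (n + m))) * rayleigh a (S n) * rayleigh a (S n) ^ m) by ring.
    apply Rmult_le_compat_r; lra.
Qed.

(** A ratio [tau > beta] would persist by log-convexity, and [tau^n] would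
    outgrow [K beta^n]. *)
Lemma rayleigh_ratio_bound : forall a K beta j, 0 < a -> 0 < beta ->
  (forall n, (j <= n)%nat -> rayleigh a n <= K * beta ^ n) ->
  forall n, rayleigh a (S (S n)) <= beta * rayleigh a (S n).
Proof.
intros a K beta j Ha Hb H n.
destruct (Rle_lt_dec (rayleigh a (S (S n))) (beta * rayleigh a (S n))) as [|Hlt];
  [assumption|exfalso].
pose proof (rayleigh_pos a n Ha) as Hp.
set (x := rayleigh a (S (S n)) / (beta * rayleigh a (S n))).
assert (Hx : 1 < x).
{ unfold x; apply Rmult_lt_reg_r with (beta * rayleigh a (S n)); [nra|].
  unfold Rdiv; rewrite Rmult_assoc, Rinv_l; nra. }
destruct (Pow_x_infinity x ltac:(rewrite Rabs_right; lra)
  (K * beta ^ (S n) / rayleigh a (S n) + 1)) as [N HN].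
specialize (HN (N + j)%nat ltac:(lia)).
pose proof (rayleigh_geometric a n (N + j) Ha) as Hg.
pose proof (H (S n + (N + j))%nat ltac:(lia)) as Hu.
rewrite Rabs_right in HN by (apply Rle_ge, pow_le; lra).
set (m := (N + j)%nat) in *.
assert (Ex : x ^ m * (beta ^ m * rayleigh a (S n) ^ m) = rayleigh a (S (S n)) ^ m).
{ rewrite <- !Rpow_mult_distr; f_equal; unfold x; field; lra. }
assert (Hbm : 0 < beta ^ m) by (apply pow_lt; lra).
assert (Hpm : 0 < rayleigh a (S n) ^ m) by (apply pow_lt; lra).
assert (Hc : rayleigh a (S n) * x ^ m <= K * beta ^ S n).
{ apply Rmult_le_reg_r with (beta ^ m * rayleigh a (S n) ^ m); [nra|].
  rewrite Rmult_assoc, Ex; apply Rle_trans with (1 := Hg).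
  rewrite pow_add in Hu.
  apply Rle_trans with (K * (beta ^ S n * beta ^ m) * rayleigh a (S n) ^ m).
  - apply Rmult_le_compat_r; lra.
  - right; ring. }
assert (x ^ m <= K * beta ^ S n / rayleigh a (S n)).
{ apply Rmult_le_reg_l with (rayleigh a (S n)); [assumption|].
  apply Rle_trans with (1 := Hc); right; field; lra. }
lra.
Qed.

(** The convolution formula has [n - 1] terms and the factor [a + n - 1] on its
    left. The bound ensures that the ratios are bounded. *)
Lemma rayleigh_le_pow : forall a n, 0 < a -> rayleigh a (S n) <= (/ a) ^ S n.
Proof.
intros a n Ha; induction n as [n IH] using lt_wf_ind; destruct n as [|n].
- rewrite rayleigh_S, bessel_ratio_0; cbn; lra.
- assert (Hi : 0 < / a) by (apply Rinv_0_lt_compat; assumption).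
  pose proof (rayleigh_convolution a n Ha) as E.
  assert (H : smul (rayleigh a) (rayleigh a) (S (S n)) <= INR (S n) * (/ a) ^ S (S n)).
  { rewrite smul_sum, decomp_sum by lia; cbn [pred].
    rewrite rayleigh_0, Rmult_0_l, Rplus_0_l; cbn [sum_f_R0].
    rewrite Nat.sub_diag, rayleigh_0, Rmult_0_r, Rplus_0_r.
    rewrite Rmult_comm, <- sum_cte; apply sum_Rle; intros k Hk.
    replace ((/ a) ^ S (S n)) with ((/ a) ^ S k * (/ a) ^ (S (S n) - S k))
      by (rewrite <- pow_add; f_equal; lia).
    replace (S (S n) - S k)%nat with (S (n - k))%nat by lia.
    apply Rmult_le_compat; try (apply rayleigh_nonneg; assumption); apply IH; lia. }
  pose proof (pos_INR (S n)).
  assert (0 < (/ a) ^ S (S n)) by (apply pow_lt; assumption).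
  apply Rmult_le_reg_l with (a + INR (S n)); [lra|]; nra.
Qed.

(** The supremum of the ratios stands for the inverse of the smallest zero. *)
Lemma rayleigh_ratio_sup : forall a, 0 < a -> exists rho, 0 < rho /\
  (forall n, rayleigh a (S (S n)) <= rho * rayleigh a (S n)) /\
  (forall beta, (forall n, rayleigh a (S (S n)) <= beta * rayleigh a (S n)) -> rho <= beta).
Proof.
intros a Ha.
assert (Hi : 0 < / a) by (apply Rinv_0_lt_compat; assumption).
destruct (completeness (fun r => exists n, r = rayleigh a (S (S n)) / rayleigh a (S n)))
  as [rho [Hub Hl]].
- exists (/ a); intros r [n ->].
  pose proof (rayleigh_pos a n Ha).
  apply Rle_div_l; [assumption|].
  apply (rayleigh_ratio_bound a 1 (/ a) 1); try assumption.
  intros m Hm; destruct m as [|m]; [lia|].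
  rewrite Rmult_1_l; apply rayleigh_le_pow; assumption.
- exists (rayleigh a 2 / rayleigh a 1), O; reflexivity.
- exists rho; split; [|split].
  + apply Rlt_le_trans with (rayleigh a 2 / rayleigh a 1).
    * apply Rdiv_lt_0_compat; apply rayleigh_pos; assumption.
    * apply Hub; exists O; reflexivity.
  + intros n; pose proof (rayleigh_pos a n Ha).
    apply Rle_div_l; [assumption|]; apply Hub; exists n; reflexivity.
  + intros beta Hbeta; apply Hl; intros r [n ->].
    pose proof (rayleigh_pos a n Ha); apply Rle_div_l; [assumption|]; apply Hbeta.
Qed.

Lemma rayleigh_ratio_iter : forall a rho n m, 0 < a -> 0 < rho ->
  (forall n, rayleigh a (S (S n)) <= rho * rayleigh a (S n)) ->
  rayleigh a (S n + m)%nat <= rho ^ m * rayleigh a (S n).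
Proof.
intros a rho n m Ha Hr H; induction m as [|m IH].
- rewrite Nat.add_0_r; cbn; lra.
- replace (S n + S m)%nat with (S (S (n + m))) by lia.
  apply Rle_trans with (1 := H _); cbn [pow].
  replace (S (n + m)) with (S n + m)%nat by lia; nra.
Qed.

Lemma bernoulli_sub : forall e n, 0 <= e <= 1 -> 1 - INR n * e <= (1 - e) ^ n.
Proof.
intros e n He; induction n as [|n IH]; [cbn; lra|].
rewrite S_INR; cbn [pow]; pose proof (pos_INR n).
assert (0 <= (1 - e) ^ n) by (apply pow_le; lra).
destruct (Rle_lt_dec 0 (1 - INR n * e)); nra.
Qed.

Lemma pow_le_1_decr : forall x n m, 0 <= x <= 1 -> (n <= m)%nat -> x ^ m <= x ^ n.
Proof.
intros x n m Hx Hnm; replace m with (n + (m - n))%nat by lia; rewrite pow_add.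
assert (0 <= x ^ n) by (apply pow_le; lra).
assert (x ^ (m - n) <= 1) by (rewrite <- (pow1 (m - n)); apply pow_incr; lra).
nra.
Qed.

(** The smallest zero has multiplicity at least one. Suppose
    [th = s_j / rho^j < 1] (with [j] standing for [S j]). Log-convexity gives
    [s_n <= th rho^n] for all [n >= j]. For [th < K < 1] and [gamma] close to 1 one
    gets [s_n <= K (gamma rho)^n] for all [n >= j]: up to a large [N] because
    [th <= K gamma^N], and beyond [N] from the convolution formula, in which the
    terms with both indices at least [j] contribute at most [(n + 1) K^2], the remaining
    terms a bounded multiple of [K], and [n K + O(1) <= n] for [n > N]. So all ratios
    are at most [gamma rho < rho], against the choice of [rho]. *)
Lemma rayleigh_ge_sup : forall a rho j, 0 < a -> 0 < rho ->
  (forall n, rayleigh a (S (S n)) <= rho * rayleigh a (S n)) ->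
  (forall beta, (forall n, rayleigh a (S (S n)) <= beta * rayleigh a (S n)) -> rho <= beta) ->
  rho ^ S j <= rayleigh a (S j).
Proof.
intros a rho j Ha Hr Hub Hl.
destruct (Rle_lt_dec (rho ^ S j) (rayleigh a (S j))) as [|Hlt]; [assumption|exfalso].
assert (Hrj : 0 < rho ^ S j) by (apply pow_lt; assumption).
set (th := rayleigh a (S j) / rho ^ S j).
assert (Hth : 0 < th < 1).
{ pose proof (rayleigh_pos a j Ha); split.
  - apply Rdiv_lt_0_compat; assumption.
  - apply Rlt_div_l; lra. }
assert (Hdec : forall n, (S j <= n)%nat -> rayleigh a n <= th * rho ^ n).
{ intros n Hn; replace n with (S j + (n - S j))%nat at 1 by lia.
  apply Rle_trans with (1 := rayleigh_ratio_iter a rho j _ Ha Hr Hub).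
  right; unfold th; replace (rho ^ n) with (rho ^ S j * rho ^ (n - S j))
    by (rewrite <- pow_add; f_equal; lia).
  field; lra. }
set (K := (1 + th) / 2).
assert (HK : th < K < 1) by (unfold K; lra).
(* Bounds [s_i / (gamma rho)^i] for [i <= j], uniformly in [gamma >= 1/2]. *)
set (kap := fun i => if (i <? S j)%nat then rayleigh a i * (2 / rho) ^ i else 0).
assert (Hkap : forall i, 0 <= kap i).
{ intros i; unfold kap; destruct (i <? S j)%nat; [|lra].
  apply Rmult_le_pos; [apply rayleigh_nonneg; assumption|].
  apply pow_le; left; apply Rdiv_lt_0_compat; lra. }
set (B := sum_f_R0 kap j).
assert (HB : forall n, sum_f_R0 kap n <= B).
{ assert (Hadd : forall m, sum_f_R0 kap (j + m) = B).
  { induction m as [|m IHm]; [rewrite Nat.add_0_r; reflexivity|].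
    rewrite <- plus_n_Sm; cbn [sum_f_R0]; rewrite IHm; unfold kap.
    replace (S (j + m) <? S j)%nat with false by (symmetry; apply Nat.ltb_ge; lia).
    ring. }
  intros n; destruct (le_lt_dec j n) as [Hjn|Hjn].
  - replace n with (j + (n - j))%nat by lia; rewrite Hadd; lra.
  - unfold B; replace j with (n + (j - n))%nat by lia.
    generalize (j - n)%nat; intros m; induction m as [|m IHm].
    + rewrite Nat.add_0_r; lra.
    + rewrite <- plus_n_Sm; cbn [sum_f_R0]; pose proof (Hkap (S (n + m))); lra. }
assert (HB0 : 0 <= B) by (apply cond_pos_sum, Hkap).
destruct (nfloor_ex ((2 * B + 2) / (1 - K))) as [N0 [_ HN0]].
{ apply Rdiv_le_0_compat; lra. }
(* From [2 S j] on, the two indices of a convolution term cannot both be small. *)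
set (N := (N0 + 1 + 2 * S j)%nat).
assert (HN : 2 * B + 2 <= INR N * (1 - K)).
{ apply Rle_div_l; [lra|].
  unfold N; rewrite plus_INR, plus_INR; pose proof (pos_INR (2 * S j)).
  cbn [INR]; lra. }
assert (HNpos : 0 < INR N) by (apply lt_0_INR; unfold N; lia).
(* Bernoulli's inequality turns this choice into [th <= K (1 - eps)^N]. *)
set (eps := Rmin (1 / 2) ((1 - th / K) / INR N)).
assert (Hq : 0 < th / K < 1).
{ split; [apply Rdiv_lt_0_compat; lra|apply Rlt_div_l; lra]. }
assert (Heps : 0 < eps <= 1 / 2).
{ unfold eps; split; [|apply Rmin_l].
  apply Rmin_pos; [lra|apply Rdiv_lt_0_compat; lra]. }
set (gam := 1 - eps).
assert (HgN : th <= K * gam ^ N).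
{ assert (th / K <= gam ^ N).
  { apply Rle_trans with (1 - INR N * eps); [|apply bernoulli_sub; lra].
    assert (eps <= (1 - th / K) / INR N) by apply Rmin_r.
    assert (INR N * eps <= 1 - th / K).
    { apply Rle_trans with (INR N * ((1 - th / K) / INR N)).
      - apply Rmult_le_compat_l; lra.
      - right; field; lra. }
    lra. }
  replace th with (K * (th / K)) by (field; lra).
  apply Rmult_le_compat_l; lra. }
set (beta := gam * rho).
assert (Hbeta : 0 < beta) by (unfold beta, gam; nra).
assert (Hmain : forall n, (S j <= n)%nat -> rayleigh a n <= K * beta ^ n).
{ intros n; induction n as [n IH] using lt_wf_ind; intros Hn.
  destruct (le_lt_dec n N) as [HnN|HnN].
  - apply Rle_trans with (1 := Hdec n Hn); unfold beta; rewrite Rpow_mult_distr.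
    rewrite <- Rmult_assoc; apply Rmult_le_compat_r; [apply pow_le; lra|].
    apply Rle_trans with (1 := HgN); apply Rmult_le_compat_l; [lra|].
    apply pow_le_1_decr; [unfold gam; lra|assumption].
  - destruct n as [|[|n]]; [lia|unfold N in HnN; lia|].
    pose proof (rayleigh_convolution a n Ha) as E.
    set (m := S (S n)) in *.
    assert (Hbm : 0 < beta ^ m) by (apply pow_lt; assumption).
    assert (Hsmall : forall i, (i < S j)%nat -> rayleigh a i <= kap i * beta ^ i).
    { intros i Hi; unfold kap; replace (i <? S j)%nat with true
        by (symmetry; apply Nat.ltb_lt; lia).
      rewrite Rmult_assoc, <- Rpow_mult_distr.
      rewrite <- (Rmult_1_r (rayleigh a i)) at 1.
      apply Rmult_le_compat_l; [apply rayleigh_nonneg; assumption|].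
      rewrite <- (pow1 i); apply pow_incr; split; [lra|].
      unfold beta, gam; replace (2 / rho * ((1 - eps) * rho)) with (2 * (1 - eps))
        by (field; lra); lra. }
    assert (Hbig : forall i, (S j <= i)%nat -> (i < m)%nat -> rayleigh a i <= K * beta ^ i)
      by (intros i Hi Him; apply IH; assumption).
    assert (Hb0 : forall i, rayleigh a i <= (K + kap i) * beta ^ i \/ i = m \/ (m < i)%nat).
    { intros i; destruct (le_lt_dec m i) as [|Him]; [right; lia|left].
      assert (0 < beta ^ i) by (apply pow_lt; assumption).
      pose proof (Hkap i).
      destruct (le_lt_dec (S j) i) as [Hi|Hi].
      - pose proof (Hbig i Hi Him); nra.
      - pose proof (Hsmall i Hi); nra. }
    assert (Hsum : smul (rayleigh a) (rayleigh a) m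
      <= sum_f_R0 (fun i => (K * kap i + K * kap (m - i)%nat + K * K) * beta ^ m) m).
    { rewrite smul_sum; apply sum_Rle; intros i Him.
      pose proof (Hkap i); pose proof (Hkap (m - i)%nat).
      destruct (Nat.eq_dec i 0) as [->|Hi0].
      { rewrite rayleigh_0, Rmult_0_l; apply Rmult_le_pos; [|lra].
        pose proof (Rmult_le_pos K (kap O) ltac:(lra) ltac:(lra)).
        pose proof (Rmult_le_pos K (kap (m - 0)%nat) ltac:(lra) ltac:(lra)).
        pose proof (Rmult_le_pos K K ltac:(lra) ltac:(lra)); lra. }
      destruct (Nat.eq_dec i m) as [->|Hi1].
      { rewrite Nat.sub_diag, rayleigh_0.
        rewrite Rmult_0_r; apply Rmult_le_pos; [|lra].
        pose proof (Hkap m); pose proof (Hkap O); nra. }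
      replace (beta ^ m) with (beta ^ i * beta ^ (m - i))
        by (rewrite <- pow_add; f_equal; lia).
      assert (0 < beta ^ i) by (apply pow_lt; assumption).
      assert (0 < beta ^ (m - i)) by (apply pow_lt; assumption).
      assert (Hn1 : 0 <= rayleigh a i) by (apply rayleigh_nonneg; assumption).
      assert (Hn2 : 0 <= rayleigh a (m - i)%nat) by (apply rayleigh_nonneg; assumption).
      assert (Hfin : forall x y, 0 <= x -> 0 <= y ->
         x * y <= K * kap i + K * kap (m - i)%nat + K * K ->
         rayleigh a i <= x * beta ^ i -> rayleigh a (m - i)%nat <= y * beta ^ (m - i) ->
         rayleigh a i * rayleigh a (m - i)%nat
         <= (K * kap i + K * kap (m - i)%nat + K * K) * (beta ^ i * beta ^ (m - i))).
      { intros x y Hx Hy Hxy H1' H2'.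
        apply Rle_trans with ((x * beta ^ i) * (y * beta ^ (m - i))).
        - apply Rmult_le_compat; assumption.
        - replace (x * beta ^ i * (y * beta ^ (m - i)))
            with (x * y * (beta ^ i * beta ^ (m - i))) by ring.
          apply Rmult_le_compat_r; [nra|assumption]. }
      destruct (le_lt_dec (S j) i) as [Hi|Hi];
        destruct (le_lt_dec (S j) (m - i)) as [Hmi|Hmi].
      - apply (Hfin K K); [lra|lra|nra|apply Hbig; lia|apply Hbig; lia].
      - apply (Hfin K (kap (m - i)%nat)); [lra|lra|nra|apply Hbig; lia|apply Hsmall; lia].
      - apply (Hfin (kap i) K); [lra|lra|nra|apply Hsmall; lia|apply Hbig; lia].
      - unfold N in HnN; lia. }
    assert (Hrev : sum_f_R0 (fun i => kap (m - i)%nat) m = sum_f_R0 kap m).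
    { transitivity (smul (fun _ => 1) kap m).
      - rewrite smul_sum; apply sum_eq; intros; ring.
      - rewrite smul_comm_pt, smul_sum; apply sum_eq; intros; ring. }
    assert (Htot : sum_f_R0 (fun i => (K * kap i + K * kap (m - i)%nat + K * K) * beta ^ m) m
       = beta ^ m * (2 * K * sum_f_R0 kap m + K * K * (INR m + 1))).
    { rewrite <- scal_sum, sum_plus, sum_plus.
      rewrite sum_cte, S_INR.
      replace (sum_f_R0 (fun l => K * kap l) m) with (K * sum_f_R0 kap m)
        by (rewrite scal_sum; apply sum_eq; intros; ring).
      replace (sum_f_R0 (fun l => K * kap (m - l)%nat) m)
        with (K * sum_f_R0 (fun i => kap (m - i)%nat) m)
        by (rewrite scal_sum; apply sum_eq; intros; ring).
      rewrite Hrev; ring. }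
    pose proof (HB m) as HBm.
    assert (HmN : INR N <= INR m) by (apply le_INR; lia).
    assert (Hfin : 2 * K * sum_f_R0 kap m + K * K * (INR m + 1) <= K * (a + INR (S n))).
    { assert (2 * sum_f_R0 kap m + K * (INR m + 1) <= a + INR (S n)).
      { unfold m; rewrite (S_INR (S n)).
        assert (INR N * (1 - K) <= INR m * (1 - K)) by (apply Rmult_le_compat_r; lra).
        unfold m in *; rewrite (S_INR (S n)) in *; lra. }
      nra. }
    pose proof (pos_INR (S n)).
    apply Rmult_le_reg_l with (a + INR (S n)); [lra|].
    rewrite E; apply Rle_trans with (1 := Hsum); rewrite Htot.
    apply Rle_trans with (beta ^ m * (K * (a + INR (S n)))).
    + apply Rmult_le_compat_l; lra.
    + right; ring. }
pose proof (Hl beta (rayleigh_ratio_bound a K beta (S j) Ha Hbeta Hmain)) as Hc.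
unfold beta, gam in Hc; nra.
Qed.

(** From [s_k <= s_j rho^(k-j)] and [rho <= s_j^(1/j)]. *)
Lemma rayleigh_power_mean : forall a j k, 0 < a -> (j <= k)%nat ->
  rayleigh a (S k) ^ S j <= rayleigh a (S j) ^ S k.
Proof.
intros a j k Ha Hjk.
destruct (rayleigh_ratio_sup a Ha) as (rho & Hr & Hub & Hl).
pose proof (rayleigh_ge_sup a rho j Ha Hr Hub Hl) as H.
pose proof (rayleigh_ratio_iter a rho j (k - j) Ha Hr Hub) as Hk.
replace (S j + (k - j))%nat with (S k) in Hk by lia.
pose proof (rayleigh_pos a j Ha) as Hp; pose proof (rayleigh_pos a k Ha).
apply Rle_trans with ((rho ^ (k - j) * rayleigh a (S j)) ^ S j).
{ apply pow_incr; lra. }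
rewrite Rpow_mult_distr, <- pow_mult.
replace ((k - j) * S j)%nat with (S j * (k - j))%nat by lia.
rewrite pow_mult.
replace (S k) with ((k - j) + S j)%nat by lia; rewrite pow_add.
apply Rmult_le_compat_r; [apply pow_le; lra|].
apply pow_incr; split; [apply pow_le; lra|assumption].
Qed.

(** * The even part of the product of two Bessel series *)

Definition dilate (c : R) (p : series) : series := fun n => c ^ n * p n.
Definition even_part (p : series) : series := fun n => p (2 * n)%nat.

Lemma dilate_smul : forall c p q,
  dilate c (smul p q) = smul (dilate c p) (dilate c q).
Proof.
intros c p q; apply functional_extensionality; intros n; unfold dilate.
rewrite !smul_sum, scal_sum; apply sum_eq; intros i Hi.
replace (c ^ n) with (c ^ i * c ^ (n - i)) by (rewrite <- pow_add; f_equal; lia).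
ring.
Qed.

Lemma dilate_theta : forall c p, theta (dilate c p) = dilate c (theta p).
Proof.
intros; apply functional_extensionality; intros n; unfold theta, dilate; ring.
Qed.

(** The odd part of [q] meets only the odd part of [p]. *)
Lemma even_smul : forall p q, (forall n, p (2 * n + 1)%nat = 0) ->
  even_part (smul p q) = smul (even_part p) (even_part q).
Proof.
intros p q Hp; apply functional_extensionality; intros n; revert p Hp.
induction n as [|n IH]; intros p Hp; [reflexivity|].
assert (H1 : tail p O = 0) by exact (Hp O).
assert (E : tail (even_part p) = even_part (tail (tail p))).
{ apply functional_extensionality; intros k; unfold tail, even_part.
  f_equal; lia. }
assert (E' : (2 * S n)%nat = S (S (2 * n))) by lia.
cbn [smul]; unfold even_part at 1; rewrite E'; cbn [smul]; rewrite H1, E, <- IH.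
- unfold even_part; rewrite E'; change (2 * 0)%nat with 0%nat; ring.
- intros k; unfold tail; rewrite <- (Hp (S k)); f_equal; lia.
Qed.

Definition bessel_product (a : R) : series :=
  smul (bessel_series a) (dilate (-1) (bessel_series a)).
(** The series [Phi] with [v_nu(z) = z Phi(z^4)]: the product
    [F_a(x) F_a(-x)] in the variable [x^2 = z^4 / 16]. *)
Definition quartic_series (a : R) : series := dilate (/ 16) (even_part (bessel_product a)).
(** The numbers [m_k], the power sums of the inverse zeros of
    [quartic_series a]. *)
Definition zero_sum (a : R) : series := dilate (/ 16) (even_part (rayleigh a)).

Lemma pow_m1_sqr : forall n, (-1) ^ n * (-1) ^ n = 1.
Proof.
intros n; rewrite <- Rpow_mult_distr; replace (-1 * -1) with 1 by ring; apply pow1.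
Qed.

(** The product is invariant under [x -> -x]. *)
Lemma bessel_product_odd : forall a n, bessel_product a (2 * n + 1)%nat = 0.
Proof.
intros a n.
assert (E : dilate (-1) (bessel_product a) = bessel_product a).
{ unfold bessel_product; rewrite dilate_smul.
  assert (D : dilate (-1) (dilate (-1) (bessel_series a)) = bessel_series a).
  { apply functional_extensionality; intros k; unfold dilate.
    rewrite <- Rmult_assoc, pow_m1_sqr; ring. }
  rewrite D; ring. }
pose proof (equal_f E (2 * n + 1)%nat) as H; unfold dilate in H at 1.
replace (2 * n + 1)%nat with (S (2 * n)) in H by lia.
rewrite pow_1_odd in H; replace (2 * n + 1)%nat with (S (2 * n)) by lia; lra.
Qed.

(** The logarithmic derivative of [F(x) F(-x)] is twice the even part of
    that of [F]; the factor 2 is absorbed by the change of variable to [x^2]. *)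
Lemma theta_quartic_series : forall a, 0 < a ->
  theta (quartic_series a) = sopp (smul (quartic_series a) (zero_sum a)).
Proof.
intros a Ha; unfold quartic_series, zero_sum; rewrite dilate_theta, <- dilate_smul.
rewrite <- even_smul by apply bessel_product_odd.
assert (E : theta (bessel_product a)
  = sopp (smul (bessel_product a) (sadd (rayleigh a) (dilate (-1) (rayleigh a))))).
{ unfold bessel_product; rewrite theta_smul, dilate_theta, theta_bessel_series by assumption.
  assert (D : dilate (-1) (sopp (smul (bessel_series a) (rayleigh a)))
     = sopp (smul (dilate (-1) (bessel_series a)) (dilate (-1) (rayleigh a)))).
  { rewrite <- dilate_smul; apply functional_extensionality; intros k.
    unfold dilate, sopp; ring. }
  rewrite D; ring. }
apply functional_extensionality; intros n; unfold dilate at 1, sopp, dilate.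
pose proof (equal_f E (2 * n)%nat) as H; unfold theta at 1, sopp in H.
replace (smul (bessel_product a) (sadd (rayleigh a) (dilate (-1) (rayleigh a))) (2 * n))
  with (2 * even_part (smul (bessel_product a) (rayleigh a)) n) in H.
- rewrite mult_INR in H; change (INR 2) with 2 in H; unfold theta.
  unfold even_part in *; nra.
- change (2 * even_part (smul (bessel_product a) (rayleigh a)) n
    = even_part (smul (bessel_product a) (sadd (rayleigh a) (dilate (-1) (rayleigh a)))) n).
  rewrite !even_smul by apply bessel_product_odd.
  replace (even_part (sadd (rayleigh a) (dilate (-1) (rayleigh a))))
    with (smul (sconst 2) (even_part (rayleigh a))).
  + rewrite <- sconst_smul.
    assert (R : forall x y z, smul x (smul y z) = smul y (smul x z)) by (intros; ring).
    rewrite R; reflexivity.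
  + apply functional_extensionality; intros k; rewrite sconst_smul.
    unfold even_part, sadd, dilate; rewrite pow_1_even; ring.
Qed.

Lemma quartic_series_0 : forall a, quartic_series a O = 1.
Proof.
intros a; transitivity (1 * (bessel_series a O * (1 * bessel_series a O))); [reflexivity|].
rewrite bessel_series_0; ring.
Qed.

Lemma zero_sum_0 : forall a, zero_sum a O = 0.
Proof. intros a; transitivity (1 * rayleigh a O); [reflexivity|rewrite rayleigh_0; ring]. Qed.

Lemma zero_sum_eq : forall a n,
  zero_sum a (S n) = (/ 16) ^ S n * rayleigh a (S (S (n + n))).
Proof.
intros a n; unfold zero_sum, dilate, even_part; do 2 f_equal; lia.
Qed.

Lemma zero_sum_pos : forall a n, 0 < a -> 0 < zero_sum a (S n).
Proof.
intros a n Ha; rewrite zero_sum_eq; apply Rmult_lt_0_compat;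
  [apply pow_lt; lra|apply rayleigh_pos; assumption].
Qed.

Lemma zero_sum_nonneg : forall a n, 0 < a -> 0 <= zero_sum a n.
Proof.
intros a [|n] Ha; [rewrite zero_sum_0; lra|left; apply zero_sum_pos; assumption].
Qed.

Lemma zero_sum_power_mean : forall a j k, 0 < a -> (j <= k)%nat ->
  zero_sum a (S k) ^ S j <= zero_sum a (S j) ^ S k.
Proof.
intros a j k Ha Hjk; rewrite !zero_sum_eq, !Rpow_mult_distr, <- !pow_mult.
rewrite (Nat.mul_comm (S j)); apply Rmult_le_compat_l; [apply pow_le; lra|].
pose proof (rayleigh_power_mean a (S (j + j)) (S (k + k)) Ha ltac:(lia)) as H.
replace (S (S (j + j))) with (S j + S j)%nat in H at 1 by lia.
replace (S (S (k + k))) with (S k + S k)%nat in H at 2 by lia.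
rewrite !pow_add in H; apply Rsqr_incr_0; [exact H| |];
  apply pow_le; apply rayleigh_nonneg; assumption.
Qed.

(** Three consecutive log-convexity inequalities of the Rayleigh sums combine
    into one for every second sum. *)
Lemma zero_sum_log_convex : forall a n, 0 < a ->
  zero_sum a (S (S n)) * zero_sum a (S (S n)) <= zero_sum a (S n) * zero_sum a (S (S (S n))).
Proof.
intros a n Ha; rewrite !zero_sum_eq.
pose proof (rayleigh_log_convex a (n + n + 1) Ha) as H1.
pose proof (rayleigh_log_convex a (n + n + 2) Ha) as H2.
pose proof (rayleigh_log_convex a (n + n + 3) Ha) as H3.
replace (S (S (S n + S n))) with (n + n + 4)%nat by lia.
replace (S (S (S (S n) + S (S n)))) with (n + n + 6)%nat by lia.
replace (S (S (n + n))) with (n + n + 2)%nat by lia.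
replace (S (S (n + n + 1))) with (n + n + 3)%nat in H1 by lia.
replace (S (n + n + 1)) with (n + n + 2)%nat in H1 by lia.
replace (S (n + n + 3)) with (n + n + 4)%nat in H1 by lia.
replace (S (S (S (n + n + 2)))) with (n + n + 5)%nat in H2 by lia.
replace (S (S (n + n + 2))) with (n + n + 4)%nat in H2 by lia.
replace (S (n + n + 2)) with (n + n + 3)%nat in H2 by lia.
replace (S (S (S (n + n + 3)))) with (n + n + 6)%nat in H3 by lia.
replace (S (S (n + n + 3))) with (n + n + 5)%nat in H3 by lia.
replace (S (n + n + 3)) with (n + n + 4)%nat in H3 by lia.
assert (P : forall k, 0 < rayleigh a (n + n + S k)%nat).
{ intros k; replace (n + n + S k)%nat with (S (n + n + k)) by lia.
  apply rayleigh_pos; assumption. }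
pose proof (P 1%nat); pose proof (P 2%nat); pose proof (P 3%nat);
  pose proof (P 4%nat); pose proof (P 5%nat).
set (b2 := rayleigh a (n + n + 2)) in *; set (b3 := rayleigh a (n + n + 3)) in *.
set (b4 := rayleigh a (n + n + 4)) in *; set (b5 := rayleigh a (n + n + 5)) in *.
set (b6 := rayleigh a (n + n + 6)) in *.
assert (Hb : b4 * b4 <= b2 * b6).
{ apply Rmult_le_reg_l with (b3 * b5); [nra|].
  apply Rle_trans with ((b3 * b3) * (b5 * b5)).
  - assert (b4 * b4 * (b4 * b4) <= (b3 * b5) * (b3 * b5)) by
      (apply Rmult_le_compat; nra).
    assert (b4 * b4 <= b3 * b5) by assumption. nra.
  - replace (b3 * b5 * (b2 * b6)) with ((b2 * b4) * (b4 * b6) * (b3 * b5 / (b4 * b4)))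
      by (field; lra).
    apply Rle_trans with ((b2 * b4) * (b4 * b6)).
    + apply Rmult_le_compat; nra.
    + rewrite <- (Rmult_1_r (b2 * b4 * (b4 * b6))) at 1.
      apply Rmult_le_compat_l; [repeat apply Rmult_le_pos; lra|].
      apply Rle_div_r; nra. }
cbn [pow].
assert (Hq : 0 < (/ 16) ^ n) by (apply pow_lt; lra).
set (q := (/ 16) ^ n) in *.
replace (/ 16 * (/ 16 * q) * b4 * (/ 16 * (/ 16 * q) * b4))
  with (/ 16 * / 16 * / 16 * / 16 * (q * q) * (b4 * b4)) by ring.
replace (/ 16 * q * b2 * (/ 16 * (/ 16 * (/ 16 * q)) * b6))
  with (/ 16 * / 16 * / 16 * / 16 * (q * q) * (b2 * b6)) by ring.
apply Rmult_le_compat_l; [|assumption].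
assert (0 < q * q) by nra; nra.
Qed.

(** The inverse of [Phi]. Its convergence for [|w| < 1 / m_1] is what shows that
    [Phi] has no zero in that disc. *)
Definition quartic_inv (a : R) : series := sdiv sone (quartic_series a).

Lemma quartic_series_quartic_inv : forall a, smul (quartic_series a) (quartic_inv a) = sone.
Proof. intros a; apply smul_sdiv, quartic_series_0. Qed.

Lemma theta_quartic_inv : forall a, 0 < a ->
  theta (quartic_inv a) = smul (quartic_inv a) (zero_sum a).
Proof.
intros a Ha; apply (smul_cancel (quartic_series a)); [apply quartic_series_0|].
assert (E : theta (smul (quartic_series a) (quartic_inv a)) = szero).
{ rewrite quartic_series_quartic_inv; apply functional_extensionality; intros [|n];
    unfold theta, sone, szero; cbn; ring. }
rewrite theta_smul, theta_quartic_series in E by assumption.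
match type of E with ?A = _ =>
  transitivity (sadd A (smul (quartic_series a) (smul (quartic_inv a) (zero_sum a)))); [ring|] end.
rewrite E; ring.
Qed.

(** From [n e_n = sum_k m_k e_(n-k)] and [m_k <= m_1^k]. *)
Lemma quartic_inv_bounds : forall a n, 0 < a -> 0 <= quartic_inv a n <= zero_sum a 1 ^ n.
Proof.
intros a n Ha; induction n as [n IH] using lt_wf_ind; destruct n as [|n].
- unfold quartic_inv; cbn; lra.
- pose proof (equal_f (theta_quartic_inv a Ha) (S n)) as E; unfold theta in E.
  pose proof (pos_INR n) as Hn; pose proof (zero_sum_pos a 0 Ha) as Hm.
  rewrite smul_comm_pt, smul_sum, decomp_sum in E by lia.
  cbn [pred] in E; rewrite zero_sum_0, Rmult_0_l, Rplus_0_l in E.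
  assert (Hk : forall k, (k <= n)%nat ->
    0 <= zero_sum a (S k) * quartic_inv a (S n - S k)%nat <= zero_sum a 1 ^ S n).
  { intros k Hk; destruct (IH (S n - S k)%nat ltac:(lia)).
    pose proof (zero_sum_power_mean a 0 k Ha ltac:(lia)) as Hp; rewrite pow_1 in Hp.
    pose proof (zero_sum_pos a k Ha); split; [nra|].
    replace (zero_sum a 1 ^ S n) with (zero_sum a 1 ^ S k * zero_sum a 1 ^ (S n - S k))
      by (rewrite <- pow_add; f_equal; lia).
    apply Rmult_le_compat; lra. }
  assert (L : 0 <= INR (S n) * quartic_inv a (S n)).
  { rewrite E, <- (Rmult_0_r (INR (S n))), Rmult_comm, <- sum_cte.
    apply sum_Rle; intros; apply Hk; assumption. }
  assert (U : INR (S n) * quartic_inv a (S n) <= INR (S n) * zero_sum a 1 ^ S n).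
  { rewrite E, (Rmult_comm (INR (S n))), <- sum_cte; apply sum_Rle.
    intros; apply Hk; assumption. }
  rewrite S_INR in *; split;
    [apply Rmult_le_reg_l with (INR n + 1)|apply Rmult_le_reg_l with (INR n + 1)]; lra.
Qed.

(** * Complex series *)

Definition is_CSeries (x : nat -> C) (l : C) : Prop :=
  is_series (fun n => Re (x n)) (Re l) /\ is_series (fun n => Im (x n)) (Im l).
Definition cabs (x : nat -> C) : Prop := ex_series (fun n => Cmod (x n)).
Definition cps (p : series) (w : C) : C := CSeries (fun n => (RtoC (p n) * w ^ n)%C).
Definition psum (p : series) (r : R) : Prop := ex_series (fun n => Rabs (p n) * r ^ n).

Lemma C_eq : forall x y : C, Re x = Re y -> Im x = Im y -> x = y.
Proof. intros [a b] [c d] H1 H2; cbn in *; subst; reflexivity. Qed.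

Lemma is_CSeries_unique : forall x l, is_CSeries x l -> CSeries x = l.
Proof.
intros x l [H1 H2]; apply C_eq; cbn; apply is_series_unique; assumption.
Qed.

Lemma is_CSeries_ext : forall x y l,
  (forall n, x n = y n) -> is_CSeries x l -> is_CSeries y l.
Proof.
intros x y l E [H1 H2]; split.
- apply (is_series_ext (fun n => Re (x n))); [intros; rewrite E; reflexivity|assumption].
- apply (is_series_ext (fun n => Im (x n))); [intros; rewrite E; reflexivity|assumption].
Qed.

Lemma CSeries_ext : forall x y, (forall n, x n = y n) -> CSeries x = CSeries y.
Proof.
intros x y E; unfold CSeries; f_equal; apply Series_ext; intros n; rewrite E; reflexivity.
Qed.

Lemma im_le_Cmod : forall z : C, Rabs (Im z) <= Cmod z.
Proof.
intros z; pose proof (Rmax_Cmod z) as H; pose proof (Rmax_r (Rabs (fst z)) (Rabs (snd z))).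
unfold Im; lra.
Qed.

Lemma ex_series_dominated : forall (x y : nat -> R),
  (forall n, Rabs (x n) <= y n) -> ex_series y -> ex_series x.
Proof. intros x y H Hy; apply (ex_series_le x y); assumption. Qed.

Lemma cabs_re : forall x, cabs x -> ex_series (fun n => Rabs (Re (x n))).
Proof.
intros x H; apply (ex_series_dominated _ (fun n => Cmod (x n))); [|exact H].
intros n; rewrite Rabs_Rabsolu; apply re_le_Cmod.
Qed.

Lemma cabs_im : forall x, cabs x -> ex_series (fun n => Rabs (Im (x n))).
Proof.
intros x H; apply (ex_series_dominated _ (fun n => Cmod (x n))); [|exact H].
intros n; rewrite Rabs_Rabsolu; apply im_le_Cmod.
Qed.

Lemma cabs_correct : forall x, cabs x -> is_CSeries x (CSeries x).
Proof.
intros x H; split; apply Series_correct, ex_series_Rabs;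
  [apply cabs_re|apply cabs_im]; assumption.
Qed.

Lemma is_CSeries_scal : forall (k : C) x l,
  is_CSeries x l -> is_CSeries (fun n => (k * x n)%C) (k * l)%C.
Proof.
intros k x l [H1 H2]; split; cbn.
- exact (is_series_minus _ _ _ _ (is_series_scal_l (Re k) _ _ H1)
    (is_series_scal_l (Im k) _ _ H2)).
- exact (is_series_plus _ _ _ _ (is_series_scal_l (Re k) _ _ H2)
    (is_series_scal_l (Im k) _ _ H1)).
Qed.

Lemma is_CSeries_plus : forall x y l m,
  is_CSeries x l -> is_CSeries y m -> is_CSeries (fun n => (x n + y n)%C) (l + m)%C.
Proof.
intros x y l m [H1 H2] [H3 H4]; split; cbn.
- apply (is_series_plus (fun n => Re (x n)) (fun n => Re (y n))); assumption.
- apply (is_series_plus (fun n => Im (x n)) (fun n => Im (y n))); assumption.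
Qed.

(** The factor 2 comes from bounding real and imaginary parts separately. *)
Lemma CSeries_bound : forall x B, (forall n, Cmod (x n) <= B n) -> ex_series B ->
  Cmod (CSeries x) <= 2 * Series B.
Proof.
intros x B H HB.
assert (Hc : cabs x).
{ apply (ex_series_dominated _ B); [|assumption].
  intros n; rewrite Rabs_right by (apply Rle_ge, Cmod_ge_0); auto. }
assert (K : forall f, (forall n, Rabs (f (x n)) <= Cmod (x n)) ->
  Rabs (Series (fun n => f (x n))) <= Series B).
{ intros f Hf; apply Rle_trans with (Series (fun n => Rabs (f (x n)))).
  - apply Series_Rabs, (ex_series_dominated _ B); [|assumption].
    intros n; rewrite Rabs_Rabsolu; apply Rle_trans with (1 := Hf n); auto.
  - apply Series_le; [|assumption]; intros n; split; [apply Rabs_pos|].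
    apply Rle_trans with (1 := Hf n); auto. }
pose proof (K Re (fun n => re_le_Cmod _)); pose proof (K Im (fun n => im_le_Cmod _)).
replace (CSeries x) with (RtoC (Series (fun n => Re (x n)))
   + Ci * RtoC (Series (fun n => Im (x n))))%C
  by (apply C_eq; cbn; ring).
apply Rle_trans with (1 := Cmod_triangle _ _).
rewrite Cmod_mult, !Cmod_R.
replace (Cmod Ci) with 1; [lra|].
unfold Cmod, Ci; cbn; replace (0 * (0 * 1) + 1 * (1 * 1)) with 1 by ring.
symmetry; apply sqrt_1.
Qed.

Lemma psum_cabs : forall p w, psum p (Cmod w) ->
  cabs (fun n => (RtoC (p n) * w ^ n)%C).
Proof.
intros p w H; apply (ex_series_ext (fun n => Rabs (p n) * Cmod w ^ n)); [|exact H].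
intros n; rewrite Cmod_mult, Cmod_R, Cmod_pow; reflexivity.
Qed.

Lemma cps_correct : forall p w, psum p (Cmod w) ->
  is_CSeries (fun n => (RtoC (p n) * w ^ n)%C) (cps p w).
Proof. intros p w H; apply cabs_correct, psum_cabs, H. Qed.

Lemma Re_scal : forall r (z : C), Re (RtoC r * z)%C = r * Re z.
Proof. intros r [x y]; cbn; ring. Qed.
Lemma Im_scal : forall r (z : C), Im (RtoC r * z)%C = r * Im z.
Proof. intros r [x y]; cbn; ring. Qed.

(** The Cauchy product of the real and imaginary parts. *)
Lemma cps_mult : forall p q w, psum p (Cmod w) -> psum q (Cmod w) ->
  cps (smul p q) w = (cps p w * cps q w)%C.
Proof.
intros p q w Hp Hq; apply is_CSeries_unique.
pose proof (psum_cabs p w Hp) as Ap; pose proof (psum_cabs q w Hq) as Aq.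
destruct (cps_correct p w Hp) as [P1 P2]; destruct (cps_correct q w Hq) as [Q1 Q2].
pose proof (is_series_mult _ _ _ _ P1 Q1 (cabs_re _ Ap) (cabs_re _ Aq)) as RR.
pose proof (is_series_mult _ _ _ _ P2 Q2 (cabs_im _ Ap) (cabs_im _ Aq)) as II.
pose proof (is_series_mult _ _ _ _ P1 Q2 (cabs_re _ Ap) (cabs_im _ Aq)) as RI.
pose proof (is_series_mult _ _ _ _ P2 Q1 (cabs_im _ Ap) (cabs_re _ Aq)) as IR.
split.
- apply (is_series_ext (fun n => minus
    (sum_f_R0 (fun k => Re (RtoC (p k) * w ^ k)%C * Re (RtoC (q (n - k)%nat) * w ^ (n - k))%C) n)
    (sum_f_R0 (fun k => Im (RtoC (p k) * w ^ k)%C * Im (RtoC (q (n - k)%nat) * w ^ (n - k))%C) n))).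
  + intros n; unfold minus, plus, opp; cbn -[sum_f_R0 Re Im Cmult].
    rewrite Re_scal, smul_sum, Rmult_comm, scal_sum.
    fold (Rminus (sum_f_R0 (fun k => Re (RtoC (p k) * w ^ k)%C * Re (RtoC (q (n - k)%nat) * w ^ (n - k))%C) n)
     (sum_f_R0 (fun k => Im (RtoC (p k) * w ^ k)%C * Im (RtoC (q (n - k)%nat) * w ^ (n - k))%C) n)).
    rewrite <- minus_sum; apply sum_eq; intros k Hk.
    rewrite !Re_scal, !Im_scal.
    replace (w ^ n)%C with (w ^ k * w ^ (n - k))%C
      by (rewrite <- Cpow_add_r; f_equal; lia).
    unfold Cmult, Re, Im; cbn [fst snd]; ring.
  + apply (is_series_minus _ _ _ _ RR II).
- apply (is_series_ext (fun n => plus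
    (sum_f_R0 (fun k => Re (RtoC (p k) * w ^ k)%C * Im (RtoC (q (n - k)%nat) * w ^ (n - k))%C) n)
    (sum_f_R0 (fun k => Im (RtoC (p k) * w ^ k)%C * Re (RtoC (q (n - k)%nat) * w ^ (n - k))%C) n))).
  + intros n; unfold plus; cbn -[sum_f_R0 Re Im Cmult].
    rewrite Im_scal, smul_sum, Rmult_comm, scal_sum.
    rewrite <- sum_plus; apply sum_eq; intros k Hk.
    rewrite !Re_scal, !Im_scal.
    replace (w ^ n)%C with (w ^ k * w ^ (n - k))%C
      by (rewrite <- Cpow_add_r; f_equal; lia).
    unfold Cmult, Re, Im; cbn [fst snd]; ring.
  + apply (is_series_plus _ _ _ _ RI IR).
Qed.

Lemma cps_even : forall p w, (forall n, p (2 * n + 1)%nat = 0) -> psum p (Cmod w) ->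
  cps (even_part p) (w ^ 2)%C = cps p w.
Proof.
intros p w Hp Hs; apply is_CSeries_unique.
assert (K : forall (x : nat -> R) l, (forall n, x (2 * n + 1)%nat = 0) -> is_series x l ->
   is_series (fun n => x (2 * n)%nat) l).
{ intros x l Hx Hl.
  assert (E : forall n, sum_n (fun k => x (2 * k)%nat) n = sum_n x (2 * n)).
  { induction n as [|n IH]; [rewrite !sum_O; reflexivity|].
    rewrite sum_Sn, IH; replace (2 * S n)%nat with (S (S (2 * n))) by lia.
    rewrite !sum_Sn; replace (S (2 * n)) with (2 * n + 1)%nat at 2 by lia.
    rewrite Hx; unfold plus; cbn -[sum_n Nat.mul]; ring. }
  change (is_lim_seq (sum_n (fun k => x (2 * k)%nat)) l).
  apply (is_lim_seq_ext (fun n => sum_n x (2 * n)));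
    [intros n; symmetry; apply E|].
  apply (is_lim_seq_subseq (sum_n x) l (fun n => (2 * n)%nat)); [|exact Hl].
  apply eventually_subseq; intros n; lia. }
destruct (cps_correct p w Hs) as [H1 H2].
assert (Ew : forall n, (RtoC (even_part p n) * (w ^ 2) ^ n
   = RtoC (p (2 * n)%nat) * w ^ (2 * n))%C)
  by (intros n; rewrite Cpow_mult_r; reflexivity).
split.
- apply (is_series_ext (fun n => Re (RtoC (p (2 * n)%nat) * w ^ (2 * n))%C)).
  + intros n; rewrite Ew; reflexivity.
  + apply (K (fun n => Re (RtoC (p n) * w ^ n)%C)); [|assumption].
    intros n; rewrite Re_scal, Hp; ring.
- apply (is_series_ext (fun n => Im (RtoC (p (2 * n)%nat) * w ^ (2 * n))%C)).
  + intros n; rewrite Ew; reflexivity.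
  + apply (K (fun n => Im (RtoC (p n) * w ^ n)%C)); [|assumption].
    intros n; rewrite Im_scal, Hp; ring.
Qed.

Lemma cps_dilate : forall c p w, cps (dilate c p) w = cps p (RtoC c * w)%C.
Proof.
intros c p w; apply CSeries_ext; intros n; unfold dilate.
rewrite Cpow_mult_l, <- RtoC_pow, RtoC_mult; ring.
Qed.

Lemma cps_sone : forall w, cps sone w = RtoC 1.
Proof.
intros w; apply is_CSeries_unique.
assert (K : forall (x : nat -> R), (forall n, x (S n) = 0) -> is_series x (x O)).
{ intros x Hx; change (is_lim_seq (sum_n x) (x O)).
  apply (is_lim_seq_ext (fun _ => x O)); [|apply is_lim_seq_const].
  induction n as [|n IH]; [rewrite sum_O; reflexivity|].
  rewrite sum_Sn, <- IH, Hx; unfold plus; cbn; ring. }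
split.
- replace (Re (RtoC 1)) with (Re (RtoC (sone O) * w ^ 0)%C) by (cbn; ring).
  apply (K (fun n => Re (RtoC (sone n) * w ^ n)%C)).
  intros n; rewrite Re_scal; cbn; ring.
- replace (Im (RtoC 1)) with (Im (RtoC (sone O) * w ^ 0)%C) by (cbn; ring).
  apply (K (fun n => Im (RtoC (sone n) * w ^ n)%C)).
  intros n; rewrite Im_scal; cbn; ring.
Qed.

Lemma psum_le : forall p q r, 0 <= r -> (forall n, Rabs (p n) <= Rabs (q n)) ->
  psum q r -> psum p r.
Proof.
intros p q r Hr H Hq; apply (ex_series_dominated _ (fun n => Rabs (q n) * r ^ n)); [|exact Hq].
intros n; rewrite Rabs_mult, Rabs_Rabsolu, (Rabs_right (r ^ n))
  by (apply Rle_ge, pow_le; assumption).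
apply Rmult_le_compat_r; [apply pow_le; assumption|apply H].
Qed.

Lemma psum_geom : forall p b r, 0 <= b -> 0 <= r -> b * r < 1 ->
  (forall n, Rabs (p n) <= b ^ n) -> psum p r.
Proof.
intros p b r Hb Hr Hbr H.
apply (ex_series_dominated _ (fun n => (b * r) ^ n)).
- intros n; rewrite Rabs_mult, Rabs_Rabsolu, (Rabs_right (r ^ n))
    by (apply Rle_ge, pow_le; assumption).
  rewrite Rpow_mult_distr; apply Rmult_le_compat_r; [apply pow_le; assumption|apply H].
- apply ex_series_geom; rewrite Rabs_right; nra.
Qed.

(** * Entire series *)

(** Boundedness of the terms at every radius amounts to infinite radius of
    convergence, and passes to products, dilations and subseries without any
    summation. *)
Definition entire (p : series) : Prop :=
  forall r, 0 <= r -> exists B, forall n, Rabs (p n) * r ^ n <= B.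

Lemma lt_pow2 : forall n, INR n + 1 <= 2 ^ n.
Proof.
induction n as [|n IH]; [cbn; lra|]; rewrite S_INR; cbn [pow].
assert (1 <= 2 ^ n) by (apply pow_R1_Rle; lra); lra.
Qed.

Lemma entire_psum : forall p r, entire p -> 0 <= r -> psum p r.
Proof.
intros p r Hp Hr; destruct (Hp (2 * r) ltac:(lra)) as [B HB].
apply (ex_series_dominated _ (fun n => (/ 2) ^ n * B)).
- intros n; rewrite Rabs_mult, Rabs_Rabsolu, (Rabs_right (r ^ n))
    by (apply Rle_ge, pow_le; assumption).
  specialize (HB n); rewrite Rpow_mult_distr in HB.
  assert (0 < 2 ^ n) by (apply pow_lt; lra).
  rewrite pow_inv; apply Rmult_le_reg_l with (2 ^ n); [assumption|].
  replace (2 ^ n * (/ 2 ^ n * B)) with B by (field; lra).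
  replace (2 ^ n * (Rabs (p n) * r ^ n)) with (Rabs (p n) * (2 ^ n * r ^ n)) by ring; lra.
- apply ex_series_scal_r, ex_series_geom; rewrite Rabs_right; lra.
Qed.

Lemma entire_smul : forall p q, entire p -> entire q -> entire (smul p q).
Proof.
intros p q Hp Hq r Hr.
destruct (Hp (2 * r) ltac:(lra)) as [B HB]; destruct (Hq (2 * r) ltac:(lra)) as [B' HB'].
assert (HB0 : 0 <= B) by (apply Rle_trans with (2 := HB O), Rmult_le_pos;
  [apply Rabs_pos|apply pow_le; lra]).
exists (B * B'); intros n.
assert (Hs : Rabs (smul p q n) * (2 * r) ^ n <= B * B' * (INR n + 1)).
{ rewrite smul_sum.
  apply Rle_trans with (sum_f_R0 (fun k => Rabs (p k * q (n - k)%nat)) n * (2 * r) ^ n).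
  - apply Rmult_le_compat_r; [apply pow_le; lra|apply Rsum_abs].
  - rewrite Rmult_comm, scal_sum, <- S_INR, <- sum_cte.
    apply sum_Rle; intros k Hk; rewrite Rabs_mult.
    replace ((2 * r) ^ n) with ((2 * r) ^ k * (2 * r) ^ (n - k))
      by (rewrite <- pow_add; f_equal; lia).
    replace (Rabs (p k) * Rabs (q (n - k)%nat) * ((2 * r) ^ k * (2 * r) ^ (n - k)))
      with ((Rabs (p k) * (2 * r) ^ k) * (Rabs (q (n - k)%nat) * (2 * r) ^ (n - k))) by ring.
    apply Rmult_le_compat; auto; apply Rmult_le_pos;
      try apply Rabs_pos; apply pow_le; lra. }
rewrite Rpow_mult_distr in Hs; pose proof (lt_pow2 n).
assert (HBB : 0 <= B * B').
{ apply Rmult_le_pos; [assumption|]; apply Rle_trans with (2 := HB' O), Rmult_le_pos;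
  [apply Rabs_pos|apply pow_le; lra]. }
assert (0 < 2 ^ n) by (apply pow_lt; lra).
apply Rmult_le_reg_l with (2 ^ n); [assumption|].
replace (2 ^ n * (Rabs (smul p q n) * r ^ n))
  with (Rabs (smul p q n) * (2 ^ n * r ^ n)) by ring.
apply Rle_trans with (1 := Hs); rewrite (Rmult_comm (2 ^ n)).
apply Rmult_le_compat_l; assumption.
Qed.

Lemma entire_dilate : forall c p, entire p -> entire (dilate c p).
Proof.
intros c p Hp r Hr; destruct (Hp (Rabs c * r)) as [B HB].
- apply Rmult_le_pos; [apply Rabs_pos|assumption].
- exists B; intros n; specialize (HB n); unfold dilate.
  rewrite Rabs_mult, <- RPow_abs; rewrite Rpow_mult_distr in HB; lra.
Qed.

Lemma entire_even : forall p, entire p -> entire (even_part p).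
Proof.
intros p Hp r Hr; destruct (Hp (1 + r) ltac:(lra)) as [B HB].
exists B; intros n; apply Rle_trans with (2 := HB (2 * n)%nat); unfold even_part.
apply Rmult_le_compat_l; [apply Rabs_pos|].
rewrite pow_mult; apply pow_incr; split; [assumption|]; cbn; nra.
Qed.

Lemma pow_fact_le_exp : forall x n, 0 <= x -> x ^ n / INR (fact n) <= exp x.
Proof.
intros x n Hx.
assert (Ht : forall k, 0 <= x ^ k / INR (fact k))
  by (intros k; apply Rdiv_le_0_compat; [apply pow_le; assumption|apply INR_fact_lt_0]).
pose proof (is_exp_Reals x) as H.
assert (E : is_lim_seq (sum_n (fun k => x ^ k / INR (fact k))) (exp x)).
{ apply (is_series_ext (fun k => scal (pow_n x k) (/ INR (fact k)))); [|exact H].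
  intros k; rewrite pow_n_pow; reflexivity. }
apply Rle_trans with (sum_n (fun k => x ^ k / INR (fact k)) n).
- destruct n as [|n]; [rewrite sum_O; lra|].
  rewrite sum_Sn, sum_n_Reals; unfold plus; cbn [AbelianMonoid.plus].
  assert (0 <= sum_f_R0 (fun k => x ^ k / INR (fact k)) n) by (apply cond_pos_sum, Ht).
  change (x ^ S n / INR (fact (S n)) <=
    sum_f_R0 (fun k => x ^ k / INR (fact k)) n + x ^ S n / INR (fact (S n))); lra.
- apply (is_lim_seq_incr_compare _ (exp x) E).
  intros k; rewrite sum_Sn.
  change (sum_n (fun k => x ^ k / INR (fact k)) k <=
    sum_n (fun k => x ^ k / INR (fact k)) k + x ^ S k / INR (fact (S k))).
  pose proof (Ht (S k)); lra.
Qed.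

Lemma entire_bessel_series : forall a, 0 < a -> entire (bessel_series a).
Proof.
intros a Ha r Hr.
set (d := Rmin a 1).
assert (Hd : 0 < d) by (apply Rmin_pos; lra).
assert (Hda : d <= a) by apply Rmin_l; assert (Hd1 : d <= 1) by apply Rmin_r.
exists (exp (r / d)); intros n.
assert (Hpoch : d ^ n <= pochhammer a n).
{ induction n as [|n IH]; [cbn; lra|cbn [pow pochhammer]].
  assert (0 < d ^ n) by (apply pow_lt; assumption); pose proof (pos_INR n).
  rewrite Rmult_comm; apply Rmult_le_compat; lra. }
assert (Hdn : 0 < d ^ n) by (apply pow_lt; assumption).
assert (Hx : 0 <= r / d) by (apply Rdiv_le_0_compat; assumption).
pose proof (INR_fact_lt_0 n) as Hf.
apply Rle_trans with ((r / d) ^ n / INR (fact n)).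
- unfold bessel_series; rewrite Rabs_div, pow_1_abs by (apply Rgt_not_eq, Rmult_lt_0_compat; lra).
  rewrite Rabs_right by (apply Rle_ge, Rlt_le, Rmult_lt_0_compat; lra).
  unfold Rdiv at 1 2; rewrite Rmult_1_l, Rinv_mult.
  unfold Rdiv at 1; rewrite Rpow_mult_distr, pow_inv.
  replace (/ INR (fact n) * / pochhammer a n * r ^ n)
    with (r ^ n * / pochhammer a n * / INR (fact n)) by ring.
  apply Rmult_le_compat_r; [left; apply Rinv_0_lt_compat; assumption|].
  apply Rmult_le_compat_l; [apply pow_le; assumption|].
  apply Rinv_le_contravar; assumption.
- apply (pow_fact_le_exp (r / d) n Hx).
Qed.

(** * Differentiation of complex power series *)

Lemma C_shift_eq : forall (x : R) (z : C), (x, snd z) = (z + RtoC (x - fst z))%C.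
Proof. intros x z; apply C_eq; cbn; ring. Qed.

(** [C_derive] only takes limits along the horizontal direction, so the
    remainder is needed for real increments only. *)
Lemma C_derive_of_bound : forall (f : C -> C) z d B,
  (forall h : R, Rabs h < 1 ->
     Cmod (f (z + RtoC h) - f z - RtoC h * d)%C <= B * h ^ 2) ->
  C_derive f z = d.
Proof.
intros f z d B H.
assert (Hq : forall eps : posreal, Rbar_locally' (fst z) (fun x =>
   Cmod ((f (x, snd z) - f z) / ((x, snd z) - z) - d)%C < eps)).
{ intros eps.
  assert (Hd : 0 < Rmin 1 (eps / (Rabs B + 1))).
  { apply Rmin_pos; [lra|]; apply Rdiv_lt_0_compat; [apply cond_pos|].
    pose proof (Rabs_pos B); lra. }
  exists (mkposreal _ Hd).
  assert (K : forall x : R, Rabs (x - fst z) < Rmin 1 (eps / (Rabs B + 1)) ->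
    x <> fst z -> Cmod ((f (x, snd z) - f z) / ((x, snd z) - z) - d)%C < eps);
    [|exact K].
  intros x Hh Hne; set (h := x - fst z) in *.
  assert (Hh0 : h <> 0) by (unfold h; lra).
  assert (Ez : (x, snd z) = (z + RtoC h)%C) by apply C_shift_eq.
  rewrite Ez.
  assert (Hne' : RtoC h <> RtoC 0) by (intros E; apply RtoC_inj in E; lra).
  replace ((f (z + RtoC h) - f z) / (z + RtoC h - z) - d)%C
    with ((f (z + RtoC h) - f z - RtoC h * d) / RtoC h)%C.
  2:{ replace (z + RtoC h - z)%C with (RtoC h) by ring; field; assumption. }
  rewrite Cmod_div by assumption; rewrite Cmod_R.
  pose proof (Rmin_l 1 (eps / (Rabs B + 1))); pose proof (Rmin_r 1 (eps / (Rabs B + 1))).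
  specialize (H h ltac:(lra)).
  assert (Ha : 0 < Rabs h) by (apply Rabs_pos_lt; assumption).
  apply Rlt_div_l; [assumption|].
  apply Rle_lt_trans with (1 := H).
  rewrite <- pow2_abs; pose proof (Rle_abs B); pose proof (Rabs_pos B).
  assert (Rabs h * (Rabs B + 1) < eps) by (apply Rlt_div_r; lra).
  nra. }
apply C_eq; unfold C_derive, C_lim; cbn [Re Im fst snd].
- assert (E : is_lim (fun x => fst ((f (x, snd z) - f z) / ((x, snd z) - z))%C)
    (fst z) (fst d)).
  { apply is_lim_spec; intros eps; generalize (Hq eps).
    apply filter_imp; intros x Hx.
    apply Rle_lt_trans with (2 := Hx).
    exact (re_le_Cmod ((f (x, snd z) - f z) / ((x, snd z) - z) - d)%C). }
  rewrite (is_lim_unique _ _ _ E); reflexivity.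
- assert (E : is_lim (fun x => snd ((f (x, snd z) - f z) / ((x, snd z) - z))%C)
    (fst z) (snd d)).
  { apply is_lim_spec; intros eps; generalize (Hq eps).
    apply filter_imp; intros x Hx.
    apply Rle_lt_trans with (2 := Hx).
    exact (im_le_Cmod ((f (x, snd z) - f z) / ((x, snd z) - z) - d)%C). }
  rewrite (is_lim_unique _ _ _ E); reflexivity.
Qed.

(** A remainder whose growth in [n] is polynomial times geometric, hence
    summable against the coefficients of an entire series. *)
Lemma Cpow_taylor : forall (z h : C) rho n, 1 <= rho -> Cmod z <= rho ->
  Cmod (z + h)%C <= rho ->
  Cmod ((z + h) ^ S n - z ^ S n - RtoC (INR (S n)) * z ^ n * h)%C
    <= INR (S n) ^ 2 * rho ^ S n * Cmod h ^ 2.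
Proof.
intros z h rho n Hr Hz Hzh; induction n as [|n IH].
- replace ((z + h) ^ 1 - z ^ 1 - RtoC (INR 1) * z ^ 0 * h)%C with (RtoC 0)
    by (cbn; ring).
  rewrite Cmod_0; cbn; pose proof (pow2_ge_0 (Cmod h)); nra.
- replace ((z + h) ^ S (S n) - z ^ S (S n) - RtoC (INR (S (S n))) * z ^ S n * h)%C
    with ((z + h) * ((z + h) ^ S n - z ^ S n - RtoC (INR (S n)) * z ^ n * h)
          + RtoC (INR (S n)) * z ^ n * (h * h))%C
    by (rewrite (S_INR (S n)), RtoC_plus; cbn [Cpow]; ring).
  apply Rle_trans with (1 := Cmod_triangle _ _).
  rewrite !Cmod_mult, Cmod_pow, Cmod_R.
  pose proof (pos_INR (S n)) as Hn.
  rewrite (Rabs_right (INR (S n))) by lra.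
  set (A := Cmod ((z + h) ^ S n - z ^ S n - RtoC (INR (S n)) * z ^ n * h)) in *.
  assert (HA : 0 <= A) by apply Cmod_ge_0.
  pose proof (Cmod_ge_0 z); pose proof (Cmod_ge_0 (z + h)); pose proof (Cmod_ge_0 h).
  assert (Hp : Cmod z ^ n <= rho ^ n) by (apply pow_incr; lra).
  assert (Hpn : 1 <= rho ^ n) by (apply pow_R1_Rle; lra).
  set (P := rho ^ n) in *; set (Q := Cmod z ^ n) in *; set (m := INR (S n)) in *.
  assert (HQ : 0 <= Q) by (apply pow_le; lra).
  rewrite (S_INR (S n)); fold m; cbn [pow] in *; fold P in IH |- *.
  set (hh := Cmod h) in *.
  assert (Hs1 : Cmod (z + h) * A <= rho * (m * (m * 1) * (rho * P) * (hh * (hh * 1))))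
    by (apply Rmult_le_compat; assumption).
  assert (Hs2 : m * Q * (hh * hh) <= m * (rho * (rho * P)) * (hh * hh)).
  { apply Rmult_le_compat_r; [nra|]; apply Rmult_le_compat_l; [assumption|].
    assert (P <= rho * P) by nra.
    assert (rho * P <= rho * (rho * P)) by (apply Rmult_le_compat_l; lra).
    lra. }
  apply Rle_trans with (1 := Rplus_le_compat _ _ _ _ Hs1 Hs2).
  assert (Hb : 0 <= (rho * (rho * P)) * (hh * hh))
    by (repeat apply Rmult_le_pos; lra).
  replace (rho * (m * (m * 1) * (rho * P) * (hh * (hh * 1))) + m * (rho * (rho * P)) * (hh * hh))
    with ((m * m + m) * ((rho * (rho * P)) * (hh * hh))) by ring.
  replace ((m + 1) * ((m + 1) * 1) * (rho * (rho * P)) * (hh * (hh * 1)))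
    with ((m + 1) * (m + 1) * ((rho * (rho * P)) * (hh * hh))) by ring.
  apply Rmult_le_compat_r; [assumption|nra].
Qed.

Lemma entire_theta : forall p, entire p -> entire (theta p).
Proof.
intros p Hp r Hr; destruct (Hp (2 * r) ltac:(lra)) as [B HB].
exists B; intros n; apply Rle_trans with (2 := HB n); unfold theta.
rewrite Rabs_mult, Rabs_right by (apply Rle_ge, pos_INR).
rewrite Rpow_mult_distr; pose proof (lt_pow2 n).
assert (0 <= Rabs (p n) * r ^ n)
  by (apply Rmult_le_pos; [apply Rabs_pos|apply pow_le; assumption]).
nra.
Qed.

Lemma cps_scal : forall c p w, psum p (Cmod w) ->
  cps (fun n => c * p n) w = (RtoC c * cps p w)%C.
Proof.
intros c p w Hp; apply is_CSeries_unique.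
apply (is_CSeries_ext (fun n => (RtoC c * (RtoC (p n) * w ^ n))%C)).
- intros n; rewrite RtoC_mult; ring.
- apply is_CSeries_scal, cps_correct; assumption.
Qed.

(** The form of [v_nu]. *)
Definition quartic (p : series) (z : C) : C := (z * cps p (z ^ 4))%C.

Lemma quartic_correct : forall p z, entire p ->
  is_CSeries (fun n => (RtoC (p n) * z ^ S (4 * n))%C) (quartic p z).
Proof.
intros p z Hp.
apply (is_CSeries_ext (fun n => (z * (RtoC (p n) * (z ^ 4) ^ n))%C)).
- intros n; rewrite <- Cpow_mult_r; cbn [Cpow]; ring.
- apply is_CSeries_scal, cps_correct, entire_psum; [assumption|apply Cmod_ge_0].
Qed.

Lemma quartic_derive : forall p z, entire p ->
  C_derive (quartic p) z = (cps p (z ^ 4) + 4 * cps (theta p) (z ^ 4))%C.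
Proof.
intros p z Hp.
set (rho := Cmod z + 1); set (d := (cps p (z ^ 4) + 4 * cps (theta p) (z ^ 4))%C).
pose proof (Cmod_ge_0 z) as Hz.
assert (Hrho : 1 <= rho) by (unfold rho; lra).
assert (Hd : is_CSeries (fun n => (RtoC (p n) * (RtoC (INR (S (4 * n))) * z ^ (4 * n)))%C) d).
{ apply (is_CSeries_ext (fun n => (RtoC (p n) * (z ^ 4) ^ n
     + 4 * (RtoC (theta p n) * (z ^ 4) ^ n))%C)).
  - intros n; unfold theta; rewrite <- Cpow_mult_r, S_INR, mult_INR.
    replace (INR 4) with 4 by (cbn; ring).
    rewrite RtoC_plus, !RtoC_mult; ring.
  - apply is_CSeries_plus; [|apply is_CSeries_scal];
      apply cps_correct, entire_psum; try apply Cmod_ge_0;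
      [|apply entire_theta]; assumption. }
set (Bn := fun n => Rabs (p n) * (4 * rho ^ 4) ^ n).
assert (HB : ex_series Bn).
{ apply entire_psum; [assumption|].
  assert (0 <= rho ^ 4) by (apply pow_le; lra); lra. }
apply (C_derive_of_bound _ _ _ (2 * (16 * rho * Series Bn))).
intros h Hh.
pose proof (quartic_correct p (z + RtoC h) Hp) as H1.
pose proof (quartic_correct p z Hp) as H0.
assert (HC : is_CSeries (fun n => (RtoC (p n) *
   ((z + RtoC h) ^ S (4 * n) - z ^ S (4 * n)
    - RtoC (INR (S (4 * n))) * z ^ (4 * n) * RtoC h))%C)
   (quartic p (z + RtoC h) - quartic p z - RtoC h * d)%C).
{ apply (is_CSeries_ext (fun n => ((RtoC (p n) * (z + RtoC h) ^ S (4 * n)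
     + (- RtoC 1) * (RtoC (p n) * z ^ S (4 * n)))
     + (- RtoC h) * (RtoC (p n) * (RtoC (INR (S (4 * n))) * z ^ (4 * n))))%C)).
  - intros n; ring.
  - replace (quartic p (z + RtoC h) - quartic p z - RtoC h * d)%C
      with ((quartic p (z + RtoC h) + (- RtoC 1) * quartic p z) + (- RtoC h) * d)%C by ring.
    apply is_CSeries_plus; [apply is_CSeries_plus|]; try apply is_CSeries_scal; assumption. }
rewrite <- (is_CSeries_unique _ _ HC).
replace (2 * (16 * rho * Series Bn) * h ^ 2)
  with (2 * Series (fun n => 16 * rho * h ^ 2 * Bn n))
  by (rewrite Series_scal_l; ring).
apply CSeries_bound; [|apply (ex_series_scal_l (16 * rho * h ^ 2) Bn HB)].
intros n; rewrite Cmod_mult, Cmod_R.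
assert (Hzh : Cmod (z + RtoC h) <= rho).
{ apply Rle_trans with (1 := Cmod_triangle _ _); rewrite Cmod_R; unfold rho; lra. }
assert (Hz' : Cmod z <= rho) by (unfold rho; lra).
pose proof (Cpow_taylor z (RtoC h) rho (4 * n) Hrho Hz' Hzh) as HT.
rewrite Cmod_R, pow2_abs in HT.
assert (Hn : INR (S (4 * n)) ^ 2 <= 16 * 4 ^ n).
{ assert (INR (S (4 * n)) <= 4 * 2 ^ n).
  { rewrite S_INR, mult_INR; replace (INR 4) with 4 by (cbn; ring).
    pose proof (lt_pow2 n); pose proof (pos_INR n); lra. }
  replace (16 * 4 ^ n) with ((4 * 2 ^ n) ^ 2).
  - apply (pow_incr (INR (S (4 * n)))); split; [apply pos_INR|assumption].
  - rewrite Rpow_mult_distr, <- pow_mult, Nat.mul_comm, pow_mult.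
    replace (2 ^ 2) with 4 by ring; ring. }
unfold Bn; rewrite Rpow_mult_distr, <- pow_mult.
assert (Hrn : 0 <= rho ^ (4 * n)) by (apply pow_le; lra).
apply Rle_trans with (Rabs (p n) * (INR (S (4 * n)) ^ 2 * rho ^ S (4 * n) * h ^ 2)).
{ apply Rmult_le_compat_l; [apply Rabs_pos|assumption]. }
apply Rle_trans with (Rabs (p n) * (16 * 4 ^ n * rho ^ S (4 * n) * h ^ 2)).
- apply Rmult_le_compat_l; [apply Rabs_pos|].
  apply Rmult_le_compat_r; [apply pow2_ge_0|].
  apply Rmult_le_compat_r; [apply pow_le; lra|assumption].
- right; rewrite <- (tech_pow_Rmult rho (4 * n)); ring.
Qed.

Lemma entire_quartic_series : forall a, 0 < a -> entire (quartic_series a).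
Proof.
intros a Ha; apply entire_dilate, entire_even, entire_smul;
  [|apply entire_dilate]; apply entire_bessel_series; assumption.
Qed.

Lemma zero_sum_psum : forall a r, 0 < a -> 0 <= r ->
  zero_sum a 1 * r < 1 -> psum (zero_sum a) r.
Proof.
intros a r Ha Hr H; pose proof (zero_sum_pos a 0 Ha).
apply (psum_geom _ (zero_sum a 1)); try assumption; [lra|].
intros [|n].
- rewrite zero_sum_0, Rabs_R0; cbn; lra.
- rewrite Rabs_right by (apply Rle_ge, zero_sum_nonneg; assumption).
  pose proof (zero_sum_power_mean a 0 n Ha ltac:(lia)) as Hp; rewrite pow_1 in Hp; exact Hp.
Qed.

Lemma quartic_inv_psum : forall a r, 0 < a -> 0 <= r ->
  zero_sum a 1 * r < 1 -> psum (quartic_inv a) r.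
Proof.
intros a r Ha Hr H; pose proof (zero_sum_pos a 0 Ha).
apply (psum_geom _ (zero_sum a 1)); try assumption; [lra|].
intros n; destruct (quartic_inv_bounds a n Ha); rewrite Rabs_right; lra.
Qed.

(** [Phi] does not vanish, because the product of its value and that of the
    inverse series is 1, and [w Phi' = - Phi M] by [theta_quartic_series]. *)
Lemma quartic_log_derivative : forall a z, 0 < a -> z <> RtoC 0 ->
  zero_sum a 1 * Cmod z ^ 4 < 1 ->
  quartic (quartic_series a) z <> RtoC 0 /\
  (z * C_derive (quartic (quartic_series a)) z / quartic (quartic_series a) z
     = 1 - 4 * cps (zero_sum a) (z ^ 4))%C.
Proof.
intros a z Ha Hz Hm.
set (w := (z ^ 4)%C).
assert (Ew : Cmod w = Cmod z ^ 4) by apply Cmod_pow.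
pose proof (Cmod_ge_0 w) as Hw.
pose proof (entire_quartic_series a Ha) as He.
assert (P1 : psum (quartic_series a) (Cmod w)) by (apply entire_psum; assumption).
assert (P2 : psum (zero_sum a) (Cmod w))
  by (apply zero_sum_psum; try assumption; rewrite Ew; assumption).
assert (P3 : psum (quartic_inv a) (Cmod w))
  by (apply quartic_inv_psum; try assumption; rewrite Ew; assumption).
pose proof (cps_mult _ _ _ P1 P3) as E1.
rewrite quartic_series_quartic_inv, cps_sone in E1.
assert (N : cps (quartic_series a) w <> RtoC 0).
{ intros E; rewrite E, Cmult_0_l in E1; apply RtoC_inj in E1; lra. }
split.
- unfold quartic; apply Cmult_neq_0; assumption.
- rewrite quartic_derive by assumption; fold w.
  assert (E2 : cps (theta (quartic_series a)) w = (- (cps (quartic_series a) w * cps (zero_sum a) w))%C).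
  { rewrite <- cps_mult by assumption; rewrite theta_quartic_series by assumption.
    replace (sopp (smul (quartic_series a) (zero_sum a)))
      with (fun n => Ropp 1 * smul (quartic_series a) (zero_sum a) n)
      by (apply functional_extensionality; intros; unfold sopp; ring).
    rewrite cps_scal; [rewrite RtoC_opp; ring|].
    apply (psum_le _ (theta (quartic_series a))); [assumption| |].
    - rewrite theta_quartic_series by assumption; intros n; unfold sopp; rewrite Rabs_Ropp; lra.
    - apply entire_psum; [apply entire_theta|]; assumption. }
  rewrite E2; unfold quartic; fold w; field; split; assumption.
Qed.

(** * The radius as the solution of a real equation *)

Lemma root_pos : forall n x, 0 < root n x.
Proof. intros n x; unfold root, Rpower; apply exp_pos. Qed.

Lemma root_pow : forall n x, 0 < x -> root (S n) x ^ S n = x.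
Proof.
intros n x Hx; rewrite <- Rpower_pow by apply root_pos; unfold root.
rewrite Rpower_mult, Rinv_l by (apply not_0_INR; lia); apply Rpower_1; assumption.
Qed.

Lemma pow_lt_reg : forall n x y, 0 <= y -> x ^ S n < y ^ S n -> 0 <= x -> x < y.
Proof.
intros n x y Hy H Hx; destruct (Rlt_le_dec x y) as [|Hyx]; [assumption|exfalso].
assert (y ^ S n <= x ^ S n) by (apply pow_incr; lra); lra.
Qed.

Lemma pow_lt_compat : forall n x y, 0 <= x -> x < y -> x ^ S n < y ^ S n.
Proof.
intros n x y Hx H; induction n as [|n IH]; [cbn; lra|].
rewrite <- !(tech_pow_Rmult _ (S n)).
assert (0 <= x ^ S n) by (apply pow_le; assumption); nra.
Qed.

Lemma pow_inj_pos : forall n x y, 0 <= x -> 0 <= y -> x ^ S n = y ^ S n -> x = y.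
Proof.
intros n x y Hx Hy E; destruct (Rtotal_order x y) as [H|[H|H]]; [|assumption|].
- pose proof (pow_lt_compat n x y Hx H); lra.
- pose proof (pow_lt_compat n y x Hy H); lra.
Qed.

Lemma root_lt : forall n x y, 0 < x -> x < y -> root (S n) x < root (S n) y.
Proof.
intros n x y Hx Hxy; unfold root; apply Rlt_Rpower_l; [|split; assumption].
apply Rinv_0_lt_compat, lt_0_INR; lia.
Qed.

Lemma zero_sum_CV_radius : forall a w, 0 < a -> 0 <= w -> zero_sum a 1 * w < 1 ->
  Rbar_lt (Rabs w) (CV_radius (zero_sum a)).
Proof.
intros a w Ha Hw H; pose proof (zero_sum_pos a 0 Ha) as Hm.
set (r := (w + / zero_sum a 1) / 2).
assert (Hi : w < / zero_sum a 1).
{ apply Rmult_lt_reg_l with (zero_sum a 1); [assumption|]; rewrite Rinv_r; lra. }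
assert (Hr : w < r < / zero_sum a 1) by (unfold r; lra).
assert (Hr1 : zero_sum a 1 * r < 1).
{ apply Rlt_le_trans with (zero_sum a 1 * / zero_sum a 1); [|rewrite Rinv_r; lra].
  apply Rmult_lt_compat_l; lra. }
rewrite Rabs_right by lra.
apply Rbar_lt_le_trans with r; [cbn; lra|].
apply (proj1 (Lub_Rbar_correct (CV_disk (zero_sum a)))).
unfold CV_disk; pose proof (zero_sum_psum a r Ha ltac:(lra) Hr1) as Hs.
apply (ex_series_ext (fun n => Rabs (zero_sum a n) * r ^ n)); [|exact Hs].
intros n; rewrite Rabs_mult, (Rabs_right (r ^ n)); [reflexivity|].
apply Rle_ge, pow_le; lra.
Qed.

Lemma zero_sum_ex_series : forall a w, 0 < a -> 0 <= w -> zero_sum a 1 * w < 1 ->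
  ex_series (fun n => zero_sum a n * w ^ n).
Proof.
intros a w Ha Hw H; pose proof (zero_sum_psum a w Ha Hw H) as Hs.
apply (ex_series_ext (fun n => Rabs (zero_sum a n) * w ^ n)); [|exact Hs].
intros n; rewrite Rabs_right; [reflexivity|]; apply Rle_ge, zero_sum_nonneg; assumption.
Qed.

Lemma zero_sum_continuous : forall a w eps, 0 < a -> 0 <= w -> zero_sum a 1 * w < 1 ->
  0 < eps -> exists d, 0 < d /\ forall w', Rabs (w' - w) < d ->
    Rabs (PSeries (zero_sum a) w' - PSeries (zero_sum a) w) < eps.
Proof.
intros a w eps Ha Hw H He.
pose proof (PSeries_continuity (zero_sum a) w (zero_sum_CV_radius a w Ha Hw H)) as Hc.
destruct (Hc eps He) as [d [Hd Hd']]; exists d; split; [exact Hd|].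
intros w' Hw'; destruct (Req_dec w' w) as [->|Hne].
- rewrite Rminus_diag_eq, Rabs_R0 by reflexivity; assumption.
- apply (Hd' w'); split; [|exact Hw'].
  split; [exact I|]; intros E; apply Hne; symmetry; exact E.
Qed.

(** Where the positivity of the [m_k] enters: on a circle the real part of [M]
    is largest on the positive axis. *)
Lemma re_cps_zero_sum_le : forall a w, 0 < a -> zero_sum a 1 * Cmod w < 1 ->
  Re (cps (zero_sum a) w) <= PSeries (zero_sum a) (Cmod w).
Proof.
intros a w Ha H; pose proof (Cmod_ge_0 w) as Hw.
pose proof (zero_sum_psum a _ Ha Hw H) as Hs.
change (Re (cps (zero_sum a) w))
  with (Series (fun n => Re (RtoC (zero_sum a n) * w ^ n)%C)).
apply Rle_trans with (Series (fun n => Rabs (Re (RtoC (zero_sum a n) * w ^ n)%C))).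
- apply Rle_trans with (1 := Rle_abs _), Series_Rabs, cabs_re, psum_cabs, Hs.
- apply Series_le; [|apply zero_sum_ex_series; assumption].
  intros n; split; [apply Rabs_pos|].
  rewrite Re_scal, Rabs_mult, Rabs_right by (apply Rle_ge, zero_sum_nonneg; assumption).
  apply Rmult_le_compat_l; [apply zero_sum_nonneg; assumption|].
  rewrite <- Cmod_pow; apply re_le_Cmod.
Qed.

Lemma re_cps_real : forall p x, Re (cps p (RtoC x)) = PSeries p x.
Proof.
intros p x; change (Re (cps p (RtoC x)))
  with (Series (fun n => Re (RtoC (p n) * RtoC x ^ n)%C)).
apply Series_ext; intros n; rewrite <- RtoC_pow, Re_scal; reflexivity.
Qed.

Lemma zero_sum_increasing : forall a x y, 0 < a -> 0 <= x <= y -> zero_sum a 1 * y < 1 ->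
  PSeries (zero_sum a) x <= PSeries (zero_sum a) y.
Proof.
intros a x y Ha Hxy H; apply Series_le; [|apply zero_sum_ex_series; lra].
intros n; pose proof (zero_sum_nonneg a n Ha); split.
- apply Rmult_le_pos; [assumption|apply pow_le; lra].
- apply Rmult_le_compat_l; [assumption|apply pow_incr; lra].
Qed.

(** Continuity of [M] provides a slightly larger [w] with [M(w) < 1/4], which
    makes the inequality strict. *)
Lemma radius_gt : forall a w, 0 < a -> 0 < w -> zero_sum a 1 * w < 1 ->
  PSeries (zero_sum a) w < / 4 ->
  Rbar_lt (root 4 w) (radius_starlikeness (quartic (quartic_series a))).
Proof.
intros a w Ha Hw Hm H; pose proof (zero_sum_pos a 0 Ha) as Hm1.
destruct (zero_sum_continuous a w (/ 4 - PSeries (zero_sum a) w) Ha ltac:(lra) Hm ltac:(lra))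
  as [d [Hd Hc]].
set (e := Rmin (d / 2) ((1 - zero_sum a 1 * w) / (2 * zero_sum a 1))).
assert (He : 0 < e).
{ apply Rmin_pos; [lra|apply Rdiv_lt_0_compat; lra]. }
assert (He1 : e <= d / 2) by apply Rmin_l.
assert (He2 : zero_sum a 1 * e <= (1 - zero_sum a 1 * w) / 2).
{ apply Rle_trans with (zero_sum a 1 * ((1 - zero_sum a 1 * w) / (2 * zero_sum a 1))).
  - apply Rmult_le_compat_l; [lra|apply Rmin_r].
  - right; field; lra. }
assert (Hm' : zero_sum a 1 * (w + e) < 1) by lra.
assert (H' : PSeries (zero_sum a) (w + e) < / 4).
{ specialize (Hc (w + e)); replace (w + e - w) with e in Hc by ring.
  rewrite Rabs_right in Hc by lra; specialize (Hc ltac:(lra)).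
  apply Rabs_def2 in Hc; lra. }
apply Rbar_lt_le_trans with (root 4 (w + e)); [apply root_lt; lra|].
apply (proj1 (Lub_Rbar_correct _)); split; [apply root_pos|].
intros z Hz Hzr; pose proof (Cmod_ge_0 z) as Hz0.
assert (Hz4 : Cmod z ^ 4 <= w + e).
{ rewrite <- (root_pow 3 (w + e)) by lra; apply pow_incr; lra. }
assert (Hz40 : 0 <= Cmod z ^ 4) by (apply pow_le; assumption).
assert (Hzm : zero_sum a 1 * Cmod z ^ 4 < 1) by nra.
destruct (quartic_log_derivative a z Ha Hz Hzm) as [N E].
split; [exact N|]; rewrite E.
assert (Hre : Re (1 - 4 * cps (zero_sum a) (z ^ 4))%C = 1 - 4 * Re (cps (zero_sum a) (z ^ 4)))
  by (unfold Cminus, Cplus, Copp, Cmult, Re; cbn; ring).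
rewrite Hre.
pose proof (re_cps_zero_sum_le a (z ^ 4)%C Ha) as Hle; rewrite Cmod_pow in Hle.
specialize (Hle Hzm).
pose proof (zero_sum_increasing a (Cmod z ^ 4) (w + e) Ha ltac:(lra) Hm'); lra.
Qed.

(** The positive point [w'^(1/4)], for [w' < w] with [M(w') > 1/4], violates
    the starlikeness condition. *)
Lemma radius_lt : forall a w, 0 < a -> 0 < w -> zero_sum a 1 * w < 1 ->
  / 4 < PSeries (zero_sum a) w ->
  Rbar_lt (radius_starlikeness (quartic (quartic_series a))) (root 4 w).
Proof.
intros a w Ha Hw Hm H; pose proof (zero_sum_pos a 0 Ha) as Hm1.
destruct (zero_sum_continuous a w (PSeries (zero_sum a) w - / 4) Ha ltac:(lra) Hm ltac:(lra))
  as [d [Hd Hc]].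
set (e := Rmin (d / 2) (w / 2)).
assert (He : 0 < e) by (apply Rmin_pos; lra).
assert (He1 : e <= d / 2) by apply Rmin_l; assert (He2 : e <= w / 2) by apply Rmin_r.
set (w' := w - e).
assert (Hm' : zero_sum a 1 * w' < 1) by (unfold w'; nra).
assert (H' : / 4 < PSeries (zero_sum a) w').
{ specialize (Hc w'); replace (w' - w) with (- e) in Hc by (unfold w'; ring).
  rewrite Rabs_Ropp, Rabs_right in Hc by lra; specialize (Hc ltac:(lra)).
  apply Rabs_def2 in Hc; lra. }
assert (Hw' : 0 < w' < w) by (unfold w'; lra).
apply Rbar_le_lt_trans with (root 4 w'); [|apply root_lt; lra].
apply (proj2 (Lub_Rbar_correct _)); intros r [Hr Hall]; cbn.
destruct (Rle_lt_dec r (root 4 w')) as [|Hlt]; [assumption|exfalso].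
pose proof (root_pos 4 w') as Hx; set (x := root 4 w') in *.
assert (Hx4 : x ^ 4 = w') by (apply (root_pow 3); lra).
assert (Hz : RtoC x <> RtoC 0) by (intros E; apply RtoC_inj in E; lra).
assert (Hcx : Cmod (RtoC x) = x) by (rewrite Cmod_R, Rabs_right; lra).
destruct (Hall (RtoC x) Hz ltac:(lra)) as [_ Hpos].
destruct (quartic_log_derivative a (RtoC x) Ha Hz) as [_ E];
  [rewrite Hcx, Hx4; assumption|].
rewrite E in Hpos.
assert (Hre : Re (1 - 4 * cps (zero_sum a) (RtoC x ^ 4))%C = 1 - 4 * Re (cps (zero_sum a) (RtoC x ^ 4)))
  by (unfold Cminus, Cplus, Copp, Cmult, Re; cbn; ring).
rewrite Hre, <- RtoC_pow, Hx4, re_cps_real in Hpos; lra.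
Qed.

(** * The gamma function *)

Definition gamma_integrand (x t : R) : R := Rpower t (x - 1) * exp (- t).

Lemma is_RInt_gen_spec : forall (f : R -> R) l,
  (forall eps, 0 < eps -> exists a0 b0, 0 < a0 /\ forall a b, 0 < a < a0 -> b0 < b ->
     exists y, is_RInt f a b y /\ Rabs (y - l) < eps) ->
  is_RInt_gen f (at_right 0) (Rbar_locally p_infty) l.
Proof.
intros f l H P [eps HP].
destruct (H eps (cond_pos eps)) as (a0 & b0 & Ha0 & K).
apply (Filter_prod _ _ _ (fun a => 0 < a < a0) (fun b => b0 < b)).
- exists (mkposreal _ Ha0); intros a Ha Hpos.
  apply Rabs_def2 in Ha; change (minus a 0) with (a - 0) in Ha; cbn in Ha.
  split; [assumption|lra].
- exists b0; intros b Hb; exact Hb.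
- intros a b Ha Hb; destruct (K a b Ha Hb) as (y & Hy & Hl).
  exists y; split; [exact Hy|apply HP; exact Hl].
Qed.

Lemma Rpower_derive : forall t y, 0 < t ->
  is_derive (fun t => Rpower t y) t (y * Rpower t (y - 1)).
Proof. intros t y Ht; apply is_derive_Reals, derivable_pt_lim_power; assumption. Qed.

Lemma gamma_continuous : forall x t, 0 < t -> continuous (gamma_integrand x) t.
Proof.
intros x t Ht; apply (ex_derive_continuous (gamma_integrand x)).
unfold gamma_integrand; apply (ex_derive_mult (fun t => Rpower t (x - 1)) (fun t => exp (- t))).
- eexists; apply Rpower_derive; assumption.
- auto_derive; exact I.
Qed.

Lemma gamma_ex_RInt : forall x a b, 0 < a -> a <= b -> ex_RInt (gamma_integrand x) a b.
Proof.
intros x a b Ha Hab; apply (ex_RInt_continuous (gamma_integrand x)); intros t Ht.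
rewrite Rmin_left in Ht by assumption; apply gamma_continuous; lra.
Qed.

Lemma gamma_integrand_pos : forall x t, 0 < gamma_integrand x t.
Proof. intros x t; apply Rmult_lt_0_compat; apply exp_pos. Qed.

Lemma ln_le_linear : forall y n, 0 < y -> 0 < n -> n * ln y <= y - n + n * ln n.
Proof.
intros y n Hy Hn; pose proof (exp_ineq1_le (ln (y / n))) as H.
assert (Hq : 0 < y / n) by (apply Rdiv_lt_0_compat; assumption).
rewrite exp_ln, ln_div in H by assumption.
replace y with (n * (y / n)) at 2 by (field; lra); nra.
Qed.

(** By concavity of the logarithm; the maximum over [1 + t] is at [n]. *)
Lemma Rpower_exp_bound : forall n, 0 < n -> exists K, 0 < K /\
  forall t, 0 < t -> Rpower (1 + t) n * exp (- t) <= K.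
Proof.
intros n Hn; exists (exp (1 - n + n * ln n)); split; [apply exp_pos|].
intros t Ht; unfold Rpower; rewrite <- exp_plus.
pose proof (ln_le_linear (1 + t) n ltac:(lra) Hn) as H.
destruct (Rle_lt_or_eq_dec (n * ln (1 + t) + - t) (1 - n + n * ln n) ltac:(lra)) as [L| ->];
  [left; apply exp_increasing; exact L|lra].
Qed.

(** A bounded function whose derivative
    [x t^(x-1) / (1 + t)^(x+1)] dominates the integrand of [Gamma x] up to a constant,
    both near 0 and at infinity. *)
Definition gamma_majorant (x t : R) : R := Rpower (t / (1 + t)) x.

Lemma gamma_majorant_derive : forall x t, 0 < t ->
  is_derive (gamma_majorant x) t (x * Rpower (t / (1 + t)) (x - 1) * / (1 + t) ^ 2).
Proof.
intros x t Ht; unfold gamma_majorant.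
replace (x * Rpower (t / (1 + t)) (x - 1) * / (1 + t) ^ 2)
  with (scal (/ (1 + t) ^ 2) (x * Rpower (t / (1 + t)) (x - 1)))
  by (unfold scal; cbn; unfold mult; cbn; ring).
apply (is_derive_comp (fun u => Rpower u x) (fun t => t / (1 + t))).
- apply Rpower_derive, Rdiv_lt_0_compat; lra.
- auto_derive; [lra|field; lra].
Qed.

Lemma gamma_majorant_bound : forall x t, 0 < x -> 0 < t -> 0 < gamma_majorant x t <= 1.
Proof.
intros x t Hx Ht; unfold gamma_majorant; split; [apply exp_pos|].
apply Rle_trans with (Rpower 1 x).
- apply Rle_Rpower_l; [lra|]; split; [apply Rdiv_lt_0_compat; lra|].
  apply Rle_div_l; lra.
- unfold Rpower; rewrite ln_1, Rmult_0_r, exp_0; lra.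
Qed.

Lemma gamma_integral_bound : forall x, 0 < x -> exists K, forall a b, 0 < a -> a <= b ->
  RInt (gamma_integrand x) a b <= K.
Proof.
intros x Hx; destruct (Rpower_exp_bound (x + 1) ltac:(lra)) as (K & HK & H).
exists (K / x); intros a b Ha Hab.
set (dm := fun t => K / x * (x * Rpower (t / (1 + t)) (x - 1) * / (1 + t) ^ 2)).
assert (Hd : is_RInt dm a b
  (minus (K / x * gamma_majorant x b) (K / x * gamma_majorant x a))).
{ apply (is_RInt_derive (fun t => K / x * gamma_majorant x t) dm).
  - intros t Ht; rewrite Rmin_left in Ht by assumption.
    apply (is_derive_scal (gamma_majorant x)), gamma_majorant_derive; lra.
  - intros t Ht; rewrite Rmin_left in Ht by assumption.
    apply (ex_derive_continuous dm); unfold dm.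
    apply (ex_derive_scal (fun t => x * Rpower (t / (1 + t)) (x - 1) * / (1 + t) ^ 2)).
    apply (ex_derive_mult (fun t => x * Rpower (t / (1 + t)) (x - 1))
      (fun t => / (1 + t) ^ 2)).
    + apply (ex_derive_scal (fun t => Rpower (t / (1 + t)) (x - 1))).
      apply (ex_derive_comp (fun u => Rpower u (x - 1)) (fun t => t / (1 + t))).
      * eexists; apply Rpower_derive, Rdiv_lt_0_compat; lra.
      * auto_derive; lra.
    + auto_derive; apply Rgt_not_eq; nra. }
apply Rle_trans with (RInt dm a b).
- apply RInt_le; [assumption|apply gamma_ex_RInt; assumption|eexists; exact Hd|].
  intros t Ht; unfold gamma_integrand, dm.
  specialize (H t ltac:(lra)).
  assert (Hpos : 0 < Rpower (1 + t) (x + 1)) by apply exp_pos.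
  replace (Rpower (t / (1 + t)) (x - 1))
    with (Rpower t (x - 1) * / Rpower (1 + t) (x - 1)).
  2:{ unfold Rpower; rewrite <- exp_Ropp, <- exp_plus, ln_div by lra; f_equal; ring. }
  assert (Es : Rpower (1 + t) (x + 1) = Rpower (1 + t) (x - 1) * (1 + t) ^ 2).
  { rewrite <- (Rpower_pow 2 (1 + t)) by lra; rewrite <- Rpower_plus; f_equal; cbn; ring. }
  assert (Hp : 0 < Rpower (1 + t) (x - 1)) by apply exp_pos.
  replace (K / x * (x * (Rpower t (x - 1) * / Rpower (1 + t) (x - 1)) * / (1 + t) ^ 2))
    with (Rpower t (x - 1) * (K / Rpower (1 + t) (x + 1))).
  2:{ rewrite Es; field; repeat split; try lra. }
  apply Rmult_le_compat_l; [left; apply exp_pos|].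
  apply Rle_div_r; [assumption|]; rewrite Rmult_comm; exact H.
- rewrite (is_RInt_unique _ _ _ _ Hd).
  pose proof (gamma_majorant_bound x a Hx Ha); pose proof (gamma_majorant_bound x b Hx ltac:(lra)).
  assert (0 < K / x) by (apply Rdiv_lt_0_compat; assumption).
  change (K / x * gamma_majorant x b - K / x * gamma_majorant x a <= K / x); nra.
Qed.

(** The integrals over compact intervals increase with the interval and are
    bounded, so the improper integral is their supremum. *)
Lemma gamma_converges : forall x, 0 < x -> exists l, 0 < l /\
  is_RInt_gen (gamma_integrand x) (at_right 0) (Rbar_locally p_infty) l.
Proof.
intros x Hx; destruct (gamma_integral_bound x Hx) as [K HK].
destruct (completeness (fun r => exists a b, 0 < a /\ a <= b /\
   r = RInt (gamma_integrand x) a b)) as [l [Hub Hl]].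
- exists K; intros r (a & b & Ha & Hab & ->); apply HK; assumption.
- exists (RInt (gamma_integrand x) 1 1), 1, 1; repeat split; lra.
- exists l; split.
  + apply Rlt_le_trans with (RInt (gamma_integrand x) 1 2).
    * apply RInt_gt_0; [lra|intros; apply gamma_integrand_pos|].
      intros t Ht; apply gamma_continuous; lra.
    * apply Hub; exists 1, 2; repeat split; lra.
  + apply is_RInt_gen_spec; intros eps He.
    assert (Hex : exists a b, 0 < a /\ a <= b /\ l - eps < RInt (gamma_integrand x) a b).
    { destruct (Classical_Prop.classic (exists a b, 0 < a /\ a <= b /\
        l - eps < RInt (gamma_integrand x) a b)) as [|N]; [assumption|exfalso].
      assert (l <= l - eps); [|lra].
      apply Hl; intros r (a & b & Ha & Hab & ->).
      destruct (Rle_lt_dec (RInt (gamma_integrand x) a b) (l - eps)); [assumption|].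
      exfalso; apply N; exists a, b; repeat split; assumption. }
    destruct Hex as (a0 & b0 & Ha0 & Hab0 & Hlow).
    exists a0, b0; split; [assumption|]; intros a b Ha Hb.
    exists (RInt (gamma_integrand x) a b); split.
    { apply (RInt_correct (gamma_integrand x)), gamma_ex_RInt; lra. }
    assert (Hup : RInt (gamma_integrand x) a b <= l)
      by (apply Hub; exists a, b; repeat split; lra).
    assert (Hnn : forall u w, 0 < u -> u <= w -> 0 <= RInt (gamma_integrand x) u w).
    { intros u w Hu Huw; apply RInt_ge_0; [assumption|apply gamma_ex_RInt; assumption|].
      intros; left; apply gamma_integrand_pos. }
    assert (Hge : RInt (gamma_integrand x) a0 b0 <= RInt (gamma_integrand x) a b).
    { assert (C : forall u w y, 0 < u -> u <= w -> w <= y ->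
        RInt (gamma_integrand x) u w + RInt (gamma_integrand x) w y
        = RInt (gamma_integrand x) u y).
      { intros u w y Hu Huw Hwy.
        apply (RInt_Chasles (gamma_integrand x)); apply gamma_ex_RInt; lra. }
      pose proof (C a a0 b ltac:(lra) ltac:(lra) ltac:(lra)).
      pose proof (C a0 b0 b ltac:(lra) ltac:(lra) ltac:(lra)).
      pose proof (Hnn a a0 ltac:(lra) ltac:(lra)).
      pose proof (Hnn b0 b ltac:(lra) ltac:(lra)); lra. }
    apply Rabs_def1; lra.
Qed.

Lemma Gamma_eq : forall x l,
  is_RInt_gen (gamma_integrand x) (at_right 0) (Rbar_locally p_infty) l -> Gamma x = l.
Proof. intros x l H; apply (is_RInt_gen_unique (gamma_integrand x) l H). Qed.

Lemma Gamma_pos : forall x, 0 < x -> 0 < Gamma x.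
Proof.
intros x Hx; destruct (gamma_converges x Hx) as (l & Hl & H).
rewrite (Gamma_eq x l H); assumption.
Qed.

Lemma gamma_boundary_limits : forall x eps, 0 < x -> 0 < eps -> exists a0 b0,
  0 < a0 /\ 0 < b0 /\ (forall a, 0 < a < a0 -> Rpower a x * exp (- a) < eps)
  /\ (forall b, b0 < b -> Rpower b x * exp (- b) < eps).
Proof.
intros x eps Hx He; destruct (Rpower_exp_bound (x + 1) ltac:(lra)) as (K & HK & H).
exists (Rpower eps (/ x)), (K / eps); repeat split.
- apply exp_pos.
- apply Rdiv_lt_0_compat; assumption.
- intros a Ha.
  assert (H1 : Rpower a x < eps).
  { apply Rlt_le_trans with (Rpower (Rpower eps (/ x)) x).
    - apply Rlt_Rpower_l; [assumption|lra].
    - rewrite Rpower_mult, Rinv_l, Rpower_1 by lra; lra. }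
  assert (exp (- a) <= 1) by (rewrite <- exp_0; left; apply exp_increasing; lra).
  assert (0 < Rpower a x) by apply exp_pos; assert (0 < exp (- a)) by apply exp_pos; nra.
- intros b Hb; assert (0 < K / eps) by (apply Rdiv_lt_0_compat; assumption).
  specialize (H b ltac:(lra)).
  rewrite Rpower_plus, Rpower_1 in H by lra.
  assert (H2 : Rpower b x <= Rpower (1 + b) x) by (apply Rle_Rpower_l; lra).
  assert (He' : 0 < exp (- b)) by apply exp_pos.
  assert (H3 : Rpower b x * exp (- b) * (1 + b) <= K).
  { apply Rle_trans with (2 := H).
    replace (Rpower (1 + b) x * (1 + b) * exp (- b))
      with (Rpower (1 + b) x * (exp (- b) * (1 + b))) by ring.
    rewrite Rmult_assoc; apply Rmult_le_compat_r; [nra|assumption]. }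
  apply Rmult_lt_reg_r with (1 + b); [lra|].
  apply Rle_lt_trans with (1 := H3).
  apply Rlt_div_l in Hb; [nra|assumption].
Qed.

(** Integration by parts: [h] is the derivative of [- t^x exp(-t)], which tends
    to 0 at both ends. *)
Lemma Gamma_succ : forall x, 0 < x -> Gamma (x + 1) = x * Gamma x.
Proof.
intros x Hx; destruct (gamma_converges x Hx) as (l & Hl & H).
rewrite (Gamma_eq x l H); apply Gamma_eq.
set (h := fun t => Rpower t x * exp (- t) - x * gamma_integrand x t).
assert (Hh : is_RInt_gen h (at_right 0) (Rbar_locally p_infty) 0).
{ apply is_RInt_gen_spec; intros eps He.
  destruct (gamma_boundary_limits x (eps / 2) Hx ltac:(lra)) as (a0 & b0 & Ha0 & Hb0 & Ka & Kb).
  exists (Rmin a0 b0), b0; split; [apply Rmin_pos; assumption|].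
  intros a b Ha Hb; pose proof (Rmin_l a0 b0); pose proof (Rmin_r a0 b0).
  set (F := fun t => - (Rpower t x * exp (- t))).
  exists (F b - F a); split.
  - apply (is_RInt_derive F h).
    + intros t Ht; rewrite Rmin_left in Ht by lra.
      unfold F, h, gamma_integrand.
      replace (Rpower t x * exp (- t) - x * (Rpower t (x - 1) * exp (- t)))
        with (opp (plus (mult (x * Rpower t (x - 1)) (exp (- t)))
                 (mult (Rpower t x) (- exp (- t)))))
        by (unfold opp, plus, mult; cbn; ring).
      apply (is_derive_opp (fun t => Rpower t x * exp (- t))).
      apply (is_derive_mult (fun t => Rpower t x) (fun t => exp (- t)));
        [apply Rpower_derive; lra| |intros; apply Rmult_comm].
      auto_derive; [exact I|ring].
    + intros t Ht; rewrite Rmin_left in Ht by lra; unfold h.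
      apply (continuous_minus (fun t => Rpower t x * exp (- t))
        (fun t => x * gamma_integrand x t)).
      * replace x with (x + 1 - 1) by ring; apply (gamma_continuous (x + 1)); lra.
      * apply (continuous_scal_r x (gamma_integrand x)), gamma_continuous; lra.
  - specialize (Ka a ltac:(lra)); specialize (Kb b ltac:(lra)); unfold F.
    assert (0 < Rpower a x * exp (- a)) by (apply Rmult_lt_0_compat; apply exp_pos).
    assert (0 < Rpower b x * exp (- b)) by (apply Rmult_lt_0_compat; apply exp_pos).
    apply Rabs_def1; lra. }
replace (x * l) with (plus (scal x l) 0) by (unfold plus, scal; cbn; unfold mult; cbn; ring).
apply (is_RInt_gen_ext (fun t => plus (scal x (gamma_integrand x t)) (h t))).
- apply filter_forall; intros ab t _; unfold h, gamma_integrand.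
  replace (x + 1 - 1) with x by ring; unfold plus, scal; cbn; unfold mult; cbn; ring.
- exact (is_RInt_gen_plus (fun t => scal x (gamma_integrand x t)) h (scal x l) 0
    (is_RInt_gen_scal (gamma_integrand x) x l H) Hh).
Qed.

Lemma Gamma_pochhammer : forall a n, 0 < a ->
  Gamma (a + INR n) = Gamma a * pochhammer a n.
Proof.
intros a n Ha; induction n as [|n IH].
- cbn; rewrite Rplus_0_r; ring.
- rewrite S_INR, <- Rplus_assoc, Gamma_succ by (pose proof (pos_INR n); lra).
  rewrite IH; cbn; ring.
Qed.

(** * Principal powers and the Bessel product *)

Lemma Cmod_sqr : forall z : C, Cmod z * Cmod z = Re z * Re z + Im z * Im z.
Proof.
intros z; unfold Cmod; rewrite sqrt_sqrt; [unfold Re, Im; ring|].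
pose proof (pow2_ge_0 (fst z)); pose proof (pow2_ge_0 (snd z)); lra.
Qed.

Lemma Carg_polar : forall z, z <> RtoC 0 ->
  Cmod z * cos (Carg z) = Re z /\ Cmod z * sin (Carg z) = Im z.
Proof.
intros z Hz; assert (Hm : 0 < Cmod z) by (apply Cmod_gt_0; assumption).
pose proof (re_le_Cmod z) as Hre; apply Rabs_le_between in Hre.
set (u := Re z / Cmod z).
assert (Hu : -1 <= u <= 1).
{ unfold u; split; [apply Rle_div_r|apply Rle_div_l]; lra. }
assert (Hru : Cmod z * u = Re z) by (unfold u; field; lra).
assert (Hs : Cmod z * sqrt (1 - Rsqr u) = Rabs (Im z)).
{ apply Rsqr_inj.
  - apply Rmult_le_pos; [lra|apply sqrt_pos].
  - apply Rabs_pos.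
  - rewrite <- Rsqr_abs, Rsqr_mult, Rsqr_sqrt by (unfold Rsqr; nra).
    unfold Rsqr; pose proof (Cmod_sqr z); nra. }
unfold Carg; fold u; destruct (Rle_dec 0 (Im z)) as [Hi|Hi].
- rewrite cos_acos, sin_acos by assumption; split; [assumption|].
  rewrite Hs, Rabs_right; lra.
- rewrite cos_neg, sin_neg, cos_acos, sin_acos by assumption; split; [assumption|].
  rewrite Rabs_left in Hs by lra; lra.
Qed.

Lemma CRpower_plus : forall z a b, CRpower z (a + b) = (CRpower z a * CRpower z b)%C.
Proof.
intros z a b; unfold CRpower; rewrite Rpower_plus, Rmult_plus_distr_r, cos_plus, sin_plus.
apply C_eq; cbn; ring.
Qed.

Lemma CRpower_0 : forall z, CRpower z 0 = RtoC 1.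
Proof.
intros z; unfold CRpower; rewrite Rmult_0_l, cos_0, sin_0.
unfold Rpower; rewrite Rmult_0_l, exp_0; apply C_eq; cbn; ring.
Qed.

Lemma CRpower_1 : forall z, z <> RtoC 0 -> CRpower z 1 = z.
Proof.
intros z Hz; destruct (Carg_polar z Hz) as [H1 H2]; unfold CRpower.
rewrite Rmult_1_l, Rpower_1 by (apply Cmod_gt_0; assumption).
apply C_eq; cbn; assumption.
Qed.

Lemma CRpower_INR : forall z n, z <> RtoC 0 -> CRpower z (INR n) = (z ^ n)%C.
Proof.
intros z n Hz; induction n as [|n IH]; [apply CRpower_0|].
rewrite S_INR, CRpower_plus, IH, CRpower_1 by assumption; cbn; ring.
Qed.

(** Halving changes the modulus but not the argument. *)
Lemma CRpower_half : forall z a, z <> RtoC 0 ->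
  CRpower (z / RtoC 2) a = (RtoC (Rpower 2 (- a)) * CRpower z a)%C.
Proof.
intros z a Hz; assert (Hm : 0 < Cmod z) by (apply Cmod_gt_0; assumption).
assert (Ez : (z / RtoC 2 = RtoC (/ 2) * z)%C).
{ rewrite RtoC_inv by lra; field; intros E; apply RtoC_inj in E; lra. }
assert (Em : Cmod (z / RtoC 2) = Cmod z / 2)
  by (rewrite Ez, Cmod_mult, Cmod_R, Rabs_right; lra).
assert (Ea : Carg (z / RtoC 2) = Carg z).
{ unfold Carg; rewrite Em, Ez, Re_scal, Im_scal.
  replace (/ 2 * Re z / (Cmod z / 2)) with (Re z / Cmod z) by (field; lra).
  destruct (Rle_dec 0 (/ 2 * Im z)); destruct (Rle_dec 0 (Im z));
    reflexivity || (exfalso; lra). }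
assert (Ep : Rpower (Cmod z / 2) a = Rpower 2 (- a) * Rpower (Cmod z) a).
{ unfold Rpower; rewrite ln_div, <- exp_plus by lra; f_equal; ring. }
unfold CRpower; rewrite Ea, Em, Ep; apply C_eq; cbn; ring.
Qed.

(** Covers [J_nu] and [I_nu] through the choice of the signs [c n]. *)
Lemma bessel_factor : forall nu z (c : nat -> R), -1 < nu -> z <> RtoC 0 ->
  entire (fun n => c n / (INR (fact n) * pochhammer (nu + 1) n)) ->
  CSeries (fun n => (RtoC (c n / (INR (fact n) * Gamma (nu + INR n + 1)))
     * CRpower (z / RtoC 2) (2 * INR n + nu))%C)
  = (RtoC (/ Gamma (nu + 1)) * CRpower (z / RtoC 2) nu
     * cps (fun n => c n / (INR (fact n) * pochhammer (nu + 1) n))%R ((z / RtoC 2) ^ 2))%C.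
Proof.
intros nu z c Hnu Hz Hc; apply is_CSeries_unique.
set (d := fun n => c n / (INR (fact n) * pochhammer (nu + 1) n)) in *.
apply (is_CSeries_ext (fun n => (RtoC (/ Gamma (nu + 1)) * CRpower (z / RtoC 2) nu
   * (RtoC (d n) * ((z / RtoC 2) ^ 2) ^ n))%C)).
- intros n; unfold d.
  replace (nu + INR n + 1) with (nu + 1 + INR n) by ring.
  rewrite Gamma_pochhammer by lra.
  assert (H2 : (z / RtoC 2)%C <> RtoC 0).
  { intros E; apply Hz.
    replace z with (z / RtoC 2 * RtoC 2)%C;
      [rewrite E; ring|field; intros E'; apply RtoC_inj in E'; lra]. }
  rewrite CRpower_plus.
  replace (2 * INR n) with (INR (2 * n)) by (rewrite mult_INR; cbn; ring).
  rewrite CRpower_INR, Cpow_mult_r by assumption.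
  replace (c n / (INR (fact n) * (Gamma (nu + 1) * pochhammer (nu + 1) n)))
    with (/ Gamma (nu + 1) * (c n / (INR (fact n) * pochhammer (nu + 1) n))).
  + rewrite RtoC_mult; ring.
  + field; pose proof (Gamma_pos (nu + 1) ltac:(lra));
      pose proof (pochhammer_pos (nu + 1) n ltac:(lra)); pose proof (INR_fact_lt_0 n).
    repeat split; lra.
- apply is_CSeries_scal, cps_correct, entire_psum; [assumption|apply Cmod_ge_0].
Qed.

Lemma v_quartic : forall nu, -1 < nu -> v nu = quartic (quartic_series (nu + 1)).
Proof.
intros nu Hnu; apply functional_extensionality; intros z; unfold v.
destruct (Ceq_dec z (RtoC 0)) as [->|Hz]; [unfold quartic; ring|].
pose proof (entire_bessel_series (nu + 1) ltac:(lra)) as He.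
pose proof (entire_dilate (-1) _ He) as Hd.
assert (EJ : BesselJ nu z = (RtoC (/ Gamma (nu + 1)) * CRpower (z / RtoC 2) nu
   * cps (bessel_series (nu + 1)) ((z / RtoC 2) ^ 2))%C)
  by (apply (bessel_factor nu z (fun n => (-1) ^ n)); assumption).
assert (ED : (fun n => 1 / (INR (fact n) * pochhammer (nu + 1) n))
   = dilate (-1) (bessel_series (nu + 1))).
{ apply functional_extensionality; intros n; unfold dilate, bessel_series, Rdiv.
  rewrite <- Rmult_assoc, pow_m1_sqr; reflexivity. }
assert (EI : BesselI nu z = (RtoC (/ Gamma (nu + 1)) * CRpower (z / RtoC 2) nu
   * cps (dilate (-1) (bessel_series (nu + 1))) ((z / RtoC 2) ^ 2))%C).
{ rewrite <- ED; apply (bessel_factor nu z (fun n => 1)); try assumption.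
  rewrite ED; assumption. }
assert (EP : (cps (bessel_series (nu + 1)) ((z / RtoC 2) ^ 2)
   * cps (dilate (-1) (bessel_series (nu + 1))) ((z / RtoC 2) ^ 2))%C
   = cps (quartic_series (nu + 1)) (z ^ 4)).
{ rewrite <- cps_mult by (apply entire_psum; [assumption|apply Cmod_ge_0]).
  fold (bessel_product (nu + 1)); unfold quartic_series; rewrite cps_dilate.
  rewrite <- cps_even; [|apply bessel_product_odd|apply entire_psum; [|apply Cmod_ge_0]].
  - f_equal; rewrite RtoC_inv by lra.
    replace (RtoC 16) with (RtoC 2 ^ 4)%C by (rewrite <- RtoC_pow; f_equal; ring).
    field; intros E'; apply RtoC_inj in E'; lra.
  - apply entire_smul; assumption. }
unfold Bessel_Pi; rewrite EJ, EI.
pose proof (Gamma_pos (nu + 1) ltac:(lra)) as Hg.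
transitivity ((RtoC (Rpower 2 (2 * nu)) * CRpower z (-2 * nu + 1)
   * RtoC (Gamma (nu + 1) ^ 2 * (/ Gamma (nu + 1) * / Gamma (nu + 1)))
   * (CRpower (z / RtoC 2) nu * CRpower (z / RtoC 2) nu))
   * (cps (bessel_series (nu + 1)) ((z / RtoC 2) ^ 2)
   * cps (dilate (-1) (bessel_series (nu + 1))) ((z / RtoC 2) ^ 2)))%C.
{ rewrite !RtoC_mult; ring. }
rewrite EP; unfold quartic; f_equal.
replace (Gamma (nu + 1) ^ 2 * (/ Gamma (nu + 1) * / Gamma (nu + 1))) with 1
  by (field; lra).
rewrite CRpower_half by assumption.
transitivity (RtoC (Rpower 2 (2 * nu) * (Rpower 2 (- nu) * Rpower 2 (- nu)))
   * (CRpower z (-2 * nu + 1) * (CRpower z nu * CRpower z nu)))%C;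
  [rewrite !RtoC_mult; ring|].
rewrite <- !Rpower_plus, <- !CRpower_plus.
replace (2 * nu + (- nu + - nu)) with 0 by ring.
replace (-2 * nu + 1 + (nu + nu)) with 1 by ring.
rewrite CRpower_1 by assumption.
unfold Rpower; rewrite Rmult_0_l, exp_0; ring.
Qed.

(** * Geometric comparison of the series of zero sums *)

Lemma zero_sum_split : forall a w n, 0 < a -> 0 <= w -> zero_sum a 1 * w < 1 ->
  PSeries (zero_sum a) w = sum_f_R0 (fun k => zero_sum a k * w ^ k) n
    + Series (fun k => zero_sum a (S n + k)%nat * w ^ (S n + k)).
Proof.
intros a w n Ha Hw H.
apply (Series_incr_n (fun k => zero_sum a k * w ^ k) (S n)); [lia|].
apply zero_sum_ex_series; assumption.
Qed.

(** Log-convexity: the ratios after [n] are at least the ratio at [n]. *)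
Lemma zero_sum_geometric : forall a n m, 0 < a ->
  zero_sum a (S n) * (zero_sum a (S (S n)) / zero_sum a (S n)) ^ m <= zero_sum a (S n + m)%nat.
Proof.
intros a n m Ha; induction m as [|m IH].
- rewrite Nat.add_0_r; cbn; lra.
- pose proof (zero_sum_pos a n Ha) as Hp; pose proof (zero_sum_pos a (S n) Ha) as Hp'.
  pose proof (zero_sum_pos a (n + m) Ha) as Hq.
  pose proof (ratio_le (fun k => zero_sum a (S k)) (S (n + m)) n) as H; cbn beta in H.
  specialize (H ltac:(intros; apply zero_sum_pos; assumption)
    ltac:(intros; apply zero_sum_log_convex; assumption) ltac:(lia)).
  replace (S (S (n + m) - 1))%nat with (S (n + m)) in H by lia.
  replace (S n + m)%nat with (S (n + m)) in IH by lia.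
  replace (S n + S m)%nat with (S (S (n + m))) by lia.
  set (q := zero_sum a (S (S n)) / zero_sum a (S n)) in *.
  assert (Hq0 : 0 < q) by (apply Rdiv_lt_0_compat; assumption).
  cbn [pow]; apply Rle_trans with (q * zero_sum a (S (n + m))).
  + replace (zero_sum a (S n) * (q * q ^ m)) with (q * (zero_sum a (S n) * q ^ m)) by ring.
    apply Rmult_le_compat_l; lra.
  + apply Rmult_le_reg_r with (zero_sum a (S n)); [assumption|].
    replace (q * zero_sum a (S (n + m)) * zero_sum a (S n))
      with (zero_sum a (S (S n)) * zero_sum a (S (n + m))) by (unfold q; field; lra); lra.
Qed.

Lemma zero_sum_lower : forall a w n r, 0 < a -> 0 <= w -> zero_sum a 1 * w < 1 ->
  r = zero_sum a (S (S n)) / zero_sum a (S n) * w -> r < 1 ->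
  sum_f_R0 (fun k => zero_sum a k * w ^ k) n + zero_sum a (S n) * w ^ S n / (1 - r)
    <= PSeries (zero_sum a) w.
Proof.
intros a w n r Ha Hw H Er Hr; rewrite (zero_sum_split a w n) by assumption.
assert (Hr0 : 0 <= r).
{ rewrite Er; apply Rmult_le_pos; [|assumption].
  left; apply Rdiv_lt_0_compat; apply zero_sum_pos; assumption. }
apply Rplus_le_compat_l.
assert (E : zero_sum a (S n) * w ^ S n / (1 - r)
  = Series (fun k => zero_sum a (S n) * w ^ S n * r ^ k)).
{ rewrite Series_scal_l, Series_geom by (rewrite Rabs_right; lra); reflexivity. }
rewrite E; apply Series_le.
- intros k; split.
  + apply Rmult_le_pos; [apply Rmult_le_pos|apply pow_le; assumption].
    * apply zero_sum_nonneg; assumption.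
    * apply pow_le; assumption.
  + rewrite pow_add, Er, Rpow_mult_distr.
    pose proof (zero_sum_geometric a n k Ha) as Hg.
    assert (0 <= w ^ S n * w ^ k) by (apply Rmult_le_pos; apply pow_le; assumption).
    replace (zero_sum a (S n) * w ^ S n * ((zero_sum a (S (S n)) / zero_sum a (S n)) ^ k * w ^ k))
      with (zero_sum a (S n) * (zero_sum a (S (S n)) / zero_sum a (S n)) ^ k * (w ^ S n * w ^ k)) by ring.
    apply Rmult_le_compat_r; assumption.
- apply (ex_series_incr_n (fun k => zero_sum a k * w ^ k) (S n)).
  apply zero_sum_ex_series; assumption.
Qed.

(** By [zero_sum_power_mean], the term of index [k > n] is at most [g^k]. *)
Lemma zero_sum_upper : forall a w n g, 0 < a -> 0 <= w -> zero_sum a 1 * w < 1 ->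
  0 <= g < 1 -> zero_sum a (S n) * w ^ S n = g ^ S n ->
  PSeries (zero_sum a) w <= sum_f_R0 (fun k => zero_sum a k * w ^ k) n + g ^ S n / (1 - g).
Proof.
intros a w n g Ha Hw H Hg Eg; rewrite (zero_sum_split a w n) by assumption.
apply Rplus_le_compat_l.
assert (E : g ^ S n / (1 - g) = Series (fun k => g ^ S n * g ^ k)).
{ rewrite Series_scal_l, Series_geom by (rewrite Rabs_right; lra); reflexivity. }
rewrite E; apply Series_le.
- intros k.
  assert (Hn : 0 <= zero_sum a (S n + k) * w ^ (S n + k))
    by (apply Rmult_le_pos; [apply zero_sum_nonneg; assumption|apply pow_le; assumption]).
  split; [assumption|]; rewrite <- pow_add.
  apply Rnot_lt_le; intros Hlt.
  assert (Hgk : 0 <= g ^ (S n + k)) by (apply pow_le; lra).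
  pose proof (pow_lt_compat n _ _ Hgk Hlt) as Hc.
  rewrite Rpow_mult_distr, <- !pow_mult in Hc.
  pose proof (zero_sum_power_mean a n (n + k) Ha ltac:(lia)) as Hm.
  replace (S (n + k)) with (S n + k)%nat in Hm by lia.
  assert (Hle : zero_sum a (S n + k) ^ S n * w ^ ((S n + k) * S n) <= g ^ ((S n + k) * S n)).
  { apply Rle_trans with (zero_sum a (S n) ^ (S n + k) * w ^ ((S n + k) * S n)).
    - apply Rmult_le_compat_r; [apply pow_le|]; assumption.
    - right; rewrite (Nat.mul_comm (S n + k)), !pow_mult, <- Rpow_mult_distr, Eg.
      reflexivity. }
  lra.
- apply (ex_series_scal_l (g ^ S n) (fun k => g ^ k)), ex_series_geom.
  rewrite Rabs_right; lra.
Qed.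

(** * Closed forms of the first Rayleigh sums *)

Lemma rayleigh_step : forall a n, 0 < a ->
  rayleigh a (S (S n)) = smul (rayleigh a) (rayleigh a) (S (S n)) / (a + INR (S n)).
Proof.
intros a n Ha; rewrite <- rayleigh_convolution by assumption.
pose proof (pos_INR (S n)); field; lra.
Qed.

Ltac rayleigh_value n :=
  intros a Ha; rewrite (rayleigh_step a n Ha), smul_sum; cbn [sum_f_R0 Nat.sub];
  rewrite !rayleigh_0.

Lemma rayleigh_1 : forall a, rayleigh a 1 = / a.
Proof. intros a; rewrite rayleigh_S, bessel_ratio_0; ring. Qed.
Lemma rayleigh_2 : forall a, 0 < a -> rayleigh a 2 = / (a ^ 2 * (a + 1)).
Proof.
rayleigh_value O; rewrite rayleigh_1; cbn [INR]; field; lra.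
Qed.
Lemma rayleigh_3 : forall a, 0 < a -> rayleigh a 3 = 2 / (a ^ 3 * (a + 1) * (a + 2)).
Proof.
rayleigh_value 1%nat; rewrite rayleigh_1, rayleigh_2 by assumption; cbn [INR]; field; lra.
Qed.
Lemma rayleigh_4 : forall a, 0 < a ->
  rayleigh a 4 = (6 + 5 * a) / (a ^ 4 * (a + 1) ^ 2 * (a + 2) * (a + 3)).
Proof.
rayleigh_value 2%nat; rewrite rayleigh_1, rayleigh_2, rayleigh_3 by assumption; cbn [INR]; field; lra.
Qed.
Lemma rayleigh_5 : forall a, 0 < a ->
  rayleigh a 5 = (24 + 14 * a) / (a ^ 5 * (a + 1) ^ 2 * (a + 2) * (a + 3) * (a + 4)).
Proof.
rayleigh_value 3%nat; rewrite rayleigh_1, rayleigh_2, rayleigh_3, rayleigh_4 by assumption.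
cbn [INR]; field; lra.
Qed.
Lemma rayleigh_6 : forall a, 0 < a -> rayleigh a 6 =
  (240 + a * (428 + a * (236 + a * 42)))
  / (a ^ 6 * (a + 1) ^ 3 * (a + 2) ^ 2 * (a + 3) * (a + 4) * (a + 5)).
Proof.
rayleigh_value 4%nat; rewrite rayleigh_1, rayleigh_2, rayleigh_3, rayleigh_4, rayleigh_5 by assumption.
cbn [INR]; field; lra.
Qed.
Lemma rayleigh_7 : forall a, 0 < a -> rayleigh a 7 =
  (1440 + a * (2088 + a * (920 + a * 132)))
  / (a ^ 7 * (a + 1) ^ 3 * (a + 2) ^ 2 * (a + 3) * (a + 4) * (a + 5) * (a + 6)).
Proof.
rayleigh_value 5%nat; rewrite rayleigh_1, rayleigh_2, rayleigh_3, rayleigh_4, rayleigh_5, rayleigh_6 by assumption.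
cbn [INR]; field; lra.
Qed.
Lemma rayleigh_8 : forall a, 0 < a -> rayleigh a 8 =
  (30240 + a * (73368 + a * (65724 + a * (27482 + a * (5495 + a * 429)))))
  / (a ^ 8 * (a + 1) ^ 4 * (a + 2) ^ 2 * (a + 3) ^ 2 * (a + 4) * (a + 5) * (a + 6) * (a + 7)).
Proof.
rayleigh_value 6%nat.
rewrite rayleigh_1, rayleigh_2, rayleigh_3, rayleigh_4, rayleigh_5, rayleigh_6, rayleigh_7 by assumption.
cbn [INR]; field; lra.
Qed.

(** * Euler-Rayleigh inequalities *)

Lemma zero_sum_1 : forall a, 0 < a -> zero_sum a 1 = / (16 * a ^ 2 * (a + 1)).
Proof.
intros a Ha; rewrite zero_sum_eq; cbn [Nat.add]; rewrite rayleigh_2 by assumption; field; lra.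
Qed.
Lemma zero_sum_2 : forall a, 0 < a -> zero_sum a 2 =
  (6 + 5 * a) / (256 * a ^ 4 * (a + 1) ^ 2 * (a + 2) * (a + 3)).
Proof.
intros a Ha; rewrite zero_sum_eq; cbn [Nat.add]; rewrite rayleigh_4 by assumption; field; lra.
Qed.
Lemma zero_sum_3 : forall a, 0 < a -> zero_sum a 3 =
  (240 + a * (428 + a * (236 + a * 42)))
  / (4096 * a ^ 6 * (a + 1) ^ 3 * (a + 2) ^ 2 * (a + 3) * (a + 4) * (a + 5)).
Proof.
intros a Ha; rewrite zero_sum_eq; cbn [Nat.add]; rewrite rayleigh_6 by assumption; field; lra.
Qed.
Lemma zero_sum_4 : forall a, 0 < a -> zero_sum a 4 =
  (30240 + a * (73368 + a * (65724 + a * (27482 + a * (5495 + a * 429)))))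
  / (65536 * a ^ 8 * (a + 1) ^ 4 * (a + 2) ^ 2 * (a + 3) ^ 2
     * (a + 4) * (a + 5) * (a + 6) * (a + 7)).
Proof.
intros a Ha; rewrite zero_sum_eq; cbn [Nat.add]; rewrite rayleigh_8 by assumption; field; lra.
Qed.

(** Positivity of a polynomial in positive variables whose expanded
    coefficients are all positive. *)
Ltac poly_pos :=
  match goal with |- 0 < ?e => ring_simplify e end;
  repeat first [ assumption | apply Rplus_lt_0_compat | apply Rmult_lt_0_compat
               | apply pow_lt | lra ].

(** The first term of [M] alone equals 1/4 at this point; the tail is
    positive. *)
Lemma first_term_upper : forall a w, 0 < a ->
  w = 4 * (a ^ 2 * (a + 1)) -> zero_sum a 1 * w < 1 /\ / 4 < PSeries (zero_sum a) w.
Proof.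
intros a w Ha Ew.
assert (Hd : 0 < a ^ 2 * (a + 1)) by (apply Rmult_lt_0_compat; [apply pow_lt|]; lra).
assert (E1 : zero_sum a 1 * w = / 4) by (rewrite zero_sum_1, Ew by assumption; field; lra).
split; [lra|].
set (r := zero_sum a 2 / zero_sum a 1 * w).
assert (Er : r = (6 + 5 * a) / (4 * (a + 2) * (a + 3))).
{ unfold r; rewrite zero_sum_1, zero_sum_2, Ew by assumption; field; lra. }
assert (Hr : 0 < r < 1).
{ rewrite Er; split.
  - apply Rdiv_lt_0_compat; nra.
  - apply Rlt_div_l; nra. }
pose proof (zero_sum_lower a w O r Ha ltac:(lra) ltac:(lra) eq_refl ltac:(lra)) as H.
cbn [sum_f_R0] in H; rewrite zero_sum_0, !pow_1, E1 in H.
apply Rlt_le_trans with (2 := H).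
apply Rlt_le_trans with (/ 4 / (1 - r)); [|lra].
apply Rlt_div_r; lra.
Qed.

(** Here [w = sigma_1 / sigma_2 = 5 m_1 / (16 m_1^2 + 9 m_2)], and
    the geometric bound reduces the claim to [m_2 < m_1^2]. *)
Lemma euler_rayleigh_upper_1 : forall a w, 0 < a ->
  w = 80 * a ^ 2 * (a + 1) * (a + 2) * (a + 3) / (150 + a * (125 + a * 16)) ->
  zero_sum a 1 * w < 1 /\ / 4 < PSeries (zero_sum a) w.
Proof.
intros a w Ha Ew.
assert (HA : 0 < 150 + a * (125 + a * 16)) by poly_pos.
assert (Hw : 0 < w).
{ rewrite Ew; apply Rdiv_lt_0_compat; [|assumption].
  repeat apply Rmult_lt_0_compat; try apply pow_lt; lra. }
assert (E1 : zero_sum a 1 * w = 5 * (a + 2) * (a + 3) / (150 + a * (125 + a * 16)))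
  by (rewrite zero_sum_1, Ew by assumption; field; lra).
assert (H1 : zero_sum a 1 * w < 1) by (rewrite E1; apply Rlt_div_l; nra).
split; [assumption|].
set (r := zero_sum a 2 / zero_sum a 1 * w).
assert (Er : r = 5 * (6 + 5 * a) / (150 + a * (125 + a * 16))).
{ unfold r; rewrite zero_sum_1, zero_sum_2, Ew by assumption; field; lra. }
assert (Hr : r < 1) by (rewrite Er; apply Rlt_div_l; nra).
pose proof (zero_sum_lower a w O r Ha ltac:(lra) ltac:(lra) eq_refl ltac:(lra)) as H.
cbn [sum_f_R0] in H; rewrite zero_sum_0, !pow_1, E1 in H.
apply Rlt_le_trans with (2 := H).
apply Rlt_le_trans with (5 * (a + 2) * (a + 3) / (150 + a * (125 + a * 16)) / (1 - r)); [|lra].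
apply Rlt_div_r; [lra|].
rewrite Er; apply Rmult_lt_reg_r with (150 + a * (125 + a * 16)); [assumption|].
replace (/ 4 * (1 - 5 * (6 + 5 * a) / (150 + a * (125 + a * 16))) * (150 + a * (125 + a * 16)))
  with (/ 4 * (150 + a * (125 + a * 16) - 5 * (6 + 5 * a))) by (field; lra).
replace (5 * (a + 2) * (a + 3) / (150 + a * (125 + a * 16)) * (150 + a * (125 + a * 16)))
  with (5 * (a + 2) * (a + 3)) by (field; lra).
nra.
Qed.

(** The polynomials of the statement in the variable [a = nu + 1]. *)
Definition nu9_shift (a : R) : R :=
  15000 + a * (26750 + a * (17150 + a * (4905 + a * (632 + a * 32)))).
Definition nu10_shift (a : R) : R :=
  18900000 + a * (45855000 + a * (45109500 + a * (23598650 + a * (7242055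
  + a * (1349309 + a * (151200 + a * (9472 + a * 256))))))).

(** Here [w = sigma_2 / sigma_3] with
    [sigma_2 = 16 m_1^2 + 9 m_2] and [sigma_3 = 64 m_1^3 + 48 m_1 m_2 + 13 m_3]. With
    [x], [y] the first two terms of [M(w)] and [r] the ratio of the geometric tail
    from the second term on, the claim is [4 x + 4 y / (1 - r) > 1]. Both sides agree
    to leading order as [a] tends to 0 and to infinity, so the closed forms of the
    sums are substituted exactly. *)
Lemma euler_rayleigh_upper_2 : forall a w, 0 < a ->
  w = 8 * a ^ 2 * (a + 1) * (a + 2) * (a + 4) * (a + 5) * (150 + a * (125 + a * 16))
      / nu9_shift a ->
  zero_sum a 1 * w < 1 /\ / 4 < PSeries (zero_sum a) w.
Proof.
intros a w Ha Ew.
assert (HA : 0 < 150 + a * (125 + a * 16)) by poly_pos.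
assert (H9 : 0 < nu9_shift a) by (unfold nu9_shift; poly_pos).
assert (H6 : 0 < 240 + a * (428 + a * (236 + a * 42))) by poly_pos.
assert (Hw : 0 < w).
{ rewrite Ew; apply Rdiv_lt_0_compat; [|assumption].
  repeat apply Rmult_lt_0_compat; try apply pow_lt; lra. }
set (x := zero_sum a 1 * w); set (y := zero_sum a 2 * w ^ 2); set (r := zero_sum a 3 / zero_sum a 2 * w).
set (n6 := 240 + a * (428 + a * (236 + a * 42))) in *.
set (A := 150 + a * (125 + a * 16)) in *; set (p1 := 6 + 5 * a).
assert (Hp1 : 0 < p1) by (unfold p1; lra).
set (U := (a + 2) * (a + 4) * (a + 5) * A); set (V := 2 * nu9_shift a).
assert (HU : 0 < U) by (unfold U; repeat apply Rmult_lt_0_compat; lra).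
assert (HV : 0 < V) by (unfold V; lra).
assert (Ex : x = U / V)
  by (unfold x, U, V; rewrite zero_sum_1, Ew by assumption; field; lra).
assert (Ey : y = p1 * U ^ 2 / ((a + 2) * (a + 3) * V ^ 2)).
{ unfold y, U, V, p1; rewrite zero_sum_2, Ew by assumption; field; lra. }
assert (Er : r = n6 * A / (p1 * V)).
{ unfold r, V; rewrite zero_sum_2, zero_sum_3, Ew by assumption.
  fold n6 p1; field; lra. }
assert (Hx : x < 1).
{ rewrite Ex; apply Rlt_div_l; [assumption|]; apply Rminus_lt_0.
  unfold U, V, A, nu9_shift; poly_pos. }
split; [assumption|].
assert (Hc : 0 < p1 * V - n6 * A) by (unfold p1, V, n6, A, nu9_shift; poly_pos).
assert (HpV : 0 < p1 * V) by (apply Rmult_lt_0_compat; assumption).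
assert (Hr : r < 1) by (rewrite Er; apply Rlt_div_l; lra).
assert (E : 0 < (4 * x - 1) * (1 - r) + 4 * y).
{ replace ((4 * x - 1) * (1 - r) + 4 * y)
    with (((4 * U - V) * (p1 * V - n6 * A) * ((a + 2) * (a + 3)) + 4 * p1 ^ 2 * U ^ 2)
          / (p1 * (a + 2) * (a + 3) * V ^ 2))
    by (rewrite Ex, Er, Ey; field; lra).
  apply Rdiv_lt_0_compat.
  - unfold U, V, p1, n6, A, nu9_shift; poly_pos.
  - repeat apply Rmult_lt_0_compat; try apply pow_lt; lra. }
pose proof (zero_sum_lower a w 1 r Ha ltac:(lra) Hx eq_refl Hr) as H.
cbn [sum_f_R0] in H; rewrite zero_sum_0, pow_1 in H; fold x y in H.
apply Rlt_le_trans with (2 := H).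
apply Rmult_lt_reg_r with (4 * (1 - r)); [lra|].
replace ((0 * w ^ 0 + x + y / (1 - r)) * (4 * (1 - r)))
  with (4 * x * (1 - r) + 4 * y) by (field; lra).
lra.
Qed.

(** Here [w = sigma_3 / sigma_4] with
    [sigma_4 = 256 m_1^4 + 256 m_1^2 m_2 + 64 m_1 m_3 + 32 m_2^2 + 17 m_4]. Two terms
    of [M(w)] are kept and the tail is geometric from the third on. *)
Lemma euler_rayleigh_upper_3 : forall a w, 0 < a ->
  w = 32 * a ^ 2 * (a + 1) * (a + 3) * (a + 6) * (a + 7) * nu9_shift a
      / nu10_shift a ->
  zero_sum a 1 * w < 1 /\ / 4 < PSeries (zero_sum a) w.
Proof.
intros a w Ha Ew.
assert (H9 : 0 < nu9_shift a) by (unfold nu9_shift; poly_pos).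
assert (H10 : 0 < nu10_shift a) by (unfold nu10_shift; poly_pos).
assert (H6 : 0 < 240 + a * (428 + a * (236 + a * 42))) by poly_pos.
assert (Hw : 0 < w).
{ rewrite Ew; apply Rdiv_lt_0_compat; [|assumption].
  repeat apply Rmult_lt_0_compat; try apply pow_lt; lra. }
set (x := zero_sum a 1 * w); set (y := zero_sum a 2 * w ^ 2); set (z := zero_sum a 3 * w ^ 3).
set (r := zero_sum a 4 / zero_sum a 3 * w).
set (n6 := 240 + a * (428 + a * (236 + a * 42))) in *.
set (n8 := 30240 + a * (73368 + a * (65724 + a * (27482 + a * (5495 + a * 429))))).
set (p1 := 6 + 5 * a).
set (U := 2 * (a + 3) * (a + 6) * (a + 7) * nu9_shift a); set (V := nu10_shift a) in *.
assert (HU : 0 < U) by (unfold U; repeat apply Rmult_lt_0_compat; lra).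
assert (Ex : x = U / V)
  by (unfold x, U, V; rewrite zero_sum_1, Ew by assumption; fold V; field; lra).
assert (Ey : y = p1 * U ^ 2 / ((a + 2) * (a + 3) * V ^ 2)).
{ unfold y, U, p1; rewrite zero_sum_2, Ew by assumption; field; lra. }
assert (Ez : z = n6 * U ^ 3 / ((a + 2) ^ 2 * (a + 3) * (a + 4) * (a + 5) * V ^ 3)).
{ unfold z, U; rewrite zero_sum_3, Ew by assumption; fold n6; field; lra. }
assert (Er : r = 2 * n8 * nu9_shift a / (n6 * V)).
{ unfold r; rewrite zero_sum_3, zero_sum_4, Ew by assumption.
  fold n6 n8; field; lra. }
assert (Hx : x < 1).
{ rewrite Ex; apply Rlt_div_l; [assumption|]; apply Rminus_lt_0.
  unfold U, V, nu9_shift, nu10_shift; poly_pos. }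
split; [assumption|].
assert (Hc : 0 < n6 * V - 2 * n8 * nu9_shift a)
  by (unfold V, n6, n8, nu9_shift, nu10_shift; poly_pos).
assert (HnV : 0 < n6 * V) by (apply Rmult_lt_0_compat; assumption).
assert (Hr : r < 1) by (rewrite Er; apply Rlt_div_l; lra).
assert (E : 0 < (4 * x + 4 * y - 1) * (1 - r) + 4 * z).
{ replace ((4 * x + 4 * y - 1) * (1 - r) + 4 * z)
    with ((((4 * U - V) * V * ((a + 2) * (a + 3)) + 4 * p1 * U ^ 2)
           * (n6 * V - 2 * n8 * nu9_shift a) * ((a + 2) * (a + 4) * (a + 5))
           + 4 * n6 ^ 2 * U ^ 3)
          / (n6 * (a + 2) ^ 2 * (a + 3) * (a + 4) * (a + 5) * V ^ 3))
    by (rewrite Ex, Er, Ey, Ez; field; lra).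
  apply Rdiv_lt_0_compat.
  - unfold U, V, p1, n6, n8, nu9_shift, nu10_shift; poly_pos.
  - repeat apply Rmult_lt_0_compat; try apply pow_lt; lra. }
pose proof (zero_sum_lower a w 2 r Ha ltac:(lra) Hx eq_refl Hr) as H.
cbn [sum_f_R0] in H; rewrite zero_sum_0, pow_1 in H; fold x y z in H.
apply Rlt_le_trans with (2 := H).
apply Rmult_lt_reg_r with (4 * (1 - r)); [lra|].
replace ((0 * w ^ 0 + x + y + z / (1 - r)) * (4 * (1 - r)))
  with (4 * (x + y) * (1 - r) + 4 * z) by (field; lra).
lra.
Qed.

(** There is more than one zero. *)
Lemma zero_sum_2_lt : forall a, 0 < a -> zero_sum a 2 < zero_sum a 1 ^ 2.
Proof.
intros a Ha; rewrite zero_sum_1, zero_sum_2 by assumption.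
assert (Hd : 0 < 256 * a ^ 4 * (a + 1) ^ 2 * (a + 2) * (a + 3))
  by (repeat apply Rmult_lt_0_compat; try apply pow_lt; lra).
apply Rlt_div_l; [assumption|].
replace ((/ (16 * a ^ 2 * (a + 1))) ^ 2 * (256 * a ^ 4 * (a + 1) ^ 2 * (a + 2) * (a + 3)))
  with ((a + 2) * (a + 3)) by (field; lra).
nra.
Qed.

Lemma zero_sum_scaled_upper : forall a w n g, 0 < a -> 0 < w -> zero_sum a 1 * w < 1 ->
  g = root (S n) (zero_sum a (S n) * w ^ S n) ->
  0 < g < 1 /\ zero_sum a (S n) * w ^ S n = g ^ S n /\
  PSeries (zero_sum a) w <= sum_f_R0 (fun k => zero_sum a k * w ^ k) n + g ^ S n / (1 - g).
Proof.
intros a w n g Ha Hw H Eg.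
pose proof (zero_sum_pos a n Ha) as Hn; pose proof (zero_sum_pos a 0 Ha) as H1.
assert (Hp : 0 < zero_sum a (S n) * w ^ S n)
  by (apply Rmult_lt_0_compat; [|apply pow_lt]; assumption).
assert (Hg0 : 0 < g) by (rewrite Eg; apply root_pos).
assert (E : zero_sum a (S n) * w ^ S n = g ^ S n)
  by (rewrite Eg, root_pow; [reflexivity|assumption]).
assert (Hg1 : g < 1).
{ apply (pow_lt_reg n); [lra| |lra]; rewrite pow1, <- E.
  pose proof (zero_sum_power_mean a 0 n Ha ltac:(lia)) as Hm; rewrite pow_1 in Hm.
  apply Rle_lt_trans with ((zero_sum a 1 * w) ^ S n).
  - rewrite Rpow_mult_distr; apply Rmult_le_compat_r; [apply pow_le; lra|assumption].
  - rewrite <- (pow1 (S n)); apply pow_lt_compat; [|assumption].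
    apply Rmult_le_pos; lra. }
split; [split; assumption|]; split; [assumption|].
apply zero_sum_upper; [assumption|lra|assumption|lra|assumption].
Qed.

Lemma zero_sum_upper_2 : forall a w, 0 < a -> 0 < w -> zero_sum a 1 * w < 1 ->
  exists g, 0 < g < 1 /\ zero_sum a 2 * w ^ 2 = g ^ 2 /\ g < zero_sum a 1 * w /\
  PSeries (zero_sum a) w <= zero_sum a 1 * w + g ^ 2 / (1 - g).
Proof.
intros a w Ha Hw H.
destruct (zero_sum_scaled_upper a w 1 _ Ha Hw H eq_refl) as (Hg & E & Hle).
set (g := root 2 (zero_sum a 2 * w ^ 2)) in *.
exists g; split; [assumption|]; split; [assumption|]; split.
- pose proof (zero_sum_pos a 0 Ha); apply (pow_lt_reg 1); [nra| |lra].
  rewrite <- E, Rpow_mult_distr; apply Rmult_lt_compat_r; [apply pow_lt; assumption|].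
  apply zero_sum_2_lt; assumption.
- apply Rle_trans with (1 := Hle); cbn [sum_f_R0]; rewrite zero_sum_0, pow_1; lra.
Qed.

(** Here [w = 1 / sigma_1]. The bound [m_k <= m_1^k] alone gives
    [M(w) <= 1/4]; keeping the second sum makes it strict. *)
Lemma euler_rayleigh_lower_1 : forall a w, 0 < a -> 0 < w -> 5 * zero_sum a 1 * w = 1 ->
  zero_sum a 1 * w < 1 /\ PSeries (zero_sum a) w < / 4.
Proof.
intros a w Ha Hw E; assert (H : zero_sum a 1 * w < 1) by lra; split; [assumption|].
destruct (zero_sum_upper_2 a w Ha Hw H) as (g & Hg & _ & Hgx & Hle).
apply Rle_lt_trans with (1 := Hle).
replace (zero_sum a 1 * w) with (/ 5) by lra.
assert (g ^ 2 / (1 - g) < / 20); [|lra].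
apply Rlt_div_l; [lra|]; nra.
Qed.

(** Here [w = sigma_2^(-1/2)]. With [x = m_1 w] and
    [g^2 = m_2 w^2] one has [16 x^2 + 9 g^2 = 1] and [x > g], hence [g < 1/5], and
    [4 (x + g^2 / (1 - g)) < 1] becomes [0 < g^2 (1 - 5 g)^2] after squaring. *)
Lemma euler_rayleigh_lower_2 : forall a w, 0 < a -> 0 < w ->
  (16 * zero_sum a 1 ^ 2 + 9 * zero_sum a 2) * w ^ 2 = 1 ->
  zero_sum a 1 * w < 1 /\ PSeries (zero_sum a) w < / 4.
Proof.
intros a w Ha Hw E.
pose proof (zero_sum_pos a 0 Ha); pose proof (zero_sum_pos a 1 Ha).
assert (Hw2 : 0 < w ^ 2) by (apply pow_lt; assumption).
assert (H16 : 16 * (zero_sum a 1 * w) ^ 2 + 9 * (zero_sum a 2 * w ^ 2) = 1)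
  by (rewrite <- E; ring).
set (x := zero_sum a 1 * w) in *.
assert (Hx0 : 0 < x) by (unfold x; nra).
assert (Hy0 : 0 < zero_sum a 2 * w ^ 2) by nra.
assert (H1 : x < 1) by nra.
split; [assumption|].
destruct (zero_sum_upper_2 a w Ha Hw H1) as (g & Hg & Eg & Hgx & Hle).
fold x in Hgx, Hle; rewrite Eg in H16.
apply Rle_lt_trans with (1 := Hle).
assert (Hg5 : g < / 5) by nra.
assert (Hq : 0 < 1 - g - 4 * g ^ 2) by nra.
assert (K : 4 * x * (1 - g) < 1 - g - 4 * g ^ 2).
{ apply (pow_lt_reg 1); [lra| |nra].
  replace ((4 * x * (1 - g)) ^ 2) with ((16 * x ^ 2) * (1 - g) ^ 2) by ring.
  replace (16 * x ^ 2) with (1 - 9 * g ^ 2) by lra.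
  apply Rminus_lt_0.
  replace ((1 - g - 4 * g ^ 2) ^ 2 - (1 - 9 * g ^ 2) * (1 - g) ^ 2)
    with ((g * (1 - 5 * g)) ^ 2) by ring.
  apply pow_lt; nra. }
apply Rmult_lt_reg_r with (4 * (1 - g)); [lra|].
replace ((x + g ^ 2 / (1 - g)) * (4 * (1 - g)))
  with (4 * x * (1 - g) + 4 * g ^ 2) by (field; lra).
lra.
Qed.

(** The algebraic content of the bound by [sigma_3]. Assume the contrary and put
    [s = 1 - x]. First, [s >= 4 g^2 / (1 - g)]: otherwise the cubic form would exceed
    its value at [x = 1 - 4 g^2 / (1 - g)], [y = 4 g^2], which is
    [1 + (g (1 - 5 g) / (1 - g))^3]. Next, [s < g]: otherwise [x <= 1 - g], and the
    assumption would make [y] too large for [y^2 <= 4 x g^3]. Finally the cubic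
    equation and the assumption give
    [(g - s) ((1 - g) (g^2 + g s + s^2) - 12 g^3) <= 0], where both factors are
    positive: by the lower bound for [s], the second one is at least
    [g^2 (1 - 5 g)^2 / (1 - g)]. *)
Lemma cubic_bound : forall x y g, 0 < g -> g < 1 ->
  4 * g < x -> 4 * g ^ 2 <= y -> y ^ 2 <= 4 * x * g ^ 3 ->
  x ^ 3 + 3 * x * y + 13 * g ^ 3 = 1 ->
  (x + y) * (1 - g) + 4 * g ^ 3 < 1 - g.
Proof.
intros x y g Hg Hg1 Hx Hy Hyx E.
assert (Hg2 : 0 < g ^ 2) by (apply pow_lt; assumption).
assert (Hg3 : 0 < g ^ 3) by (apply pow_lt; assumption).
assert (Hx0 : 0 < x) by lra.
assert (Hxy : 4 * g * (4 * g ^ 2) < x * y).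
{ apply Rlt_le_trans with (x * (4 * g ^ 2)).
  - apply Rmult_lt_compat_r; lra.
  - apply Rmult_le_compat_l; lra. }
assert (Hx3 : (4 * g) ^ 3 < x ^ 3) by (apply pow_lt_compat; lra).
assert (Hg5 : 5 * g < 1).
{ apply (pow_lt_reg 2); [lra| |lra].
  replace ((5 * g) ^ 3) with ((4 * g) ^ 3 + 3 * (4 * g * (4 * g ^ 2)) + 13 * g ^ 3) by ring.
  rewrite pow1; lra. }
assert (Hx1 : x < 1) by (apply (pow_lt_reg 2); [lra| |lra]; rewrite pow1; nra).
destruct (Rlt_le_dec ((x + y) * (1 - g) + 4 * g ^ 3) (1 - g)) as [|Hc];
  [assumption|exfalso].
set (s := 1 - x).
assert (HA : 4 * g ^ 2 <= s * (1 - g)).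
{ apply Rnot_lt_le; intros Hlt.
  assert (Hx' : 1 - g - 4 * g ^ 2 < x * (1 - g)) by (unfold s in Hlt; lra).
  assert (Hp : 0 < 1 - g - 4 * g ^ 2) by nra.
  assert (H3 : (1 - g - 4 * g ^ 2) ^ 3 < (x * (1 - g)) ^ 3) by (apply pow_lt_compat; lra).
  assert (H4 : 12 * g ^ 2 * (1 - g) ^ 2 * (1 - g - 4 * g ^ 2)
    <= 3 * y * (1 - g) ^ 2 * (x * (1 - g))).
  { assert (0 < (1 - g) ^ 2) by (apply pow_lt; lra).
    apply Rmult_le_compat; try nra; lra. }
  assert (H5 : 0 < (g * (1 - 5 * g)) ^ 3) by (apply pow_lt; nra).
  assert (H6 : (x * (1 - g)) ^ 3 + 3 * y * (1 - g) ^ 2 * (x * (1 - g))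
     + 13 * g ^ 3 * (1 - g) ^ 3 = (1 - g) ^ 3).
  { replace ((1 - g) ^ 3) with (1 * (1 - g) ^ 3) at 2 by ring; rewrite <- E; ring. }
  assert (H7 : (1 - g - 4 * g ^ 2) ^ 3 + 12 * g ^ 2 * (1 - g) ^ 2 * (1 - g - 4 * g ^ 2)
    + 13 * g ^ 3 * (1 - g) ^ 3 = (1 - g) ^ 3 + (g * (1 - 5 * g)) ^ 3) by ring.
  lra. }
assert (Hyl : s * (1 - g) - 4 * g ^ 3 <= y * (1 - g)) by (unfold s; lra).
assert (HB : s < g).
{ apply Rnot_le_lt; intros Hle.
  assert (L : g * (1 - g - 4 * g ^ 2) <= y * (1 - g)).
  { apply Rle_trans with (2 := Hyl).
    replace (g * (1 - g - 4 * g ^ 2)) with (g * (1 - g) - 4 * g ^ 3) by ring.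
    assert (g * (1 - g) <= s * (1 - g)) by (apply Rmult_le_compat_r; lra); lra. }
  assert (Hp : 0 < 1 - g - 4 * g ^ 2) by nra.
  assert (Q : (g * (1 - g - 4 * g ^ 2)) ^ 2 <= (y * (1 - g)) ^ 2)
    by (apply pow_incr; split; [apply Rmult_le_pos; lra|assumption]).
  assert (Q2 : (y * (1 - g)) ^ 2 <= 4 * (1 - g) * g ^ 3 * (1 - g) ^ 2).
  { rewrite Rpow_mult_distr; apply Rmult_le_compat_r; [apply pow2_ge_0|].
    apply Rle_trans with (1 := Hyx); apply Rmult_le_compat_r; [lra|].
    unfold s in Hle; lra. }
  assert (Q3 : (g * (1 - g - 4 * g ^ 2)) ^ 2 - 4 * (1 - g) * g ^ 3 * (1 - g) ^ 2
    = g ^ 2 * ((1 - 5 * g) * (1 - g - 4 * g ^ 3))) by ring.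
  assert (0 < 1 - g - 4 * g ^ 3) by nra.
  assert (0 < g ^ 2 * ((1 - 5 * g) * (1 - g - 4 * g ^ 3)))
    by (repeat apply Rmult_lt_0_compat; lra).
  lra. }
assert (Hs0 : 0 < s) by (unfold s; lra).
assert (HC : g ^ 3 * (1 - 13 * g + 12 * s) <= s ^ 3 * (1 - g)).
{ assert (Hm : 3 * x * (s * (1 - g) - 4 * g ^ 3) <= 3 * x * (y * (1 - g)))
    by (apply Rmult_le_compat_l; lra).
  assert (E' : x ^ 3 * (1 - g) + 3 * x * (y * (1 - g)) + 13 * g ^ 3 * (1 - g) = 1 - g).
  { replace (1 - g) with (1 * (1 - g)) at 4 by ring; rewrite <- E; ring. }
  assert (Es : x = 1 - s) by (unfold s; ring).
  rewrite Es in Hm, E'; nra. }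
assert (HF : (g - s) * ((1 - g) * (g ^ 2 + g * s + s ^ 2) - 12 * g ^ 3) <= 0).
{ replace ((g - s) * ((1 - g) * (g ^ 2 + g * s + s ^ 2) - 12 * g ^ 3))
    with (g ^ 3 * (1 - 13 * g + 12 * s) - s ^ 3 * (1 - g)) by ring; lra. }
assert (HG : 0 < (1 - g) * (g ^ 2 + g * s + s ^ 2) - 12 * g ^ 3).
{ apply Rmult_lt_reg_r with (1 - g); [lra|]; rewrite Rmult_0_l.
  assert (S2 : (4 * g ^ 2) ^ 2 <= (s * (1 - g)) ^ 2) by (apply pow_incr; lra).
  assert (S1 : g * (1 - g) * (4 * g ^ 2) <= g * (1 - g) * (s * (1 - g)))
    by (apply Rmult_le_compat_l; nra).
  apply Rlt_le_trans with (g ^ 2 * (1 - 5 * g) ^ 2).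
  - apply Rmult_lt_0_compat; apply pow_lt; lra.
  - replace (((1 - g) * (g ^ 2 + g * s + s ^ 2) - 12 * g ^ 3) * (1 - g))
      with (g ^ 2 * (1 - g) ^ 2 + g * (1 - g) * (s * (1 - g)) + (s * (1 - g)) ^ 2
            - 12 * g ^ 3 * (1 - g)) by ring.
    replace (g ^ 2 * (1 - 5 * g) ^ 2)
      with (g ^ 2 * (1 - g) ^ 2 + g * (1 - g) * (4 * g ^ 2) + (4 * g ^ 2) ^ 2
            - 12 * g ^ 3 * (1 - g)) by ring.
    lra. }
nra.
Qed.

(** Here [w = sigma_3^(-1/3)]; the hypotheses of [cubic_bound] are met by
    [x = 4 m_1 w], [y = 4 m_2 w^2] and [g^3 = m_3 w^3]. *)
Lemma euler_rayleigh_lower_3 : forall a w, 0 < a -> 0 < w ->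
  (64 * zero_sum a 1 ^ 3 + 48 * zero_sum a 1 * zero_sum a 2 + 13 * zero_sum a 3) * w ^ 3 = 1 ->
  zero_sum a 1 * w < 1 /\ PSeries (zero_sum a) w < / 4.
Proof.
intros a w Ha Hw E.
pose proof (zero_sum_pos a 0 Ha); pose proof (zero_sum_pos a 1 Ha); pose proof (zero_sum_pos a 2 Ha).
assert (Hw2 : 0 < w ^ 2) by (apply pow_lt; assumption).
assert (Hw3 : 0 < w ^ 3) by (apply pow_lt; assumption).
set (x := 4 * (zero_sum a 1 * w)); set (y := 4 * (zero_sum a 2 * w ^ 2)).
assert (Hx0 : 0 < x) by (unfold x; nra).
assert (Hy0 : 0 < y) by (unfold y; nra).
assert (Hz0 : 0 < zero_sum a 3 * w ^ 3) by nra.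
assert (Exy : x ^ 3 + 3 * x * y + 13 * (zero_sum a 3 * w ^ 3) = 1)
  by (rewrite <- E; unfold x, y; ring).
assert (Hx1 : zero_sum a 1 * w < 1).
{ assert (x < 1); [|unfold x in *; lra].
  apply (pow_lt_reg 2); [lra| |lra]; rewrite pow1.
  assert (0 < x * y) by (apply Rmult_lt_0_compat; assumption); lra. }
split; [assumption|].
destruct (zero_sum_scaled_upper a w 2 _ Ha Hw Hx1 eq_refl) as (Hg & Eg & Hle).
set (g := root 3 (zero_sum a 3 * w ^ 3)) in *.
rewrite Eg in Exy; cbn [sum_f_R0] in Hle; rewrite zero_sum_0, pow_1 in Hle.
apply Rle_lt_trans with (1 := Hle).
assert (Hgy : 4 * g ^ 2 <= y).
{ unfold y; apply Rmult_le_compat_l; [lra|].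
  apply Rnot_lt_le; intros Hlt.
  assert (Hc : (zero_sum a 2 * w ^ 2) ^ 3 < (g ^ 2) ^ 3) by (apply pow_lt_compat; nra).
  replace ((g ^ 2) ^ 3) with ((g ^ 3) ^ 2) in Hc by ring; rewrite <- Eg in Hc.
  pose proof (zero_sum_power_mean a 1 2 Ha ltac:(lia)) as Hm.
  replace ((zero_sum a 2 * w ^ 2) ^ 3) with (zero_sum a 2 ^ 3 * w ^ 6) in Hc by ring.
  replace ((zero_sum a 3 * w ^ 3) ^ 2) with (zero_sum a 3 ^ 2 * w ^ 6) in Hc by ring.
  assert (0 < w ^ 6) by (apply pow_lt; assumption); nra. }
assert (Hyx : y < x ^ 2 / 4).
{ unfold x, y; pose proof (zero_sum_2_lt a Ha); nra. }
assert (Hgx : 4 * g < x) by (apply (pow_lt_reg 1); nra).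
assert (Hlc : y ^ 2 <= 4 * x * g ^ 3).
{ rewrite <- Eg; unfold x, y; pose proof (zero_sum_log_convex a 0 Ha) as Hm.
  assert (0 < w ^ 4) by (apply pow_lt; assumption).
  replace ((4 * (zero_sum a 2 * w ^ 2)) ^ 2) with (16 * w ^ 4 * (zero_sum a 2 * zero_sum a 2)) by ring.
  replace (4 * (4 * (zero_sum a 1 * w)) * (zero_sum a 3 * w ^ 3))
    with (16 * w ^ 4 * (zero_sum a 1 * zero_sum a 3)) by ring.
  apply Rmult_le_compat_l; [lra|assumption]. }
pose proof (cubic_bound x y g ltac:(lra) ltac:(lra) Hgx Hgy Hlc Exy) as K.
apply Rmult_lt_reg_r with (4 * (1 - g)); [lra|].
replace ((0 * w ^ 0 + zero_sum a 1 * w + zero_sum a 2 * w ^ 2 + g ^ 3 / (1 - g)) * (4 * (1 - g)))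
  with ((x + y) * (1 - g) + 4 * g ^ 3) by (unfold x, y; field; lra).
lra.
Qed.

(** * Bounds for the radius *)

Lemma two_root_4 : forall x, 0 < x -> 2 * root 4 x = root 4 (16 * x).
Proof.
intros x Hx; pose proof (root_pos 4 x); pose proof (root_pos 4 (16 * x)).
apply (pow_inj_pos 3); [lra|lra|].
rewrite Rpow_mult_distr, !root_pow by lra; ring.
Qed.

Lemma two_root_8 : forall x, 0 < x -> 2 * root 8 x = root 4 (root 2 (256 * x)).
Proof.
intros x Hx; pose proof (root_pos 8 x).
pose proof (root_pos 4 (root 2 (256 * x))); pose proof (root_pos 2 (256 * x)).
apply (pow_inj_pos 7); [lra|lra|].
rewrite Rpow_mult_distr, (root_pow 7) by lra.
replace (root 4 (root 2 (256 * x)) ^ 8) with ((root 4 (root 2 (256 * x)) ^ 4) ^ 2) by ring.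
rewrite (root_pow 3), (root_pow 1) by lra; ring.
Qed.

Lemma root_12 : forall x, 0 < x -> root 12 x = root 4 (root 3 x).
Proof.
intros x Hx; pose proof (root_pos 12 x).
pose proof (root_pos 4 (root 3 x)); pose proof (root_pos 3 x).
apply (pow_inj_pos 11); [lra|lra|].
rewrite (root_pow 11) by lra.
replace (root 4 (root 3 x) ^ 12) with ((root 4 (root 3 x) ^ 4) ^ 3) by ring.
rewrite (root_pow 3), (root_pow 2) by lra; reflexivity.
Qed.

Lemma A_shift : forall a, 16 * (a - 1) ^ 2 + 157 * (a - 1) + 291 = 150 + a * (125 + a * 16).
Proof. intros a; ring. Qed.
Lemma nu9_eq : forall a, nu9 (a - 1) = nu9_shift a.
Proof. intros a; unfold nu9, nu9_shift; ring. Qed.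
Lemma nu10_eq : forall a, nu10 (a - 1) = nu10_shift a.
Proof. intros a; unfold nu10, nu10_shift; ring. Qed.

Theorem theorem10 : forall nu : R, -1 < nu ->
  Rbar_lt (radius_starlikeness (v nu))
    (Finite (root 4 (4 * (nu + 1) ^ 2 * (nu + 2))))
  /\
  (Rbar_lt (Finite (2 * root 4 ((nu + 1) ^ 2 * (nu + 2) / 5)))
     (radius_starlikeness (v nu))
   /\
   Rbar_lt (radius_starlikeness (v nu))
     (Finite (2 * root 4 (5 * (nu + 1) * pochhammer (nu + 1) 4
                          / (16 * nu ^ 2 + 157 * nu + 291)))))
  /\
  (Rbar_lt (Finite (2 * root 8 (pochhammer (nu + 1) 4 * (nu + 1) ^ 3 * (nu + 2)
                                / (16 * nu ^ 2 + 157 * nu + 291))))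
     (radius_starlikeness (v nu))
   /\
   Rbar_lt (radius_starlikeness (v nu))
     (Finite (root 4 (8 * (nu + 1) * pochhammer (nu + 1) 3
                      * pochhammer (nu + 5) 2
                      * (16 * nu ^ 2 + 157 * nu + 291) / nu9 nu))))
  /\
  (Rbar_lt (Finite (root 12 (2 ^ 11 * pochhammer (nu + 1) 3
                             * pochhammer (nu + 1) 6 * (nu + 1) ^ 4 * (nu + 2)
                             / nu9 nu)))
     (radius_starlikeness (v nu))
   /\
   Rbar_lt (radius_starlikeness (v nu))
     (Finite (2 * root 4 (2 * (nu + 1) ^ 2 * (nu + 2) * (nu + 4)
                          * pochhammer (nu + 7) 2 * nu9 nu / nu10 nu)))).
Proof.
intros nu Hnu; rewrite v_quartic by assumption.
set (a := nu + 1); assert (Ha : 0 < a) by (unfold a; lra).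
assert (Enu : nu = a - 1) by (unfold a; ring).
clearbody a; subst nu; rewrite A_shift, nu9_eq, nu10_eq.
replace (a - 1 + 2) with (a + 1) by ring; replace (a - 1 + 4) with (a + 3) by ring.
replace (a - 1 + 5) with (a + 4) by ring; replace (a - 1 + 7) with (a + 6) by ring.
assert (HA : 0 < 150 + a * (125 + a * 16)) by poly_pos.
assert (H9 : 0 < nu9_shift a) by (unfold nu9_shift; poly_pos).
assert (H10 : 0 < nu10_shift a) by (unfold nu10_shift; poly_pos).
set (A := 150 + a * (125 + a * 16)) in *.
cbn [pochhammer]; replace (INR 0) with 0 by reflexivity.
replace (INR 1) with 1 by reflexivity.
replace (INR 2) with 2 by (cbn; ring); replace (INR 3) with 3 by (cbn; ring).
replace (INR 4) with 4 by (cbn; ring); replace (INR 5) with 5 by (cbn; ring).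
split; [|split; [split|split; split]].
- set (w := 4 * a ^ 2 * (a + 1)).
  destruct (first_term_upper a w Ha) as [H1 H]; [unfold w; ring|].
  apply radius_lt; try assumption; unfold w; poly_pos.
- rewrite two_root_4 by (apply Rdiv_lt_0_compat; [poly_pos|lra]).
  set (w := 16 * (a ^ 2 * (a + 1) / 5)).
  assert (Hw : 0 < w)
    by (apply Rmult_lt_0_compat; [lra|apply Rdiv_lt_0_compat; [poly_pos|lra]]).
  destruct (euler_rayleigh_lower_1 a w Ha Hw) as [H1 H].
  { unfold w; rewrite zero_sum_1 by assumption; field; lra. }
  apply radius_gt; assumption.
- match goal with |- context [2 * root 4 ?e] =>
    assert (He : 0 < e) by (apply Rdiv_lt_0_compat; [poly_pos|assumption]);
    rewrite (two_root_4 e He); set (w := 16 * e) end.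
  destruct (euler_rayleigh_upper_1 a w Ha) as [H1 H].
  { unfold w; fold A; field; lra. }
  apply radius_lt; try assumption; unfold w; lra.
- match goal with |- context [2 * root 8 ?e] =>
    assert (He : 0 < e) by (apply Rdiv_lt_0_compat; [poly_pos|assumption]);
    rewrite (two_root_8 e He); set (w := root 2 (256 * e)) end.
  assert (Hw : 0 < w) by apply root_pos.
  assert (Hw2 : w ^ 2 = _) by (apply (root_pow 1); lra).
  destruct (euler_rayleigh_lower_2 a w Ha Hw) as [H1 H].
  { rewrite Hw2, zero_sum_1, zero_sum_2 by assumption; unfold A; field; fold A; lra. }
  apply radius_gt; assumption.
- match goal with |- context [root 4 ?e] =>
    assert (He : 0 < e) by (apply Rdiv_lt_0_compat;
      [apply Rmult_lt_0_compat; [poly_pos|assumption]|assumption]); set (w := e) in * end.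
  destruct (euler_rayleigh_upper_2 a w Ha) as [H1 H].
  { unfold w; fold A; field; lra. }
  apply radius_lt; assumption.
- match goal with |- context [root 12 ?e] =>
    assert (He : 0 < e) by (apply Rdiv_lt_0_compat; [poly_pos|assumption]);
    rewrite (root_12 e He); set (w := root 3 e) end.
  assert (Hw : 0 < w) by apply root_pos.
  assert (Hw3 : w ^ 3 = _) by (apply (root_pow 2); exact He).
  destruct (euler_rayleigh_lower_3 a w Ha Hw) as [H1 H].
  { rewrite Hw3, zero_sum_1, zero_sum_2, zero_sum_3 by assumption.
    unfold nu9_shift in *; field; lra. }
  apply radius_gt; assumption.
- match goal with |- context [2 * root 4 ?e] =>
    assert (He : 0 < e) by (apply Rdiv_lt_0_compat;
      [apply Rmult_lt_0_compat; [poly_pos|assumption]|assumption]);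
    rewrite (two_root_4 e He); set (w := 16 * e) end.
  destruct (euler_rayleigh_upper_3 a w Ha) as [H1 H].
  { unfold w; field; lra. }
  apply radius_lt; try assumption; unfold w; lra.
Qed.
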